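(* The following decision problem is coNP-complete: given a target arena $\mathcal{A}=(V,V_P,E,T)$, a non-empty vertex set $W\subseteq V$ and a vertex $v\in V$, determine whether $v\unlhd W$. Moreover, it remains coNP-hard even when restricted to target arenas in which $|uE|=1$ for all $u\in V_P$.
   Context: A target arena is a tuple $\mathcal{A}=(V,V_P,E,T)$ where $V$ is finite, $V_P\subseteq V$, $V_N:=V\setminus V_P$, $E\subseteq (V_P\times V_N)\cup(V_N\times V_P)$, $T\subseteq V_P$, and $uE:=\{v\mid (u,v)\in E\}\neq\emptyset$ for all $u\in V_N$. A family of full-support probability distributions is $\mu=(\mu_u)_{u\in V_N}$ with each $\mu_u:uE\to\mathbb{Q}_{>0}$ summing to $1$. A strategy is a function $\sigma:V_P\to V_N$. The arena, $\mu$ and $\sigma$ induce the Markov chain on $V_P\cup\{\bot\}$ in which from $p\in V_P$ the next state is $q$ with probability $\mu_{\sigma(p)}(q)$ if $(p,\sigma(p))\in E$, and $\bot$ with probability $1$ otherwise; $\bot$ is absorbing. $\mathrm{Val}^\mu(v):=\max_\sigma$ (probability of eventually reaching $T$ from $v$ in this chain) for $v\in V_P$, and $\mathrm{Val}^\mu(u):=\sum_{v\in uE}\mu_u(v)\mathrm{Val}^\mu(v)$ for $u\in V_N$. For $v\in V$, $W\subseteq V$: $v\unlhd W$ iff for every full-support family $\mu$ there exists $w\in W$ with $\mathrm{Val}^\mu(v)\le\mathrm{Val}^\mu(w)$. The arena is given explicitly as a finite graph. *)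

(* Defs.v *)
From HB Require Import structures.
(* Loaded first, so that set notions below are those of finset. *)
From mathcomp Require Import classical_sets reals topology normedtype.
From mathcomp Require Import sequences.
From mathcomp Require Import all_boot all_order all_algebra.

Set Implicit Arguments.
Unset Strict Implicit.
Unset Printing Implicit Defensive.

Import Order.TTheory GRing.Theory Num.Theory numFieldNormedType.Exports.

(** * Deterministic multi-tape Turing machines *)

Inductive move := MoveLeft | Stay | MoveRight.

(* Tapes are one-way infinite; moving left from cell 0 has no effect. *)
Definition shift (m : move) (i : nat) : nat :=
  match m with MoveLeft => i.-1 | Stay => i | MoveRight => i.+1 end.

(* The machine has [tm_last.+1] tapes; it ignores [tm_delta] once halted. *)
Record tm := TM {
  tm_state : finType;
  tm_sym : finType;
  tm_last : nat;
  tm_lend : tm_sym;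
  tm_blank : tm_sym;
  tm_bit : bool -> tm_sym;
  tm_uniq : uniq [:: tm_lend; tm_blank; tm_bit false; tm_bit true];
  tm_init : tm_state;
  tm_halt : pred tm_state;
  tm_delta : tm_state -> {ffun 'I_tm_last.+1 -> tm_sym} ->
             tm_state * {ffun 'I_tm_last.+1 -> tm_sym * move} }.

Record config (M : tm) := Config {
  cf_state : tm_state M;
  cf_tape : 'I_(tm_last M).+1 -> nat -> tm_sym M;
  cf_head : 'I_(tm_last M).+1 -> nat }.

Definition tape_of (M : tm) (s : seq bool) : nat -> tm_sym M :=
  nth (tm_blank M) (tm_lend M :: map (@tm_bit M) s).

Definition init_config (M : tm) (s : seq bool) : config M :=
  Config (tm_init M) (fun t => tape_of M (if t == ord0 then s else [::]))
         (fun=> 0).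

Definition step (M : tm) (c : config M) : config M :=
  if tm_halt (cf_state c) then c else
  let: (q, act) :=
    tm_delta (cf_state c) [ffun t => cf_tape c t (cf_head c t)] in
  Config q
    (fun t i => if i == cf_head c t then (act t).1 else cf_tape c t i)
    (fun t => shift (act t).2 (cf_head c t)).

(* The input is on the first tape and the output on the last one (the same tape
   if there is only one). *)
Definition outputs_in (M : tm) (s : seq bool) (n : nat) (y : seq bool) : Prop :=
  let c := iter n (@step M) (init_config M s) in
  tm_halt (cf_state c) /\ cf_tape c ord_max =1 tape_of M y.

(** * Complexity classes of languages over {0,1} *)

Definition polytime (f : seq bool -> seq bool) : Prop :=
  exists (M : tm) (p : {poly nat}), forall s,
    exists2 n, n <= (p.[size s])%R & outputs_in M s n (f s).

Definition language := seq bool -> Prop.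

(* Self-delimiting: each bit of [s] is preceded by 1, and 0 marks the end. *)
Definition pair_bits (s u : seq bool) : seq bool :=
  flatten [seq [:: true; b] | b <- s] ++ false :: u.

Definition NP (L : language) : Prop :=
  exists (p : {poly nat}) (verify : seq bool -> bool),
    polytime (fun s => [:: verify s]) /\
    forall s, L s <->
      exists2 u, size u <= (p.[size s])%R & verify (pair_bits s u).

Definition coNP (L : language) : Prop := NP (fun s => ~ L s).

Record decision_problem := DecisionProblem {
  instance : Type;
  encode : instance -> seq bool;
  yes : instance -> Prop }.

Definition language_of (D : decision_problem) : language :=
  fun s => exists2 x : instance D, encode x = s & yes x.

(* Karp reductions; they are required to produce genuine instances only, which
   matters when the set of instances is restricted. *)
Definition reduces_to (L : language) (D : decision_problem) : Prop :=
  exists2 f, polytime f &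
    forall s, exists2 x : instance D, f s = encode x & (L s <-> yes x).

Definition coNP_hard (D : decision_problem) : Prop :=
  forall L, coNP L -> reduces_to L D.

Definition coNP_complete (D : decision_problem) : Prop :=
  coNP (language_of D) /\ coNP_hard D.

Definition restrict (D : decision_problem) (Q : instance D -> Prop) :=
  @DecisionProblem {x : instance D | Q x}
    (fun x => encode (sval x)) (fun x => yes (sval x)).

(** * Target arenas *)

Record target_arena (V : finType) := TargetArena {
  players : {set V};
  edges : {set V * V};
  targets : {set V};
  edges_bipartite :
    edges \subset setX players (~: players) :|: setX (~: players) players;
  targets_sub : targets \subset players;
  nature_live : [forall u in ~: players, [set v | (u, v) \in edges] != set0] }.

Section Value.
Context (R : realType) (V : finType) (A : target_arena V).

Definition out (u : V) : {set V} := [set v | (u, v) \in edges A].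

Definition playerT : finType := {p : V | p \in players A}.
Definition natureT : finType := {u : V | u \in ~: players A}.

(* [mu u v] stands for mu_u(v), extended by 0 outside [out u]; it is irrelevant for
   [u] in V_P. *)
Definition full_support_family (mu : V -> V -> rat) : Prop :=
  forall u, u \notin players A ->
    [/\ forall v, v \in out u -> (0 < mu u v)%R,
        forall v, v \notin out u -> mu u v = 0%R
      & (\sum_(v in out u) mu u v = 1)%R].

Definition strategy : finType := {ffun playerT -> natureT}.

(* [None] is the sink. *)
Definition mc_state : finType := option playerT.

Definition trans (mu : V -> V -> rat) (sigma : strategy) (s s' : mc_state) : rat :=
  match s with
  | Some p =>
      let u := val (sigma p) in
      if (val p, u) \in edges A then (if s' is Some q then mu u (val q) else 0%R)
      else (s' == None)%:R%R
  | None => (s' == None)%:R%R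
  end.

Definition hit : pred mc_state :=
  fun s => if s is Some p then val p \in targets A else false.

Fixpoint path_prob mu sigma (s : mc_state) (w : seq mc_state) : rat :=
  if w is s' :: w' then (trans mu sigma s s' * path_prob mu sigma s' w')%R
  else 1%R.

(* Probability that T is visited at one of the times 0, ..., n. *)
Definition reach_within mu sigma (s : mc_state) (n : nat) : rat :=
  (\sum_(w : n.-tuple mc_state | has hit (s :: w)) path_prob mu sigma s w)%R.

(* "Eventually" is the increasing union over n of "within n steps". *)
Definition reach mu sigma (s : mc_state) : R :=
  limn (fun n => ratr (reach_within mu sigma s n) : R).

(* The default [p \in T] of the maximum never exceeds the reachability
   probabilities, so it only matters when V_N is empty and no strategy exists:
   the value is then 1 on T and 0 elsewhere. *)
Definition valueP mu (p : playerT) : R :=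
  \big[Num.max/((val p \in targets A)%:R)%R]_(sigma : strategy)
    reach mu sigma (Some p).

Definition value mu (v : V) : R :=
  match insub v : option playerT with
  | Some p => valueP mu p
  | None => (\sum_(p : playerT | val p \in out v)
              ratr (mu v (val p)) * valueP mu p)%R
  end.

Definition never_worse (v : V) (W : {set V}) : Prop :=
  forall mu, full_support_family mu ->
    exists2 w, w \in W & (value mu v <= value mu w)%R.

End Value.

(** * The decision problem *)

Record nwr_instance := NwrInstance {
  nwr_size : nat;
  nwr_arena : target_arena 'I_nwr_size;
  nwr_set : {set 'I_nwr_size};
  nwr_vertex : 'I_nwr_size;
  nwr_set_neq0 : nwr_set != set0 }.

Definition bits (I : finType) (P : {pred I}) : seq bool :=
  [seq i \in P | i <- enum I].

(* The number of vertices in unary, then the characteristic vectors of V_P, T,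
   W, {v} and the adjacency matrix of E. *)
Definition nwr_encode (x : nwr_instance) : seq bool :=
  let A := nwr_arena x in
  nseq (nwr_size x) true ++ false ::
  bits (players A) ++ bits (targets A) ++ bits (nwr_set x) ++ bits (pred1 (nwr_vertex x)) ++
  bits (edges A).

Definition nwr_problem (R : realType) : decision_problem :=
  @DecisionProblem nwr_instance nwr_encode
    (fun x => never_worse R (nwr_arena x) (nwr_vertex x) (nwr_set x)).

Definition single_successor (x : nwr_instance) : Prop :=
  forall u, u \in players (nwr_arena x) -> #|out (nwr_arena x) u| = 1.

Lemma size_bits (I : finType) (P : {pred I}) : size (bits P) = #|I|.
Proof. by rewrite size_map -cardT. Qed.

Lemma bits_inj (I : finType) (P Q : {pred I}) : bits P = bits Q -> P =i Q.
Proof. by move=> /eq_in_map PQ i; apply: PQ; rewrite mem_enum. Qed.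

Lemma nwr_encode_inj : injective nwr_encode.
Proof.
have unary m n (s t : seq bool) :
    nseq m true ++ false :: s = nseq n true ++ false :: t -> m = n /\ s = t.
  elim: m n => [|m IHm] [|n] //= [].
  - by move=> ->.
  - by move=> /IHm [-> ->].
case=> [m A W v W0] [n B X w X0]; rewrite /nwr_encode /= => /unary [mn].
case: n / mn B X w X0 => B X w X0 /eqP.
rewrite eqseq_cat ?size_bits // => /andP[/eqP eVP].
rewrite eqseq_cat ?size_bits // => /andP[/eqP eT].
rewrite eqseq_cat ?size_bits // => /andP[/eqP eW].
rewrite eqseq_cat ?size_bits // => /andP[/eqP ev /eqP eE].
have {ev}: v = w by have /(_ v) := bits_inj ev; rewrite !inE eqxx => /esym/eqP.
have {eW}: W = X by apply/setP/bits_inj.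
move=> eW ev; have {eVP eT eE} eA: A = B.
  case: A B eVP eT eE => [PA EA TA a1 a2 a3] [PB EB TB b1 b2 b3] /=.
  move=> /bits_inj/setP eP /bits_inj/setP eT /bits_inj/setP eE.
  subst PB TB EB.
  by rewrite (bool_irrelevance a1 b1) (bool_irrelevance a2 b2)
             (bool_irrelevance a3 b3).
by subst w X B; rewrite (bool_irrelevance W0 X0).
Qed.

(* Main.v *)
Require Import Defs.
From mathcomp Require Import boolp classical_sets reals topology normedtype.
From mathcomp Require Import sequences.
From mathcomp Require Import all_boot all_order all_algebra.
From mathcomp Require Import zify.

(* Only the order of the values matters: v fails to be never worse than W exactly
   when the vertices can be layered in such a way that players never move up,
   every nature vertex has all its successors in its own layer or has some
   strictly below and some strictly above, every player in a positive layer can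
   stay in its layer while approaching T, and v lies strictly above W. Given mu,
   the layers are the ranks of the values, and an optimal positional strategy
   shows the approach to T; given the layers, mu is chosen such that the layer
   function is harmonic, and the maximum principle identifies it with the value.
   Layerings have polynomial size, hence membership in coNP.

   For hardness, the accepting runs of a verifier are described by a CNF, and a CNF
   by an arena without choices: V_i averages the two literals of variable i, each
   literal averages V_(i+1) and a sink, and V_n is the target. The values of the
   V_i increase and one of the two literals of each variable has at least the
   value of V_i, so the literals whose value is below that of V_0 are consistent.
   A clause averages its literals and the target; its value can be made smaller
   than that of V_0 exactly when one of its literals is below V_0.

   Both the verifier and the reduction are given by arithmetical expressions with
   bounded sums; Turing machines evaluate these in polynomial time with the head
   positions as unary counters. *)

Set Implicit Arguments.
Unset Strict Implicit.
Unset Printing Implicit Defensive.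

Import Order.TTheory GRing.Theory Num.Theory numFieldNormedType.Exports.

(** * Counter programs and their compilation to Turing machines *)

(** Harmonicity at a nature vertex is only a sign condition: positive weights balancing given
    numbers exist as soon as these all vanish or take both signs. Hence every admissible layering is
    realised by some family, and neither probabilities nor values have to be guessed. The layers
    alone would not do, since moves inside a layer may cycle without ever reaching the target; the
    rank [r] excludes this. Conversely, [r] is read off from one strategy that is optimal
    everywhere, whereas the value maximises over strategies vertex by vertex; policy improvement
    closes this gap.

    In the hardness proof, the target among the successors of a clause makes an empty clause a
    legitimate nature vertex, and lets every satisfied clause lie strictly between a true literal
    and the target.

    Numbers are kept in unary throughout: all those that occur are polynomially bounded. This is why
    counters suffice and why a language with bounded sums as its only iteration is expressive
    enough. *)

Definition upd (rho : nat -> nat) r x := fun i => if i == r then x else rho i.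

Inductive test := NonZero of nat | InBit | InSome | Never.

Inductive prog :=
  | Skip
  | Mv of nat & move
  | Emit of bool
  | Seq of prog & prog
  | While of test & prog
  | If of test & prog & prog.

(* Register 0 is the head of the input tape: cell 0 holds the end marker and cell
   i.+1 holds bit i. *)
Definition test_val (s : seq bool) (rho : nat -> nat) (t : test) : bool :=
  match t with
  | NonZero r => 0 < rho r
  | InBit => nth false (false :: s) (rho 0)
  | InSome => rho 0 <= size s
  | Never => false
  end.

Definition store := ((nat -> nat) * seq bool)%type.

(* [runs s p st st' n]: on input [s], [p] leads from [st] to [st'] in at most [n]
   machine steps. *)
Inductive runs (s : seq bool) : prog -> store -> store -> nat -> Prop :=
  | runs_skip st : runs s Skip st st 0
  | runs_mv r m rho o :
      runs s (Mv r m) (rho, o) (upd rho r (Defs.shift m (rho r)), o) 1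
  | runs_emit b rho o : runs s (Emit b) (rho, o) (rho, rcons o b) 1
  | runs_seq p q st1 st2 st3 m n :
      runs s p st1 st2 m -> runs s q st2 st3 n ->
      runs s (Seq p q) st1 st3 (m + n)
  | runs_while1 t p st1 st2 st3 m n : test_val s st1.1 t ->
      runs s p st1 st2 m -> runs s (While t p) st2 st3 n ->
      runs s (While t p) st1 st3 (m + n + 2)
  | runs_while0 t p st : ~~ test_val s st.1 t -> runs s (While t p) st st 1
  | runs_if1 t p q st st' n : test_val s st.1 t ->
      runs s p st st' n -> runs s (If t p q) st st' (n + 2)
  | runs_if0 t p q st st' n : ~~ test_val s st.1 t ->
      runs s q st st' n -> runs s (If t p q) st st' (n + 2)
  | runs_le p st st' m n : m <= n -> runs s p st st' m -> runs s p st st' n.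

Definition test_bound t := if t is NonZero r then r.+1 else 1.

Fixpoint prog_bound p : nat :=
  match p with
  | Mv r _ => r.+1
  | Seq p q => maxn (prog_bound p) (prog_bound q)
  | While t p => maxn (test_bound t) (prog_bound p)
  | If t p q => maxn (test_bound t) (maxn (prog_bound p) (prog_bound q))
  | _ => 0
  end.

(* [IBr t a] continues with the next instruction if [t] holds and jumps to
   address [a] otherwise. *)
Inductive ins := IMv of nat & move | IOut of bool | IBr of test & nat.

Fixpoint code_of p (a : nat) : seq ins :=
  match p with
  | Skip => [::]
  | Mv r m => [:: IMv r m]
  | Emit b => [:: IOut b]
  | Seq p q => let c := code_of p a in c ++ code_of q (a + size c)
  | While t p =>
      let c := code_of p a.+1 in
      IBr t (a + size c + 2) :: rcons c (IBr Never a)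
  | If t p q =>
      let c := code_of p a.+1 in
      let d := code_of q (a + size c + 2) in
      IBr t (a + size c + 2) :: c ++ IBr Never (a + size c + size d + 2) :: d
  end.

(** [None] is the end marker, [Some None] the blank and [Some (Some b)] a bit. A register is a head
    position on a tape whose contents never change, so it is zero exactly when the marker is
    scanned. *)
Definition cell := option (option bool).

(** * Simulation of counter programs by a multi-tape machine *)

Section Machine.
(* The tapes are the registers 0, ..., K and the output tape K.+1; the first
   instruction moves the output head off the end marker. *)
Variables (K : nat) (code : seq ins).

Definition tst_tape t := if t is NonZero r then r else 0.
Definition tst_cell t (x : cell) : bool :=
  match t with
  | NonZero _ => x != None
  | InBit => x == Some (Some true)
  | InSome => x != Some None
  | Never => false
  end.

Definition ins_tape (i : ins) : nat :=
  match i with IMv r _ => r | IOut _ => K.+1 | IBr t _ => tst_tape t end.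
Definition ins_act (i : ins) (x : cell) : cell * move :=
  match i with
  | IMv _ m => (x, m) | IOut b => (Some (Some b), MoveRight) | IBr _ _ => (x, Stay)
  end.
Definition ins_next (i : ins) (x : cell) (pc : nat) : nat :=
  if i is IBr t a then if tst_cell t x then pc.+1 else a else pc.+1.

Definition asm_delta (q : 'I_(size code).+1) (a : {ffun 'I_K.+2 -> cell}) :
    'I_(size code).+1 * {ffun 'I_K.+2 -> cell * move} :=
  let i := nth (IOut false) code q in
  let t0 := inord (ins_tape i) in
  (inord (ins_next i (a t0) q),
   [ffun t => if t == t0 then ins_act i (a t) else (a t, Stay)]).

Definition asm_tm : tm :=
  @TM 'I_(size code).+1 cell K.+1 None (Some None) (fun b => Some (Some b)) isT
    ord0 (fun q => q == size code :> nat) asm_delta.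

Definition cfg (s : seq bool) (pc : nat) (st : store) : config asm_tm :=
  @Config asm_tm (inord pc)
    (fun t => tape_of asm_tm
      (if t == ord0 then s else if t == ord_max then st.2 else [::]))
    (fun t => if t == ord_max then (size st.2).+1 else st.1 t).

Lemma tape_ofE (s : seq bool) i :
  tape_of asm_tm s i =
  if i is i'.+1 then if i' < size s then Some (Some (nth false s i'))
                     else Some None
  else None.
Proof.
case: i => [|i] //; rewrite /tape_of /=; case: ltnP => h.
  by rewrite (nth_map false).
by rewrite nth_default ?size_map.
Qed.

Lemma config_eq (c d : config asm_tm) :
  cf_state c = cf_state d -> cf_tape c =2 cf_tape d -> cf_head c =1 cf_head d ->
  c = d.
Proof.
case: c d => [q t h] [q' t' h'] /= -> tE hE.
have -> : t = t' by apply/funext => i; apply/funext => j; exact: tE.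
by have -> : h = h' by apply/funext.
Qed.

Lemma step_reg (s : seq bool) (c1 c2 : seq ins) i st :
  code = c1 ++ i :: c2 -> ins_tape i <= K ->
  let r := ins_tape i in
  let x := tape_of asm_tm (if r == 0 then s else [::]) (st.1 r) in
  (ins_act i x).1 = x ->
  step (cfg s (size c1) st) =
  cfg s (ins_next i x (size c1))
    (upd st.1 r (Defs.shift (ins_act i x).2 (st.1 r)), st.2).
Proof.
move=> cE rK r x xE.
have sc : size c1 < (size code).+1 by rewrite cE size_cat ltnS leq_addr.
have iE : nth (IOut false) code (size c1) = i.
  by rewrite cE nth_cat ltnn subnn.
have rE : (inord r : 'I_K.+2) = r :> nat by rewrite inordK // ltnS leqW.
have rnm : (inord r : 'I_K.+2) == ord_max = false.
  by apply/negbTE; rewrite -val_eqE /= rE neq_ltn ltnS rK.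
have r0 : ((inord r : 'I_K.+2) == ord0) = (r == 0).
  by rewrite -val_eqE /= rE.
rewrite /step /= inordK // {1}cE size_cat /= ltn_eqF; last by lia.
rewrite /asm_delta /= iE -/r.
apply: config_eq => /=.
  by rewrite !ffunE rnm r0 rE.
- move=> t j; rewrite !ffunE /=.
  case: (eqVneq t (inord r)) => [->|nt]; last first.
    by case: eqP => [-> | //]; rewrite ?rnm.
  rewrite rnm r0 rE /= -/x.
  case: eqP => [->|//].
  by rewrite xE.
- move=> t; rewrite !ffunE /= /upd.
  case: (eqVneq t (inord r)) => [->|nt] /=.
    by rewrite rnm rE eqxx r0.
  case: eqP => // tm.
  case: eqP => // tr; case/eqP: nt; apply/val_inj; rewrite /= rE //.
Qed.

Lemma step_out (s : seq bool) (c1 c2 : seq ins) b st :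
  code = c1 ++ IOut b :: c2 ->
  step (cfg s (size c1) st) = cfg s (size c1).+1 (st.1, rcons st.2 b).
Proof.
move=> cE.
have sc : size c1 < (size code).+1 by rewrite cE size_cat ltnS leq_addr.
have iE : nth (IOut false) code (size c1) = IOut b.
  by rewrite cE nth_cat ltnn subnn.
have rE : (inord K.+1 : 'I_K.+2) = ord_max by apply/val_inj; rewrite /= inordK.
rewrite /step /= inordK // {1}cE size_cat /= ltn_eqF; last by lia.
rewrite /asm_delta /= iE /= rE.
apply: config_eq => //=.
- move=> t j; rewrite !ffunE /=.
  case: (eqVneq t ord_max) => [->|nt]; last first.
    by rewrite /=; case: eqP => [-> | //].
  rewrite /= !tape_ofE.
  case: j => [|j] //=; rewrite size_rcons nth_rcons eqSS; case: eqP => [->|jo].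
    by rewrite ltnSn ltnn.
  by case: (ltngtP j (size st.2)) => h; rewrite ?ltnS ?(ltnW h) // leqNgt h.
- move=> t; rewrite !ffunE /=.
  by case: eqP => // _; rewrite size_rcons.
Qed.

Lemma test_cellP (s : seq bool) (st : store) t : test_bound t <= K.+1 ->
  tst_cell t (tape_of asm_tm (if tst_tape t == 0 then s else [::])
                (st.1 (tst_tape t)))
  = test_val s st.1 t.
Proof.
case: t => [r| | |] //= _; rewrite tape_ofE.
- by case: (st.1 r) => [|n] //; case: ifP.
- case: (st.1 0) => [|n] //=; case: ltnP => h; last by rewrite nth_default.
  by case: (nth _ _ _).
- by case: (st.1 0) => [|n] //=; case: ltnP.
Qed.

Lemma upd_same rho r : upd rho r (rho r) = rho.
Proof. by apply/funext => i; rewrite /upd; case: eqP => [->|]. Qed.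

Lemma step_br (s : seq bool) c1 c2 t a (st : store) : test_bound t <= K.+1 ->
  code = c1 ++ IBr t a :: c2 ->
  step (cfg s (size c1) st) =
  cfg s (if test_val s st.1 t then (size c1).+1 else a) st.
Proof.
move=> tb cE; rewrite (step_reg cE) //=; last by case: t tb {cE}.
by rewrite test_cellP // upd_same; case: st.
Qed.

(** The induction is on the run, since a loop unfolds into shorter runs of the same program. Jump
    addresses are absolute, so the code is placed behind an arbitrary prefix [c1] and compiled for
    the address [size c1]. *)
Lemma runs_sim s p st st' n : runs s p st st' n -> prog_bound p <= K.+1 ->
  forall c1 c2, code = c1 ++ code_of p (size c1) ++ c2 ->
  exists2 m, m <= n &
    iter m (@step asm_tm) (cfg s (size c1) st) =
    cfg s (size c1 + size (code_of p (size c1))) st'.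
Proof.
elim=> {p st st' n} /=.
- by move=> st _ c1 c2 _; exists 0 => //=; rewrite addn0.
- move=> r m rho o rK c1 c2 cE; exists 1 => //=.
  by rewrite addn1; apply: (step_reg cE).
- move=> b rho o _ c1 c2 cE; exists 1 => //=.
  by rewrite addn1; apply: (step_out _ _ cE).
- move=> p q st1 st2 st3 m n _ IHp _ IHq; rewrite geq_max => /andP[bp bq] c1 c2.
  set cp := code_of p _; rewrite -catA => cE.
  have [m' m'm e1] := IHp bp c1 _ cE.
  have := IHq bq (c1 ++ cp); rewrite size_cat => /(_ c2).
  rewrite -catA => /(_ cE) [n' n'n e2].
  exists (n' + m'); first by rewrite addnC leq_add.
  by rewrite iterD e1 e2 size_cat addnA.
- move=> t p st1 st2 st3 m n tv _ IHp _ IHw; rewrite geq_max => /andP[bt bp].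
  move=> c1 c2; set cp := code_of p _ => cE.
  have bw : maxn (test_bound t) (prog_bound p) <= K.+1 by rewrite geq_max bt.
  have [n' n'n e2] := IHw bw c1 c2 cE.
  have [m' m'm e1] : exists2 m', m' <= m & iter m' (step (M:=asm_tm))
      (cfg s (size c1).+1 st1) = cfg s ((size c1).+1 + size cp) st2.
    have := IHp bp (rcons c1 (IBr t (size c1 + size cp + 2))).
    rewrite size_rcons; apply => //.
    by rewrite cE /= !cat_rcons.
  exists (n' + 1 + m' + 1); first by lia.
  rewrite iterD /= (step_br s st1 bt cE) tv.
  rewrite iterD e1 iterD /=.
  have := @step_br s (rcons c1 (IBr t (size c1 + size cp + 2)) ++ cp) c2 Never
     (size c1) st2 isT.
  rewrite size_cat size_rcons => -> //=.
  by rewrite cE /= !cat_rcons -!catA /= ?cat_rcons.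
- move=> t p st tv; rewrite geq_max => /andP[bt bp] c1 c2 cE.
  exists 1 => //=; rewrite (step_br _ _ bt cE) (negbTE tv).
  by rewrite size_rcons; congr cfg; lia.
- move=> t p q st st' n tv _ IH; rewrite !geq_max => /and3P[bt bp bq] c1 c2.
  set cp := code_of p _; set cq := code_of q _ => cE.
  have [m' m'm e1] : exists2 m', m' <= n & iter m' (step (M:=asm_tm))
      (cfg s (size c1).+1 st) = cfg s ((size c1).+1 + size cp) st'.
    have := IH bp (rcons c1 (IBr t (size c1 + size cp + 2))).
    rewrite size_rcons; apply => //.
    by rewrite cE /= !cat_rcons -catA.
  exists (1 + m' + 1); first by lia.
  rewrite iterD /= (step_br _ _ bt cE) tv e1.
  have := @step_br s (rcons c1 (IBr t (size c1 + size cp + 2)) ++ cp)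
    (cq ++ c2) Never (size c1 + size cp + size cq + 2) st' isT.
  rewrite size_cat size_rcons => -> //=.
    by rewrite size_cat /=; congr cfg; lia.
  by rewrite cE /= cat_rcons -!catA.
- move=> t p q st st' n tv _ IH; rewrite !geq_max => /and3P[bt bp bq] c1 c2.
  set cp := code_of p _; set cq := code_of q _ => cE.
  have [m' m'm e1] : exists2 m', m' <= n & iter m' (step (M:=asm_tm))
      (cfg s (size c1 + size cp + 2) st) =
      cfg s (size c1 + size cp + 2 + size cq) st'.
    have := IH bq (c1 ++ IBr t (size c1 + size cp + 2) :: cp ++
      [:: IBr Never (size c1 + size cp + size cq + 2)]) c2.
    have -> : size (c1 ++ IBr t (size c1 + size cp + 2) :: cp ++
      [:: IBr Never (size c1 + size cp + size cq + 2)]) =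
      size c1 + size cp + 2 by rewrite size_cat /= size_cat /=; lia.
    apply.
    by rewrite cE -!catA /= -!catA.
  exists (m' + 1); first by lia.
  rewrite iterD /= (step_br _ _ bt cE) (negbTE tv) e1.
  by rewrite size_cat /=; congr cfg; lia.
- move=> p st st' m n mn _ IH b c1 c2 cE.
  by have [m' ? e] := IH b _ _ cE; exists m' => //; lia.
Qed.

End Machine.

Lemma polytime_prog (f : seq bool -> seq bool) (p : prog) (P : {poly nat}) :
  (forall s, exists2 n, n <= (P.[size s])%R &
     exists rho, runs s p (fun=> 0, [::]) (rho, f s) n) ->
  polytime f.
Proof.
move=> H; set K := prog_bound p; pose code := IMv K.+1 MoveRight :: code_of p 1.
exists (asm_tm K code), (P + 1)%R => s; have [n nP [rho run]] := H s.
have [m mn e] : exists2 m, m <= n &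
    iter m (@step (asm_tm K code)) (cfg K code s 1 (fun=> 0, [::])) =
    cfg K code s (size code) (rho, f s).
  have := @runs_sim K code s _ _ _ _ run (leqnSn _) [:: IMv K.+1 MoveRight] [::].
  by rewrite cats0; apply.
exists (m + 1).
  by rewrite hornerD hornerC leq_add // (leq_trans mn).
rewrite /outputs_in iterD /=.
have -> : step (init_config (asm_tm K code) s) = cfg K code s 1 (fun=> 0, [::]).
  rewrite /step /= /asm_delta /=.
  apply: config_eq => /=.
  - by [].
  - move=> t j; rewrite !ffunE if_same.
    by case: j => [|j] /=; rewrite ?ffunE; do 2?case: ifP.
  - move=> t; rewrite !ffunE -val_eqE /= inordK //.
    by rewrite -(val_eqE t ord_max) /=; case: ifP.
rewrite e; split; first by rewrite /= inordK.
by move=> i; rewrite /= eqxx.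
Qed.

(** * A language of polynomial-time arithmetic *)

(* Variables are de Bruijn indices; [ESum g f] binds index 0 in [f]. *)
Inductive expr :=
  | EVar of nat
  | EConst of nat
  | ELen
  | EBit of expr
  | EAdd of expr & expr
  | ESub of expr & expr
  | ESum of expr & expr.

Definition scons {T} (i : T) (v : nat -> T) k := if k is k'.+1 then v k' else i.

Fixpoint eval (s : seq bool) (v : nat -> nat) (e : expr) : nat :=
  match e with
  | EVar k => v k
  | EConst n => n
  | ELen => size s
  | EBit e => nth false s (eval s v e)
  | EAdd a b => eval s v a + eval s v b
  | ESub a b => eval s v a - eval s v b
  | ESum g f => \sum_(i < eval s v g) eval s (scons (i : nat) v) f
  end.

(** * Compilation of expressions to counter programs *)

Notation Inc r := (Mv r MoveRight).
Notation Dec r := (Mv r MoveLeft).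
Notation Loop r p := (While (NonZero r) (Seq (Dec r) p)).

(* [comp e m d] puts the value of [e] into register [d], the variable [k] being
   in register [m k]; the registers from [d] on must be zero. *)
Fixpoint comp (e : expr) (m : nat -> nat) (d : nat) : prog :=
  match e with
  | EVar k => Seq (Loop (m k) (Seq (Inc d) (Inc d.+1))) (Loop d.+1 (Inc (m k)))
  | EConst n => iter n (Seq (Inc d)) Skip
  | ELen => Seq (While InSome (Seq (Inc 0) (Inc d))) (Seq (Dec d) (Loop 0 Skip))
  | EBit e => Seq (comp e m d) (Seq (Inc 0) (Seq (Loop d (Inc 0))
                (Seq (If InBit (Inc d) Skip) (Loop 0 Skip))))
  | EAdd a b => Seq (comp a m d) (Seq (comp b m d.+1) (Loop d.+1 (Inc d)))
  | ESub a b => Seq (comp a m d) (Seq (comp b m d.+1) (Loop d.+1 (Dec d)))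
  | ESum g f => Seq (comp g m d) (Seq
      (Loop d (Seq (comp f (scons d m) d.+2) (Loop d.+2 (Inc d.+1))))
      (Loop d.+1 (Inc d)))
  end.

(** The constants count the steps of the loops in [comp]: per unit, moving a register takes 4 steps,
    copying it into two registers 5 and clearing it 3. Reading a variable takes 5 + 4, because the
    copy must be moved back. *)
Fixpoint cost (s : seq bool) (v : nat -> nat) (e : expr) : nat :=
  match e with
  | EVar k => 9 * v k + 2
  | EConst n => n
  | ELen => 7 * size s + 10
  | EBit e => cost s v e + 7 * eval s v e + 10
  | EAdd a b | ESub a b => cost s v a + cost s v b + 4 * eval s v b + 1
  | ESum g f => cost s v g +
      (\sum_(i < eval s v g) (cost s (scons (i : nat) v) f +
         4 * eval s (scons (i : nat) v) f + 4)) + 4 * eval s v e + 2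
  end.

Lemma runs_eq s p st st1 st2 m n :
  runs s p st st1 m -> st1 = st2 -> m <= n -> runs s p st st2 n.
Proof. by move=> h <- mn; apply: runs_le h. Qed.

Lemma runs_eql s p st st1 st2 n :
  st = st1 -> runs s p st1 st2 n -> runs s p st st2 n.
Proof. by move=> ->. Qed.

(** [f k] is the store with [k] iterations left, so the loop leads from [f n] to [f 0]. The overhead
    3 of an iteration is the test, the decrement and the jump back. *)
Lemma runs_loop s a p (f : nat -> nat -> nat) o (c : nat -> nat) n :
  (forall k, k <= n -> f k a = k) ->
  (forall k, k < n -> runs s p (upd (f k.+1) a k, o) (f k, o) (c k)) ->
  runs s (Loop a p) (f n, o) (f 0, o) ((\sum_(k < n) (c k + 3)) + 1).
Proof.
elim: n => [|n IH] fa fr.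
  by rewrite big_ord0; apply: runs_while0 => /=; rewrite fa.
rewrite big_ord_recr /=.
apply: runs_eq; first apply: runs_while1.
- by rewrite /= fa.
- apply: runs_seq; first exact: runs_mv.
  by rewrite fa //=; apply: fr.
- apply: IH => k kn; [exact: fa (leqW kn) | exact: fr (leqW kn)].
- by [].
- set S := (\sum_(_ < _) _); lia.
Qed.

Ltac upd_eq := rewrite /upd /=;
  repeat match goal with
  | |- context [?x == ?y] => case: (eqVneq x y) => ? /=; subst
  end; try lia.

Lemma runs_while_dec s a p rho rho' o n c :
  rho a = n.+1 -> runs s p (upd rho a n, o) (rho', o) c ->
  forall st m, runs s (Loop a p) (rho', o) st m ->
  runs s (Loop a p) (rho, o) st (c + m + 3).
Proof.
move=> e rp st m rl.
have H : runs s (Seq (Dec a) p) (rho, o) (rho', o) (1 + c).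
  by apply: runs_seq; [exact: runs_mv | rewrite e; exact: rp].
have tv : test_val s (rho, o).1 (NonZero a) by rewrite /= e.
by apply: runs_eq (runs_while1 tv H rl) (erefl _) _; lia.
Qed.

Lemma runs_move s a b rho o : a != b ->
  runs s (Loop a (Inc b)) (rho, o)
    (upd (upd rho a 0) b (rho b + rho a), o) (4 * rho a + 1).
Proof.
move=> ab; move e : (rho a) => n; elim: n => [|n IH] in rho e *.
  apply: runs_eq; first by apply: runs_while0; rewrite /= e.
    by congr (_, _); apply/funext => i; upd_eq.
  by [].
apply: runs_eq; first apply: (runs_while_dec e (runs_mv _ _ _ _ _)).
- by apply: IH; upd_eq.
- by congr (_, _); apply/funext => i; upd_eq.
- lia.
Qed.

Lemma runs_move2 s a b c rho o : a != b -> a != c -> b != c ->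
  runs s (Loop a (Seq (Inc b) (Inc c))) (rho, o)
    (upd (upd (upd rho a 0) b (rho b + rho a)) c (rho c + rho a), o)
    (5 * rho a + 1).
Proof.
move=> ab ac bc; move e : (rho a) => n; elim: n => [|n IH] in rho e *.
  apply: runs_eq; first by apply: runs_while0; rewrite /= e.
    by congr (_, _); apply/funext => i; upd_eq.
  by [].
apply: runs_eq; first apply: (runs_while_dec e).
- by apply: runs_seq; exact: runs_mv.
- by apply: IH; upd_eq.
- by congr (_, _); apply/funext => i; upd_eq.
- lia.
Qed.

Lemma runs_sub s a b rho o : a != b ->
  runs s (Loop a (Dec b)) (rho, o)
    (upd (upd rho a 0) b (rho b - rho a), o) (4 * rho a + 1).
Proof.
move=> ab; move e : (rho a) => n; elim: n => [|n IH] in rho e *.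
  apply: runs_eq; first by apply: runs_while0; rewrite /= e.
    by congr (_, _); apply/funext => i; upd_eq.
  by [].
apply: runs_eq; first apply: (runs_while_dec e (runs_mv _ _ _ _ _)).
- by apply: IH; upd_eq.
- by congr (_, _); apply/funext => i; upd_eq.
- lia.
Qed.

Lemma runs_clear s a rho o :
  runs s (Loop a Skip) (rho, o) (upd rho a 0, o) (3 * rho a + 1).
Proof.
move e : (rho a) => n; elim: n => [|n IH] in rho e *.
  apply: runs_eq; first by apply: runs_while0; rewrite /= e.
    by congr (_, _); apply/funext => i; upd_eq.
  by [].
apply: runs_eq; first apply: (runs_while_dec e (runs_skip _ _)).
- by apply: IH; upd_eq.
- by congr (_, _); apply/funext => i; upd_eq.
- lia.
Qed.

Lemma runs_len s d rho o k : 0 < d -> rho 0 + k = (size s).+1 ->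
  runs s (While InSome (Seq (Inc 0) (Inc d))) (rho, o)
    (upd (upd rho 0 (size s).+1) d (rho d + k), o) (4 * k + 1).
Proof.
move=> d0; elim: k => [|k IH] in rho *; rewrite ?addn0 => e.
  apply: runs_eq; first by apply: runs_while0; rewrite /= e ltnn.
    by congr (_, _); apply/funext => i; upd_eq.
  by [].
apply: runs_eq; first apply: runs_while1.
- by rewrite /=; lia.
- by apply: runs_seq; exact: runs_mv.
- by apply: IH; upd_eq.
- by congr (_, _); apply/funext => i; upd_eq.
- lia.
Qed.

(** Since only register [d] changes, the variables are intact and the scratch registers above [d]
    are zero again; nested evaluations can therefore use the same registers one after the other. *)
Lemma runs_comp s e m d rho o : 0 < d -> (forall k, 0 < m k < d) ->
  rho 0 = 0 -> (forall i, d <= i -> rho i = 0) ->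
  runs s (comp e m d) (rho, o) (upd rho d (eval s (rho \o m) e), o)
    (cost s (rho \o m) e).
Proof.
elim: e => [k|n||e IH|a IHa b IHb|a IHa b IHb|g IHg f IHf] /= in m d rho *;
  move=> d0 mP r0 rd.
- have /andP[mk0 mkd] := mP k.
  apply: runs_eq; first apply: runs_seq.
  + by apply: runs_move2; lia.
  + by apply: runs_move; lia.
  + congr (_, _); apply/funext => i.
    have := rd d; have := rd d.+1; upd_eq.
  + by have := rd d; have := rd d.+1; upd_eq.
- have E j : runs s (iter n (Seq (Inc d)) Skip) (upd rho d j, o) (upd rho d (j + n), o) n.
    elim: n j => [|n IH] j; first by rewrite addn0; exact: runs_skip.
    apply: runs_eq; first apply: runs_seq; first exact: runs_mv.
    + have -> : upd (upd rho d j) d (Defs.shift MoveRight (upd rho d j d))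
              = upd rho d j.+1 by apply/funext => i; upd_eq.
      exact: IH.
    + by rewrite addSnnS.
    + lia.
  have rE : upd rho d 0 = rho by apply/funext => i; have := rd d; upd_eq.
  by have := E 0; rewrite add0n rE.
- apply: runs_eq; first apply: runs_seq.
  + by apply: (@runs_len s d rho o (size s).+1); rewrite ?r0.
  + by apply: runs_seq; [exact: runs_mv | exact: runs_clear].
  + congr (_, _); apply/funext => i; have := rd d; upd_eq.
  + upd_eq.
- have := IH m d rho d0 mP r0 rd.
  move: (eval s (rho \o m) e) (cost s (rho \o m) e) => x c Ie.
  have E : runs s (If InBit (Inc d) Skip) (upd (upd rho d 0) 0 x.+1, o)
             (upd (upd rho d (nth false s x)) 0 x.+1, o) 3.
    case nx : (nth false s x).
      apply: runs_eq; first apply: runs_if1 => /=; first by rewrite /upd.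
      - exact: runs_mv.
      - by congr (_, _); apply/funext => i; upd_eq.
      - by [].
    apply: runs_eq; first apply: runs_if0 => /=; first by rewrite /upd /= nx.
    - exact: runs_skip.
    - by congr (_, _); apply/funext => i; upd_eq.
    - by [].
  apply: runs_eq.
    apply: runs_seq; first exact: Ie.
    apply: runs_seq; first exact: runs_mv.
    apply: runs_seq; first by apply: runs_move; lia.
    apply: runs_seq.
      apply: (runs_eql _ E).
      by congr (_, _); apply/funext => i; upd_eq.
    exact: runs_clear.
  + congr (_, _); apply/funext => i; upd_eq.
  + upd_eq.
- have := IHa m d rho d0 mP r0 rd.
  have : runs s (comp b m d.+1) (upd rho d (eval s (rho \o m) a), o)
    (upd (upd rho d (eval s (rho \o m) a)) d.+1 (eval s (rho \o m) b), o)
    (cost s (rho \o m) b).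
    set r := upd rho d _; have -> : rho \o m = r \o m.
      by apply/funext => k /=; have := mP k; rewrite /r; upd_eq.
    apply: IHb => //.
    + by move=> k; have := mP k; lia.
    + by rewrite /r; upd_eq.
    + by move=> i di; have := rd i; rewrite /r; upd_eq.
  move: (eval s (rho \o m) a) (cost s (rho \o m) a) => x c.
  move: (eval s (rho \o m) b) (cost s (rho \o m) b) => y c'.
  move=> Ib Ia; apply: runs_eq; first apply: runs_seq; first exact: Ia.
  + apply: runs_seq; first exact: Ib.
    by apply: runs_move; lia.
  + congr (_, _); apply/funext => i; have := rd d.+1; upd_eq.
  + upd_eq.
- have := IHa m d rho d0 mP r0 rd.
  have : runs s (comp b m d.+1) (upd rho d (eval s (rho \o m) a), o)
    (upd (upd rho d (eval s (rho \o m) a)) d.+1 (eval s (rho \o m) b), o)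
    (cost s (rho \o m) b).
    set r := upd rho d _; have -> : rho \o m = r \o m.
      by apply/funext => k /=; have := mP k; rewrite /r; upd_eq.
    apply: IHb => //.
    + by move=> k; have := mP k; lia.
    + by rewrite /r; upd_eq.
    + by move=> i di; have := rd i; rewrite /r; upd_eq.
  move: (eval s (rho \o m) a) (cost s (rho \o m) a) => x c.
  move: (eval s (rho \o m) b) (cost s (rho \o m) b) => y c'.
  move=> Ib Ia; apply: runs_eq; first apply: runs_seq; first exact: Ia.
  + apply: runs_seq; first exact: Ib.
    by apply: runs_sub; lia.
  + congr (_, _); apply/funext => i; have := rd d.+1; upd_eq.
  + upd_eq.
- have := IHg m d rho d0 mP r0 rd.
  move: (eval s (rho \o m) g) (cost s (rho \o m) g) => N c Ig.
  pose F i := eval s (scons i (rho \o m)) f.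
  pose C i := cost s (scons i (rho \o m)) f.
  (* The loop counter in [d] doubles as the bound variable. It is decremented before the body runs,
     so the sum is accumulated in [d.+1] from its last index down to 0. *)
  pose st k := upd (upd rho d k) d.+1 (\sum_(k <= i < N) F i).
  have body k : k < N ->
      runs s (Seq (comp f (scons d m) d.+2) (Loop d.+2 (Inc d.+1)))
        (upd (st k.+1) d k, o) (st k, o) (C k + (4 * F k + 1)).
    move=> kN; pose r := upd (st k.+1) d k.
    have rE : r \o scons d m = scons k (rho \o m).
      apply/funext => -[|j] /=; rewrite /r /st; first by upd_eq.
      by have := mP j; upd_eq.
    have If : runs s (comp f (scons d m) d.+2) (r, o) (upd r d.+2 (F k), o) (C k).
      rewrite /F /C -rE; apply: IHf => //.
      - by case=> [|j] /=; [lia | have := mP j; lia].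
      - by rewrite /r /st; upd_eq.
      - by move=> i di; have := rd i; rewrite /r /st; upd_eq.
    apply: runs_eq; first apply: runs_seq; first exact: If.
    + by apply: runs_move; lia.
    + congr (_, _); apply/funext => i; have := rd d.+2.
      by rewrite /r /st (big_ltn kN); upd_eq.
    + by upd_eq.
  have L := @runs_loop s d _ st o _ N _ body.
  apply: runs_eq; first apply: runs_seq; first exact: Ig.
  + apply: runs_seq.
      have -> : upd rho d N = st N.
        apply/funext => i; rewrite /st big_geq //; have := rd d.+1; upd_eq.
      by apply: L => k _; rewrite /st; upd_eq.
    by apply: runs_move; lia.
  + congr (_, _); apply/funext => i; rewrite /st -(big_mkord xpredT F).
    by have := rd d.+1; upd_eq.
  + rewrite /st -(big_mkord xpredT F).
    have -> : \sum_(k < N) (C k + (4 * F k + 1) + 3) = \sum_(i < N) (C i + 4 * F i + 4).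
      by apply: eq_bigr => i _; lia.
    set S := (\sum_(i < N) _); upd_eq.
Qed.

(** A base of at least 2 lets sums and constant factors be absorbed into the exponent. A bound
    variable stays below the value of its range, hence below a power of [B.+2], and that power takes
    over the role of [B] for the body of a sum. *)
Lemma eval_cost_bound e : exists c, forall s v B,
  size s <= B -> (forall k, v k <= B) -> eval s v e + cost s v e <= B.+2 ^ c.
Proof.
have add x y X a b : 1 < X -> x <= X ^ a -> y <= X ^ b -> x + y <= X ^ (a + b).+1.
  move=> X1 xa yb; rewrite expnS expnD.
  have := expn_gt0 X a; have := expn_gt0 X b.
  move: (X ^ a) (X ^ b) xa yb => A C xA yC C0 A0.
  apply: leq_trans (_ : 2 * (A * C) <= _); last by rewrite leq_mul2r X1 orbT.
  by nia.
have const k X : 1 < X -> k <= X ^ k.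
  by move=> X1; rewrite ltnW // ltn_expl.
have big x k l X a : 1 < X -> x <= X ^ a -> k * x + l <= X ^ (a + k + l).+1.
  move=> X1 xa; apply: add => //; last exact: const.
  by rewrite expnD mulnC leq_mul // const.
elim: e => [k|n||e [c IH]|e1 [c1 IH1] e2 [c2 IH2]|e1 [c1 IH1] e2 [c2 IH2]
  |e1 [c1 IH1] e2 [c2 IH2]] /=.
- exists (1 + 10 + 2).+1 => s v B sB vB.
  have : v k <= B.+2 ^ 1 by rewrite expn1 ltnW // ltnW // ltnS ltnS.
  by move=> /(@big _ 10 2 B.+2 1 isT); apply: leq_trans; lia.
- exists (n + n) => s v B sB vB; apply: const => //.
- exists (1 + 8 + 10).+1 => s v B sB vB.
  have : size s <= B.+2 ^ 1 by rewrite expn1; lia.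
  by move=> /(@big _ 8 10 B.+2 1 isT); apply: leq_trans; lia.
- exists (c + 8 + 11).+1 => s v B sB vB; have := IH s v B sB vB.
  move=> /(@big _ 8 11 B.+2 c isT); apply: leq_trans.
  by case: nth => /=; lia.
- exists ((c1 + c2).+1 + 8 + 1).+1 => s v B sB vB.
  have /(@big _ 8 1 B.+2 _ isT) :=
    add _ _ B.+2 _ _ isT (IH1 s v B sB vB) (IH2 s v B sB vB).
  by apply: leq_trans; lia.
- exists ((c1 + c2).+1 + 8 + 1).+1 => s v B sB vB.
  have /(@big _ 8 1 B.+2 _ isT) :=
    add _ _ B.+2 _ _ isT (IH1 s v B sB vB) (IH2 s v B sB vB).
  by apply: leq_trans; lia.
(* The variables of the body are at most [B.+2 ^ c1.+1]; the 3 absorbs the added 2 in the base of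
   its bound. The 9 and 4 are the coefficients of the summand in [H2], and the outer [c1] accounts
   for the number of summands. *)
- pose b := c1 + ((c1.+1 + 3) * c2 + 9 + 4).+1.
  exists ((c1 + b).+1 + 2 + 2).+1 => s v B sB vB.
  have H1 := IH1 s v B sB vB.
  have H2 : \sum_(i < eval s v e1) (9 * (eval s (scons (i : nat) v) e2 +
      cost s (scons (i : nat) v) e2) + 4) <= B.+2 ^ b.
    rewrite /b expnD.
    apply: leq_trans (_ : eval s v e1 * B.+2 ^ ((c1.+1 + 3) * c2 + 9 + 4).+1 <= _); last first.
      by rewrite leq_mul // (leq_trans _ H1) // leq_addr.
    rewrite -[X in X * _]card_ord -sum_nat_const; apply: leq_sum => i _.
    apply: big => //; rewrite expnM.
    have X0 : 0 < B.+2 ^ c1 by rewrite expn_gt0.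
    apply: leq_trans (IH2 s (scons (i:nat) v) (B.+2 ^ c1.+1) _ _) _.
    + by rewrite expnS; nia.
    + case=> [|k] /=; have := ltn_ord i; have := vB; rewrite expnS; last by move=> /(_ k); nia.
      by move=> _; nia.
    + case: (c2) => // k; rewrite leq_exp2r //.
      apply: leq_trans (_ : B.+2 ^ c1.+1 + 2 <= _); first by rewrite addn2.
      have : 2 <= B.+2 ^ 1 by rewrite expn1.
      move=> /(@add _ _ B.+2 c1.+1 1 isT (leqnn _)) h; apply: leq_trans h _.
      by rewrite leq_pexp2l //; lia.
  have /(@big _ 2 2 B.+2 _ isT) := add _ _ B.+2 _ _ isT H1 H2.
  apply: leq_trans.
  set S1 := (\sum_(_ < _) eval _ _ _); set S2 := (\sum_(_ < _) (cost _ _ _ + _ + _)).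
  set S3 := (\sum_(_ < _) _).
  have h : S1 + S2 + 4 * S1 <= 2 * S3.
    by rewrite !big_distrr /= -!big_split /=; apply: leq_sum => i _; lia.
  by lia.
Qed.

(* [lf f]: the function [f] of the input string and of finitely many numbers is
   expressible, hence computable in polynomial time. *)
Definition lf (f : seq bool -> (nat -> nat) -> nat) : Prop :=
  exists e, forall s v, f s v = eval s v e.

(** The source of every polynomial-time function below. Register 1 holds the position of the next
    bit and is the register of all variables, register 2 counts the bits still to be written,
    register 3 receives the bit. *)
Lemma polytime_mkseq (len : seq bool -> nat) (bit : seq bool -> nat -> bool) :
  lf (fun s _ => len s) -> lf (fun s v => bit s (v 0)) ->
  polytime (fun s => mkseq (bit s) (len s)).
Proof.
move=> [el elP] [eb ebP].
have [c1 H1] := eval_cost_bound el; have [c2 H2] := eval_cost_bound eb.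
pose body := Seq (comp eb (fun=> 1) 3)
  (Seq (If (NonZero 3) (Seq (Dec 3) (Emit true)) (Emit false)) (Inc 1)).
pose p := Seq (comp el (fun=> 1) 2) (Loop 2 body).
pose Q : {poly nat} := (('X + 2%:P) ^+ c1)%R.
pose P := (Q + Q * ((('X + Q + 2%:P) ^+ c2) + 8%:P) + 1%:P)%R.
apply: (@polytime_prog _ p P) => s.
have QE : (Q.[size s])%R = (size s).+2 ^ c1.
  by rewrite /Q horner_exp hornerD hornerX hornerC natrXE natrDE addn2.
have PE : (P.[size s])%R = (size s).+2 ^ c1 + (size s).+2 ^ c1 *
  ((size s + (size s).+2 ^ c1).+2 ^ c2 + 8) + 1.
  rewrite /P; move: (Q) QE => q QE.
  rewrite !hornerD hornerM hornerD horner_exp !hornerD hornerX !hornerC QE.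
  by rewrite !natrXE !natrDE natrME addn2.
have [rl Cl] : runs s (comp el (fun=> 1) 2) (fun=> 0, [::])
    (upd (fun=> 0) 2 (len s), [::]) (cost s (fun=> 0) el) /\
    len s + cost s (fun=> 0) el <= (size s).+2 ^ c1.
  rewrite (elP s (fun=> 0)); split; last exact: H1.
  exact: (@runs_comp s el (fun=> 1) 2 (fun=> 0)).
set N := len s in rl Cl *; set X := (_ ^ c1) in Cl PE.
pose st k := (upd (upd (fun=> 0) 2 k) 1 (N - k), mkseq (bit s) (N - k)).
have rb k : k < N -> runs s (Seq (Dec 2) body) (st k.+1) (st k)
    ((size s + X).+2 ^ c2 + 6).
  move=> kN; pose r := upd (upd (fun=> 0) 2 k) 1 (N - k.+1).
  have bE : eval s (fun=> N - k.+1) eb = bit s (N - k.+1) by rewrite -ebP.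
  have rc : runs s (comp eb (fun=> 1) 3) (r, mkseq (bit s) (N - k.+1))
     (upd r 3 (bit s (N - k.+1)), mkseq (bit s) (N - k.+1))
     (cost s (fun=> N - k.+1) eb).
    have rE : (fun=> N - k.+1) = r \o (fun _ : nat => 1).
      by apply/funext => j /=; rewrite /r; upd_eq.
    rewrite -bE rE; apply: runs_comp => // i; rewrite /r; upd_eq.
  have NE : N - k = (N - k.+1).+1 by lia.
  apply: runs_eq.
    apply: runs_seq; first exact: runs_mv.
    apply: runs_seq.
      apply: (runs_eql _ rc).
      by congr (_, _); apply/funext => i; rewrite /r; upd_eq.
    have E : runs s (If (NonZero 3) (Seq (Dec 3) (Emit true)) (Emit false))
       (upd r 3 (bit s (N - k.+1)), mkseq (bit s) (N - k.+1))
       (r, mkseq (bit s) (N - k)) 4.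
      rewrite NE mkseqS; case: (bit s _).
        apply: runs_eq; first apply: runs_if1 => /=; first by rewrite /upd.
        - by apply: runs_seq; [exact: runs_mv | exact: runs_emit].
        - by congr (_, _); apply/funext => i; rewrite /r; upd_eq.
        - by [].
      apply: runs_eq; first apply: runs_if0 => /=; first by rewrite /upd.
      - exact: runs_emit.
      - by congr (_, _); apply/funext => i; rewrite /r; upd_eq.
      - by [].
    by apply: runs_seq; [exact: E | exact: runs_mv].
  + by congr (_, _); apply/funext => i; rewrite /r; upd_eq.
  + have := H2 s (fun=> N - k.+1) (size s + X) (leq_addr _ _).
    move=> /(_ (fun=> _)) h.
    by apply: leq_trans (_ : cost s (fun=> N - k.+1) eb + 6 <= _); lia.
exists (cost s (fun=> 0) el + (N * ((size s + X).+2 ^ c2 + 8) + 1)).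
  rewrite PE -addnA leq_add //; first by lia.
  by rewrite leq_add2r leq_mul2r; lia.
exists (upd (fun=> 0) 1 N).
apply: runs_seq; first exact: rl.
have -> : (upd (fun=> 0) 2 N, [::]) = st N.
  by rewrite /st subnn; congr (_, _); apply/funext => i; upd_eq.
have -> : (upd (fun=> 0) 1 N, mkseq (bit s) N) = st 0.
  by rewrite /st subn0; congr (_, _); apply/funext => i; upd_eq.
suff W k : k <= N -> runs s (Loop 2 body) (st k) (st 0)
    (k * ((size s + X).+2 ^ c2 + 8) + 1) by exact: W.
elim: k => [|k IH] kN; first exact: runs_while0.
have tv : test_val s (st k.+1).1 (NonZero 2) by [].
by apply: runs_eq (runs_while1 tv (rb _ kN) (IH (ltnW kN))) (erefl _) _; lia.
Qed.

(** * Closure properties of the expressible functions *)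

Fixpoint ren (r : nat -> nat) (e : expr) : expr :=
  match e with
  | EVar k => EVar (r k)
  | EConst n => EConst n
  | ELen => ELen
  | EBit a => EBit (ren r a)
  | EAdd a b => EAdd (ren r a) (ren r b)
  | ESub a b => ESub (ren r a) (ren r b)
  | ESum g f => ESum (ren r g) (ren (scons 0 (S \o r)) f)
  end.

Lemma eval_ren s v r e : eval s v (ren r e) = eval s (v \o r) e.
Proof.
elim: e v r => //= [e IH|a IHa b IHb|a IHa b IHb|g IHg f IHf] v r;
  rewrite ?IH ?IHa ?IHb // IHg; apply: eq_bigr => i _.
by rewrite IHf; congr eval; apply/funext => -[].
Qed.

Fixpoint subst (g : nat -> expr) (e : expr) : expr :=
  match e with
  | EVar k => g k
  | EConst n => EConst n
  | ELen => ELen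
  | EBit a => EBit (subst g a)
  | EAdd a b => EAdd (subst g a) (subst g b)
  | ESub a b => ESub (subst g a) (subst g b)
  | ESum n f => ESum (subst g n) (subst (scons (EVar 0) (ren S \o g)) f)
  end.

Lemma eval_subst s v g e :
  eval s v (subst g e) = eval s (fun k => eval s v (g k)) e.
Proof.
elim: e v g => //= [e IH|a IHa b IHb|a IHa b IHb|n IHn f IHf] v g;
  rewrite ?IH ?IHa ?IHb // IHn; apply: eq_bigr => i _.
by rewrite IHf; congr eval; apply/funext => -[|k] //=; rewrite eval_ren.
Qed.

Lemma lf_eq f g : (forall s v, f s v = g s v) -> lf f -> lf g.
Proof. by move=> fg [e E]; exists e => s v; rewrite -fg. Qed.

Lemma lf_var k : lf (fun _ v => v k). Proof. by exists (EVar k). Qed.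
Lemma lf_const n : lf (fun _ _ => n). Proof. by exists (EConst n). Qed.
Lemma lf_size : lf (fun s _ => size s). Proof. by exists ELen. Qed.
Lemma lf_bit a : lf a -> lf (fun s v => nth false s (a s v)).
Proof. by move=> [e E]; exists (EBit e) => s v; rewrite /= E. Qed.
Lemma lf_add a b : lf a -> lf b -> lf (fun s v => a s v + b s v).
Proof. by move=> [e E] [f F]; exists (EAdd e f) => s v; rewrite E F. Qed.
Lemma lf_sub a b : lf a -> lf b -> lf (fun s v => a s v - b s v).
Proof. by move=> [e E] [f F]; exists (ESub e f) => s v; rewrite E F. Qed.
(** Under the binder, variable 0 is the summation index and the outer variables start at 1, whence
    the shifted valuation passed to [F]. *)
Lemma lf_sum g (F : seq bool -> (nat -> nat) -> nat -> nat) :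
  lf g -> lf (fun s v => F s (fun k => v k.+1) (v 0)) ->
  lf (fun s v => \sum_(i < g s v) F s v i).
Proof.
move=> [e E] [f H]; exists (ESum e f) => s v /=; rewrite E.
by apply: eq_bigr => i _; rewrite -H.
Qed.

Lemma lf_sum_nat g (F : seq bool -> (nat -> nat) -> nat -> nat) :
  lf g -> lf (fun s v => F s (fun k => v k.+1) (v 0)) ->
  lf (fun s v => \sum_(0 <= i < g s v) F s v i).
Proof. by move=> lg /(lf_sum lg); apply: lf_eq => s v; rewrite big_mkord. Qed.

Lemma lf_subst f (g : nat -> seq bool -> (nat -> nat) -> nat) :
  lf f -> (forall k, lf (g k)) -> lf (fun s v => f s (fun k => g k s v)).
Proof.
move=> [e E] /boolp.choice[h H]; exists (subst h e) => s v.
by rewrite E eval_subst; congr eval; apply/funext => k.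
Qed.

Lemma lf_app2 (F : seq bool -> nat -> nat -> nat) a b :
  lf (fun s v => F s (v 0) (v 1)) -> lf a -> lf b ->
  lf (fun s v => F s (a s v) (b s v)).
Proof.
by move=> lF la lb; apply: (lf_subst (g := nth a [:: a; b]) lF) => -[|[|[]]].
Qed.

Lemma lf_weak f : lf f -> lf (fun s v => f s (fun k => v k.+1)).
Proof. by move=> lF; apply: (lf_subst lF) => k; exact: lf_var. Qed.

Lemma lf_mul a b : lf a -> lf b -> lf (fun s v => a s v * b s v).
Proof.
move=> la lb; apply: (@lf_eq (fun s v => \sum_(i < a s v) b s v)).
  by move=> s v; rewrite sum_nat_const card_ord.
by apply: (lf_sum (F := fun s v _ => b s v)) => //; exact: lf_weak.
Qed.

Lemma lf_succ a : lf a -> lf (fun s v => (a s v).+1).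
Proof.
move=> la; apply: (lf_eq _ (lf_add la (lf_const 1))) => s v.
exact: addn1.
Qed.

Lemma lf_pred a : lf a -> lf (fun s v => (a s v).-1).
Proof.
move=> la; apply: (lf_eq _ (lf_sub la (lf_const 1))) => s v.
exact: subn1.
Qed.

Lemma lf_neg (a : seq bool -> (nat -> nat) -> bool) : lf a -> lf (fun s v => ~~ a s v).
Proof.
by move=> la; apply: (lf_eq _ (lf_sub (lf_const 1) la)) => s v; case: (a s v).
Qed.

Lemma lf_and (a b : seq bool -> (nat -> nat) -> bool) :
  lf a -> lf b -> lf (fun s v => a s v && b s v).
Proof.
by move=> la lb; apply: (lf_eq _ (lf_mul la lb)) => s v; case: (a s v); case: (b s v).
Qed.

Lemma lf_or (a b : seq bool -> (nat -> nat) -> bool) :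
  lf a -> lf b -> lf (fun s v => a s v || b s v).
Proof.
move=> la lb; apply: (lf_eq _ (lf_neg (lf_and (lf_neg la) (lf_neg lb)))) => s v.
by rewrite -negb_or negbK.
Qed.

Lemma lf_imp (a b : seq bool -> (nat -> nat) -> bool) :
  lf a -> lf b -> lf (fun s v => a s v ==> b s v).
Proof.
move=> la lb; apply: (lf_eq _ (lf_or (lf_neg la) lb)) => s v.
by rewrite implybE.
Qed.

Lemma lf_leq a b : lf a -> lf b -> lf (fun s v => a s v <= b s v).
Proof.
move=> la lb; apply: (lf_eq _ (lf_sub (lf_const 1) (lf_sub la lb))) => s v.
by rewrite /leq; case: (a s v - b s v).
Qed.

Lemma lf_eqn (a b : seq bool -> (nat -> nat) -> nat) :
  lf a -> lf b -> lf (fun s v => a s v == b s v).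
Proof.
move=> la lb; apply: (lf_eq _ (lf_and (lf_leq la lb) (lf_leq lb la))) => s v.
by rewrite eqn_leq.
Qed.

Lemma lf_eqb (a b : seq bool -> (nat -> nat) -> bool) :
  lf a -> lf b -> lf (fun s v => a s v == b s v).
Proof.
move=> la lb; apply: (lf_eq _ (lf_eqn la lb)) => s v.
by case: (a s v); case: (b s v).
Qed.

Lemma lf_if (c : seq bool -> (nat -> nat) -> bool) a b :
  lf c -> lf a -> lf b -> lf (fun s v => if c s v then a s v else b s v).
Proof.
move=> lc la lb.
apply: (lf_eq _ (lf_add (lf_mul lc la) (lf_mul (lf_neg lc) lb))) => s v.
by case: (c s v); rewrite ?mul1n ?addn0.
Qed.

Lemma lf_ifb (c a b : seq bool -> (nat -> nat) -> bool) :
  lf c -> lf a -> lf b -> lf (fun s v => if c s v then a s v else b s v).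
Proof. by move=> lc la lb; apply: (lf_eq _ (lf_if lc la lb)) => s v; case: ifP. Qed.

Lemma lf_has g (F : seq bool -> (nat -> nat) -> nat -> bool) :
  lf g -> lf (fun s v => F s (fun k => v k.+1) (v 0)) ->
  lf (fun s v => has (F s v) (iota 0 (g s v))).
Proof.
move=> lg lF.
have lS := lf_sum (F := fun s v i => nat_of_bool (F s v i)) lg lF.
apply: (lf_eq _ (lf_leq (lf_const 1) lS)) => s v.
congr nat_of_bool; rewrite has_count -sum1_count.
rewrite -(big_mkord xpredT (fun i => nat_of_bool (F s v i))) /index_iota subn0.
by congr (0 < _); rewrite [RHS]big_mkcond; apply: eq_bigr => i _; case: (F s v i).
Qed.

Lemma lf_all g (F : seq bool -> (nat -> nat) -> nat -> bool) :
  lf g -> lf (fun s v => F s (fun k => v k.+1) (v 0)) ->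
  lf (fun s v => all (F s v) (iota 0 (g s v))).
Proof.
move=> lg lF.
have H := lf_neg (lf_has (F := fun s v i => ~~ F s v i) lg (lf_neg lF)).
by apply: (lf_eq _ H) => s v; rewrite has_predC negbK.
Qed.

(** The quotient is the number of [i] with [i.+1 * b <= a], and all of these are below [a]. The
    condition [0 < b] gives 0 for division by zero. *)
Lemma lf_div a b : lf a -> lf b -> lf (fun s v => a s v %/ b s v).
Proof.
move=> la lb.
have H : lf (fun s v => \sum_(i < a s v) ((0 < b s v) && (i.+1 * b s v <= a s v))).
  apply: (lf_sum (F := fun s v i =>
    nat_of_bool ((0 < b s v) && (i.+1 * b s v <= a s v)))) => //.
  apply: lf_and; first exact: (lf_leq (lf_const 1) (lf_weak lb)).
  by apply: lf_leq; [apply: lf_mul; [apply/lf_succ/lf_var|]|]; exact: lf_weak.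
apply: (lf_eq _ H) => s v; case: (posnP (b s v)) => [->|b0].
  by rewrite big1 // divn0.
rewrite -(big_mkord xpredT (fun i => nat_of_bool (i.+1 * b s v <= a s v))).
rewrite (eq_bigr (fun i => nat_of_bool (i < a s v %/ b s v))); last first.
  by move=> i _; rewrite leq_divRL.
rewrite -big_mkcond sum1_count /index_iota subn0 -size_filter.
have /subnKC E : a s v %/ b s v <= a s v by apply: leq_div.
rewrite -[X in iota 0 X]E iotaD filter_cat size_cat /= add0n.
rewrite (@eq_in_filter _ _ xpredT) ?filter_predT ?size_iota; last first.
  by move=> i; rewrite mem_iota => /andP[_ ->].
rewrite (@eq_in_filter _ _ pred0) ?filter_pred0 ?addn0 //.
by move=> i; rewrite mem_iota leqNgt; case: ltnP.
Qed.

Lemma lf_mod a b : lf a -> lf b -> lf (fun s v => a s v %% b s v).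
Proof.
move=> la lb; apply: (lf_eq _ (lf_sub la (lf_mul (lf_div la lb) lb))) => s v.
by rewrite {1}(divn_eq (a s v) (b s v)) addKn.
Qed.

Lemma lf_exp a n : lf a -> lf (fun s v => a s v ^ n).
Proof.
move=> la; elim: n => [|n IH]; first exact: (lf_const 1).
by apply: (lf_eq _ (lf_mul la IH)) => s v; rewrite expnS.
Qed.

Lemma lf_horner (p : {poly nat}) a : lf a -> lf (fun s v => (p.[a s v])%R).
Proof.
move=> la; rewrite /horner; elim: (polyseq p) => [|c q IH] /=.
  exact: (lf_const 0).
exact: (lf_add (lf_mul IH la) (lf_const c)).
Qed.

(** The list [r] is independent of the input, so the disjunction unfolds into an expression of fixed
    size. *)
Lemma lf_static_has (I : Type) (r : seq I) (F : I -> seq bool -> (nat -> nat) -> bool) :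
  (forall i, lf (F i)) -> lf (fun s v => has (fun i => F i s v) r).
Proof.
move=> lF; elim: r => [|i r IH].
  exact: (lf_const 0).
exact: (lf_or (lF i) IH).
Qed.

Ltac lf_step := lazymatch goal with
  | |- lf (fun s v => nat_of_bool (~~ @?a s v)) => apply: lf_neg
  | |- lf (fun s v => nat_of_bool (@?a s v && @?b s v)) => apply: lf_and
  | |- lf (fun s v => nat_of_bool (@?a s v || @?b s v)) => apply: lf_or
  | |- lf (fun s v => nat_of_bool (@?a s v ==> @?b s v)) => apply: lf_imp
  | |- lf (fun s v => nat_of_bool (@?a s v <= @?b s v)) => apply: lf_leq
  | |- lf (fun s v => nat_of_bool (@eq_op _ (@?a s v) (@?b s v))) =>
      first [apply: lf_eqn | apply: lf_eqb]
  | |- lf (fun s v => nat_of_bool (has (@?a s v) (iota 0 (@?b s v)))) => apply: lf_has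
  | |- lf (fun s v => nat_of_bool (all (@?a s v) (iota 0 (@?b s v)))) => apply: lf_all
  | |- lf (fun s v => nat_of_bool (nth false s (@?b s v))) => apply: lf_bit
  | |- lf (fun s v => @?a s v + @?b s v) => apply: lf_add
  | |- lf (fun s v => @?a s v - @?b s v) => apply: lf_sub
  | |- lf (fun s v => @?a s v * @?b s v) => apply: lf_mul
  | |- lf (fun s v => @?a s v %/ @?b s v) => apply: lf_div
  | |- lf (fun s v => @?a s v %% @?b s v) => apply: lf_mod
  | |- lf (fun s v => @?a s v ^ ?b) => apply: lf_exp
  | |- lf (fun s v => (?p.[@?a s v])%R) => apply: lf_horner
  | |- lf (fun s v => (@?a s v).-1) => apply: lf_pred
  | |- lf (fun s v => size s) => apply: lf_size
  | |- lf (fun s v => S (@?a s v)) => first [apply: lf_const | apply: lf_succ]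
  | |- lf (fun s v => nat_of_bool (if _ then _ else _)) => apply: lf_ifb
  | |- lf (fun s v => if _ then _ else _) => apply: lf_if
  | |- lf (fun s v => bigop.body _ _ _) => apply: lf_sum_nat
  | |- lf (fun s v => v _) => apply: lf_var
  | |- lf _ => first [assumption | apply: lf_const]
  end.
Ltac lf := repeat lf_step.

(** * Values in target arenas *)

Lemma tuple_sum (T : finType) (V : nmodType) n (F : n.+1.-tuple T -> V) :
  (\sum_(w : n.+1.-tuple T) F w =
   \sum_(x : T) \sum_(w : n.-tuple T) F [tuple of x :: w])%R.
Proof.
rewrite pair_big /= (reindex (fun p : T * n.-tuple T => [tuple of p.1 :: p.2])) //.
exists (fun w : n.+1.-tuple T => (thead w, [tuple of behead w])) => [[x w] _|w _] /=.
  by congr (_, _); apply/val_inj.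
by rewrite -tuple_eta.
Qed.

Lemma bipartiteP (V : finType) (P : {set V}) (E : {set V * V}) :
  reflect (forall u v, (u, v) \in E -> (u \in P) = (v \notin P))
    (E \subset setX P (~: P) :|: setX (~: P) P).
Proof.
apply: (iffP subsetP) => [H u v /H|H [u v] /H uv].
  by rewrite !inE /=; case/orP => /andP[] => [->|/negbTE->] //= ->.
by rewrite !inE /= uv; case: (v \in P).
Qed.

(** * The Markov chain of a strategy and its reachability probabilities *)

Section Chain.
Local Open Scope ring_scope.
Variables (R : realType) (V : finType) (A : target_arena V).
Variable mu : V -> V -> rat.
Hypothesis mu_full : full_support_family A mu.

Implicit Types (sigma : strategy A) (s : mc_state A) (p q : playerT A).

Lemma edge_player u v : (u, v) \in edges A -> (u \in players A) = (v \notin players A).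
Proof. exact: (bipartiteP _ _ (edges_bipartite A)). Qed.

Lemma nature_strategy sigma p : val (sigma p) \notin players A.
Proof. by have := valP (sigma p); rewrite inE. Qed.

Lemma mu_ge0 u v : u \notin players A -> 0 <= mu u v.
Proof.
move=> /mu_full[mu_pos mu_0 _].
by have [/mu_pos/ltW|/mu_0->] := boolP (v \in out A u).
Qed.

Lemma out_player u v : u \notin players A -> v \in out A u -> v \in players A.
Proof. by rewrite inE => uP /edge_player; rewrite (negbTE uP) => /esym/negbFE. Qed.

Lemma sum_out u (F : V -> R) : u \notin players A ->
  \sum_(p : playerT A | val p \in out A u) F (val p) = \sum_(v in out A u) F v.
Proof.
move=> uP; rewrite [RHS](eq_bigl (fun v => (v \in players A) && (v \in out A u))).
  by rewrite [RHS]big_sub_cond.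
by move=> v; case h: (v \in out A u); rewrite ?andbF // (out_player uP h).
Qed.

Lemma sum_mu u (F : playerT A -> R) : u \notin players A ->
  \sum_p ratr (mu u (val p)) * F p =
  \sum_(p : playerT A | val p \in out A u) ratr (mu u (val p)) * F p.
Proof.
move=> uP; rewrite [RHS]big_mkcond; apply: eq_bigr => p _; case: ifP => // /negbT.
by have [_ mu_0 _] := mu_full uP; move/mu_0 ->; rewrite rmorph0 mul0r.
Qed.

Lemma sum_muC u (c : R) : u \notin players A ->
  \sum_(p : playerT A) ratr (mu u (val p)) * c = c.
Proof.
move=> uP; rewrite sum_mu // (sum_out (fun v => ratr (mu u v) * c)) // -mulr_suml.
by have [_ _ mu1] := mu_full uP; rewrite -rmorph_sum mu1 rmorph1 mul1r.
Qed.

Lemma trans_ge0 sigma s s' : 0 <= trans mu sigma s s'.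
Proof.
case: s => [p|] /=; last exact: ler0n.
case: ifP => _; last exact: ler0n.
by case: s' => // q; apply/mu_ge0/nature_strategy.
Qed.

Lemma sum_option (T : finType) (F : option T -> R) :
  \sum_s F s = F None + \sum_x F (Some x).
Proof.
rewrite (bigD1 None) //=; congr (_ + _).
rewrite (reindex_omap Some id) //=; last by case.
by apply: eq_bigl => x; rewrite eqxx.
Qed.

Definition next sigma (F : mc_state A -> R) s : R :=
  \sum_s' ratr (trans mu sigma s s') * F s'.

Lemma next_None sigma F : next sigma F None = F None.
Proof.
rewrite /next sum_option /= rmorph1 mul1r big1 ?addr0 // => p _.
by rewrite rmorph0 mul0r.
Qed.

Lemma next_Some sigma F p : next sigma F (Some p) =
  if (val p, val (sigma p)) \in edges A
  then \sum_q ratr (mu (val (sigma p)) (val q)) * F (Some q) else F None.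
Proof.
rewrite /next sum_option /=; case: ifP => _.
  by rewrite rmorph0 mul0r add0r.
by rewrite rmorph1 mul1r big1 ?addr0 // => q _; rewrite rmorph0 mul0r.
Qed.

Lemma next_le sigma F G s : (forall s', F s' <= G s') -> next sigma F s <= next sigma G s.
Proof.
by move=> FG; apply: ler_sum => s' _; rewrite ler_wpM2l // ler0q trans_ge0.
Qed.

Lemma next_cst sigma c s : next sigma (fun=> c) s = c.
Proof.
case: s => [p|]; last by rewrite next_None.
rewrite next_Some; case: ifP => // _; rewrite sum_muC //; exact: nature_strategy.
Qed.

Lemma nextB sigma F G s :
  next sigma (fun s => F s - G s) s = next sigma F s - next sigma G s.
Proof.
rewrite /next -sumrB; apply: eq_bigr => s' _; exact: mulrBr.
Qed.

Definition rw sigma s n : R := ratr (reach_within mu sigma s n).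

Lemma sum_trans sigma s : \sum_s' trans mu sigma s s' = 1.
Proof.
apply: (@fmorph_inj _ _ (ratr : rat -> R)).
rewrite rmorph_sum rmorph1 -(next_cst sigma 1 s).
by apply: eq_bigr => s' _; rewrite mulr1.
Qed.

Lemma sum_path_prob sigma s n :
  \sum_(w : n.-tuple (mc_state A)) path_prob mu sigma s w = 1.
Proof.
elim: n s => [|n IH] s.
  rewrite (bigD1 [tuple]) //= big1 ?addr0 // => w.
  by rewrite [w]tuple0 => /eqP[].
rewrite tuple_sum /= -(sum_trans sigma s); apply: eq_bigr => s' _.
by rewrite -mulr_sumr IH mulr1.
Qed.

Lemma rw0 sigma s : rw sigma s 0 = (hit s)%:R.
Proof.
rewrite /rw /reach_within; case: (boolP (hit s)) => h.
  rewrite (bigD1 [tuple]) /= ?h // big1 ?addr0 ?rmorph1 // => w.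
  by rewrite [w]tuple0 => /andP[_ /eqP[]].
rewrite big1 ?rmorph0 // => w; rewrite [w]tuple0 /= orbF => h'.
by rewrite h' in h.
Qed.

Lemma rwS sigma s n :
  rw sigma s n.+1 = if hit s then 1 else next sigma (rw sigma ^~ n) s.
Proof.
rewrite /rw /reach_within; case: (boolP (hit s)) => h.
  rewrite (eq_bigl xpredT) ?sum_path_prob ?rmorph1 //.
  by move=> w; rewrite /= h.
rewrite big_mkcond tuple_sum rmorph_sum; apply: eq_bigr => s' _ /=.
rewrite -rmorphM; congr ratr; rewrite mulr_sumr [RHS]big_mkcond.
by apply: eq_bigr => w _; rewrite (negbTE h).
Qed.

Lemma rw_ge0 sigma s n : 0 <= rw sigma s n.
Proof.
elim: n s => [|n IH] s; first by rewrite rw0 ler0n.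
rewrite rwS; case: ifP => // _.
by rewrite -(next_cst sigma 0 s); apply: next_le.
Qed.

(** The reachability probability is the least supersolution: by first-step analysis, each finite
    stage [rw] stays below all of them. *)
Definition supersolution sigma (g : mc_state A -> R) :=
  forall s, [/\ 0 <= g s, hit s -> 1 <= g s & ~~ hit s -> next sigma g s <= g s].

Lemma rw_le sigma g s n : supersolution sigma g -> rw sigma s n <= g s.
Proof.
move=> sg; elim: n s => [|n IH] s; have [g0 g1 gn] := sg s.
  by rewrite rw0; case: (boolP (hit s)) => [/g1|].
rewrite rwS; case: (boolP (hit s)) => [/g1 //|/gn]; apply: le_trans.
exact: next_le.
Qed.

Lemma rw_mono sigma s : nondecreasing_seq (rw sigma s).
Proof.
apply/nondecreasing_seqP => n; elim: n s => [|n IH] s.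
  rewrite rw0 rwS; case: ifP => // _.
  by rewrite -[leLHS](next_cst sigma 0 s); apply: next_le => s'; exact: rw_ge0.
by rewrite rwS [leRHS]rwS; case: ifP => // _; apply: next_le.
Qed.

Lemma supersolution1 sigma : supersolution sigma (fun=> 1).
Proof. by move=> s; split => //; rewrite next_cst. Qed.

Lemma rw_cvg sigma s : (rw sigma s @ \oo --> reach R mu sigma s)%classic.
Proof.
apply: nondecreasing_is_cvgn; first exact: rw_mono.
by exists 1 => _ [n _ <-]; apply: rw_le; exact: supersolution1.
Qed.

Lemma rw_reach sigma s n : rw sigma s n <= reach R mu sigma s.
Proof.
apply: nondecreasing_cvgn_le; first exact: rw_mono.
by apply/cvg_ex; exists (reach R mu sigma s); exact: rw_cvg.
Qed.

Lemma reach_le sigma g s : supersolution sigma g -> reach R mu sigma s <= g s.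
Proof.
move=> sg; apply: limr_le.
  by apply/cvg_ex; exists (reach R mu sigma s); exact: rw_cvg.
by apply: nearW => n; exact: rw_le.
Qed.

Lemma reach_ge0 sigma s : 0 <= reach R mu sigma s.
Proof. exact: le_trans (rw_ge0 sigma s 0) (rw_reach _ _ _). Qed.

(** The sum in [next] is finite and commutes with the limit, so the recursion [rwS] passes to the
    limit. *)
Lemma reachE sigma s :
  reach R mu sigma s = if hit s then 1 else next sigma (reach R mu sigma) s.
Proof.
have : (rw sigma s n.+1 @[n --> \oo] --> reach R mu sigma s)%classic.
  by have := @rw_cvg sigma s; rewrite -cvg_shiftS.
have : (rw sigma s n.+1 @[n --> \oo] -->
        (if hit s then 1 else next sigma (reach R mu sigma) s))%classic.
  under eq_cvg do rewrite rwS.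
  case: ifP => _; first exact: cvg_cst.
  apply: cvg_big => //; first exact: add_continuous.
  by move=> s' _; apply: cvgMl_tmp; exact: rw_cvg.
by move=> h1 h2; apply: cvg_unique h2 h1.
Qed.

Lemma reach_None sigma : reach R mu sigma None = 0.
Proof.
apply/le_anti; rewrite reach_ge0 andbT.
pose g s : R := (s != None)%:R.
have -> : 0 = g None by [].
apply: reach_le => s; split; rewrite /g ?ler0n //; first by case: s.
case: s => [p|] _ /=; last by rewrite next_None.
rewrite -[leRHS](next_cst sigma 1 (Some p)); apply: next_le => s'.
by rewrite lern1 leq_b1.
Qed.

(** Provides the ranks: the least such [n] decreases along some transition. *)
Lemma reach_pos sigma s : 0 < reach R mu sigma s -> exists n, 0 < rw sigma s n.
Proof.
move=> h; apply: contrapT => /forallNP H; move: h; apply/negP; rewrite -leNgt.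
apply: limr_le.
  by apply/cvg_ex; exists (reach R mu sigma s); exact: rw_cvg.
by apply: nearW => n; have /negP := H n; rewrite -leNgt.
Qed.

End Chain.

(* [l] orders the vertices by value, and [r] decreases with positive probability
   when every player moves optimally. *)
Definition certificate (V : finType) (A : target_arena V) (l r : V -> nat)
    (v : V) (W : {set V}) : Prop :=
  [/\ forall t x, t \in targets A -> l x <= l t,
      forall p u, p \in players A -> (p, u) \in edges A -> l u <= l p,
      forall p, p \in players A -> p \notin targets A -> 0 < l p ->
        exists u, [/\ (p, u) \in edges A, l u = l p &
          exists2 q, (u, q) \in edges A & r q < r p],
      forall u, u \notin players A ->
        (forall q, (u, q) \in edges A -> l q = l u) \/
        ((exists2 q, (u, q) \in edges A & l q < l u) /\
         (exists2 q, (u, q) \in edges A & l u < l q))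
    & forall w, w \in W -> l w < l v].

(** * Values determined by a certificate *)

Section Values.
Local Open Scope ring_scope.
Variables (R : realType) (V : finType) (A : target_arena V).
Variable mu : V -> V -> rat.
Hypothesis mu_full : full_support_family A mu.

Implicit Types (sigma : strategy A) (s : mc_state A) (p q : playerT A).
Local Notation reach := (reach R mu).
Local Notation value := (value R A mu).
Local Notation valueP := (valueP R mu).

Lemma reach_valueP sigma p : reach sigma (Some p) <= valueP p.
Proof. exact: (le_bigmax _ (fun sigma => reach sigma (Some p))). Qed.

Lemma valueP_target p : val p \in targets A -> 1 <= valueP p.
Proof. by move=> pT; rewrite /Defs.valueP pT; exact: bigmax_ge_id. Qed.

Lemma valueE_player p : value (val p) = valueP p.
Proof. by rewrite /Defs.value valK. Qed.

Lemma valueE_nature u : u \notin players A ->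
  value u = \sum_(v in out A u) ratr (mu u v) * value v.
Proof.
move=> uP; rewrite /Defs.value insubN //.
rewrite -(sum_out (fun v => ratr (mu u v) * value v)) //.
by apply: eq_bigr => p _; rewrite valueE_player.
Qed.

(** As players never move up in [g], its extension by 0 to the sink is a supersolution for all
    strategies at once. *)
Lemma value_le (g : V -> R) :
  (forall v, 0 <= g v) -> (forall t, t \in targets A -> 1 <= g t) ->
  (forall v u, v \in players A -> (v, u) \in edges A -> g u <= g v) ->
  (forall u, u \notin players A -> \sum_(v in out A u) ratr (mu u v) * g v <= g u) ->
  forall v, value v <= g v.
Proof.
move=> g0 gT gP gN.
have gp p : valueP p <= g (val p).
  apply: bigmax_le => [|sigma _].
    by case: (boolP (val p \in targets A)) => [/gT|].
  pose G s := if s is Some q then g (val q) else 0.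
  have -> : g (val p) = G (Some p) by [].
  apply: (reach_le mu_full) => s; split.
  - by case: s => [q|] /=.
  - by case: s => [q|] //= /gT.
  case: s => [q|] _; last by rewrite next_None.
  rewrite next_Some; case: ifP => //= e.
  have uP := nature_strategy sigma q.
  apply: le_trans (gP _ _ (valP q) e); apply: le_trans (gN _ uP).
  rewrite (sum_mu mu_full (fun q => g (val q))) //.
  by rewrite (sum_out (fun v => ratr (mu (val (sigma q)) v) * g v)).
move=> v; case: (boolP (v \in players A)) => [vP|vP].
  by have := gp (Sub v vP); rewrite -valueE_player SubK.
apply: le_trans (gN v vP); rewrite valueE_nature //.
apply: ler_sum => q qv; rewrite ler_wpM2l ?ler0q ?(mu_ge0 mu_full) //.
have qP := out_player vP qv.
by have := gp (Sub q qP); rewrite -valueE_player SubK.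
Qed.

Section Certified.
Variables (l r : V -> nat) (v0 : V) (W : {set V}).
Hypothesis cert : certificate A l r v0 W.
Hypothesis harmonic : forall u, u \notin players A ->
  \sum_(v in out A u) mu u v * (l v)%:R = (l u)%:R.

(** Targets lie in the top layer, so this scaling gives them 1, while layer 0 gets 0. *)
Let L := \max_x l x.
Let g v : R := (l v)%:R / L%:R.

Lemma cert_harmonic u : u \notin players A ->
  \sum_(v in out A u) ratr (mu u v) * g v = g u.
Proof.
move=> uP; rewrite /g -(ratr_nat R (l u)) -harmonic // rmorph_sum mulr_suml.
by apply: eq_bigr => v _; rewrite rmorphM rmorph_nat mulrA.
Qed.

Hypothesis L0 : (0 < L)%N.

Lemma cert_target t : t \in targets A -> g t = 1.
Proof.
case: cert => c1 _ _ _ _ tT; rewrite /g.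
suff -> : l t = L by rewrite divff // pnatr_eq0 -lt0n.
apply/eqP; rewrite eqn_leq leq_bigmax /=.
by apply/bigmax_leqP => x _; exact: c1.
Qed.

Lemma cert_value_le v : value v <= g v.
Proof.
case: (cert) => _ c2 _ _ _; apply: value_le => [x|t /cert_target->|p u pP e|u uP] //.
- exact: divr_ge0.
- by rewrite ler_wpM2r ?invr_ge0 // ler_nat c2.
- by rewrite cert_harmonic.
Qed.

Let good p (u : natureT A) := [&& (val p, val u) \in edges A, l (val u) == l (val p) &
  [exists q, ((val u, q) \in edges A) && (r q < r (val p))%N]].

Lemma cert_valueP_ge (u0 : natureT A) p : g (val p) <= valueP p.
Proof.
(* [u0] is a default for players without a good move; these are targets or lie in layer 0, where the
   deficit is not positive. *)
pose sigma : strategy A := [ffun p => odflt u0 [pick u | good p u]].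
apply: le_trans (reach_valueP sigma p).
pose G s := if s is Some q then g (val q) else 0.
pose d s := G s - reach sigma s.
(* Maximum principle: among the players with maximal deficit [d > 0], the one of
   least rank has a successor of smaller rank with the same deficit. *)
suff : d (Some p) <= 0 by rewrite subr_le0.
pose p0 := [arg max_(q > p) d (Some q)]%O.
have dmax q : d (Some q) <= d (Some p0) by rewrite /p0; case: arg_maxP => // i _; exact.
apply: le_trans (dmax p) _; rewrite leNgt; apply/negP => M0.
pose p1 := [arg min_(q < p0 | d (Some q) == d (Some p0)) r (val q)].
have [/eqP dp1 p1min] : d (Some p1) == d (Some p0) /\
    forall q, d (Some q) == d (Some p0) -> (r (val p1) <= r (val q))%N.
  by rewrite /p1; case: arg_minnP.
have p1T : val p1 \notin targets A.
  apply/negP => p1T; move: M0; rewrite -dp1 /d /G cert_target // reachE //= p1T.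
  by rewrite subrr ltxx.
have lp1 : (0 < l (val p1))%N.
  rewrite lt0n; apply/negP => /eqP l0; move: M0; rewrite -dp1 /d /G /g l0 mul0r.
  by rewrite sub0r oppr_gt0 ltNge reach_ge0.
have [u gu] : exists u, good p1 u.
  case: cert => _ _ c3 _ _; have [u [e lu [q uq rq]]] := c3 _ (valP p1) p1T lp1.
  have uP : u \in ~: players A.
    by rewrite inE; have := edge_player e; rewrite (valP p1) => /esym ->.
  exists (Sub u uP); rewrite /good SubK e lu eqxx; apply/existsP; exists q.
  by rewrite uq.
have : good p1 (sigma p1).
  by rewrite ffunE; case: pickP => //= /(_ u); rewrite gu.
case/and3P => e /eqP lu /existsP[q /andP[uq rq]].
have uP := nature_strategy sigma p1.
have dE : d (Some p1) = \sum_q ratr (mu (val (sigma p1)) (val q)) * d (Some q).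
  have hE : hit (Some p1 : mc_state A) = false by rewrite /= (negbTE p1T).
  rewrite {1}/d reachE // hE next_Some e.
  have -> : G (Some p1) = \sum_q ratr (mu (val (sigma p1)) (val q)) * G (Some q).
    rewrite sum_mu // (sum_out (fun v => ratr (mu (val (sigma p1)) v) * g v)) //.
    by rewrite cert_harmonic // /G /g lu.
  by rewrite -sumrB; apply: eq_bigr => i _; rewrite mulrBr.
have qP : q \in players A by apply: out_player uP _; rewrite inE.
have /eqP : \sum_q ratr (mu (val (sigma p1)) (val q)) * (d (Some p0) - d (Some q)) = 0.
  rewrite -dp1; under eq_bigr do rewrite mulrBr.
  by rewrite sumrB sum_muC // -dE subrr.
rewrite psumr_eq0 => [/allP/(_ (Sub q qP))|i _]; last first.
  by rewrite mulr_ge0 ?subr_ge0 ?ler0q ?(mu_ge0 mu_full).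
rewrite mem_index_enum => /(_ isT); rewrite SubK mulf_eq0 => /orP[].
  have [mu_pos _ _] := mu_full uP.
  by rewrite gt_eqF // ltr0q mu_pos // inE.
rewrite subr_eq0 eq_sym => /p1min; rewrite SubK leqNgt.
by rewrite rq.
Qed.

(** [g] bounds the values in [W] from above and that of [v0] from below. The lower bound asks for a
    nature vertex, in order that strategies exist: this is [v0] itself or the move that the
    certificate grants to [v0], and a target is treated directly. *)
Lemma cert_value_gt : W != set0 -> forall w, w \in W -> value w < value v0.
Proof.
move=> W0 w wW; apply: le_lt_trans (cert_value_le w) _.
case: (cert) => _ _ c3 _ /(_ w wW) lw.
apply: lt_le_trans (_ : g v0 <= _).
  by rewrite ltr_pM2r ?invr_gt0 ?ltr0n // ltr_nat.
case: (boolP (v0 \in players A)) => v0P; last first.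
  rewrite -cert_harmonic // valueE_nature //; apply: ler_sum => q qv.
  rewrite ler_wpM2l ?ler0q ?(mu_ge0 mu_full) //.
  have qP := out_player v0P qv.
  have uP : v0 \in ~: players A by rewrite inE.
  by have := cert_valueP_ge (Sub v0 uP) (Sub q qP); rewrite -valueE_player SubK.
have vE : value v0 = valueP (Sub v0 v0P) by rewrite -valueE_player SubK.
case: (boolP (v0 \in targets A)) => v0T.
  by rewrite cert_target // vE; apply: valueP_target; rewrite SubK.
have [|u [e _ _]] := c3 _ v0P v0T; first exact: leq_ltn_trans lw.
have uP : u \in ~: players A.
  by rewrite inE; have := edge_player e; rewrite v0P => /esym ->.
by rewrite vE; have := cert_valueP_ge (Sub u uP) (Sub v0 v0P); rewrite SubK.
Qed.

End Certified.
End Values.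

(** * Weights that make the layers harmonic *)

Section Weights.
Local Open Scope ring_scope.

(** With all weights 1 the sum is some [D]. If [D] is not 0, raising the weight of a single element
    whose [z] has the opposite sign brings it to 0; normalising preserves this, and everything stays
    rational. *)
Lemma balanced_weights (V : finType) (S : {set V}) (z : V -> rat) :
  S != set0 ->
  (forall x, x \in S -> z x = 0) \/
    ((exists2 x, x \in S & z x < 0) /\ (exists2 x, x \in S & 0 < z x)) ->
  exists m : V -> rat, [/\ forall x, x \in S -> 0 < m x,
    forall x, x \notin S -> m x = 0, \sum_(x in S) m x = 1
    & \sum_(x in S) m x * z x = 0].
Proof.
move=> S0 zS; suff [a a0 az] : exists2 a : V -> rat,
    forall x, x \in S -> 0 < a x & \sum_(x in S) a x * z x = 0.
  have a_gt0 : 0 < \sum_(x in S) a x.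
    have [x xS] := set0Pn _ S0; rewrite (bigD1 x) //= ltr_pwDl ?a0 //.
    by apply: sumr_ge0 => y /andP[/a0/ltW].
  exists (fun x => if x \in S then a x / \sum_(y in S) a y else 0).
  split=> [x xS|x /negbTE->||] //; first by rewrite xS divr_gt0 ?a0.
    rewrite (eq_bigr (fun x => a x / \sum_(y in S) a y)); last by move=> x ->.
    by rewrite -mulr_suml divff // gt_eqF.
  rewrite (eq_bigr (fun x => a x * z x / \sum_(y in S) a y)); last first.
    by move=> x ->; rewrite mulrAC.
  by rewrite -mulr_suml az mul0r.
pose D := \sum_(x in S) z x.
have [D0|D0] := eqVneq D 0.
  by exists (fun=> 1) => // ; rewrite -[RHS]D0; apply: eq_bigr => x _; rewrite mul1r.
suff [x [xS zx Dz]] : exists x, [/\ x \in S, z x != 0 & 0 <= - D / z x].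
  exists (fun y => 1 + (y == x)%:R * (- D / z x)) => [y _|].
    by rewrite ltr_pwDl // mulr_ge0 ?ler0n.
  under eq_bigr do rewrite mulrDl mul1r.
  rewrite big_split /= -/D (bigD1 x) //= eqxx mul1r divfK // big1 ?addr0 ?subrr //.
  by move=> y /andP[_ /negbTE->]; rewrite !mul0r.
case: zS => [z0|[[x xS zx] [y yS zy]]].
  by case/eqP: D0; rewrite /D big1.
case: (ltgtP D 0) D0 => // D0 _; [exists y | exists x]; split => //.
- by rewrite gt_eqF.
- by apply: divr_ge0; rewrite ?oppr_ge0 ltW.
- by rewrite lt_eqF.
- by apply: mulr_le0; rewrite ?oppr_le0 ?invr_le0 ltW.
Qed.

(** [balanced_weights] is applied at each nature vertex to the differences of layers, whose signs
    are controlled by the fourth clause of [certificate]. *)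
Lemma cert_weights (V : finType) (A : target_arena V) l r v W :
  certificate A l r v W -> exists2 mu, full_support_family A mu &
    forall u, u \notin players A ->
      \sum_(v in out A u) mu u v * (l v)%:R = (l u)%:R.
Proof.
case=> _ _ _ c4 _.
have /boolp.choice[mu H] u : exists m : V -> rat, u \notin players A ->
    [/\ forall x, x \in out A u -> 0 < m x,
    forall x, x \notin out A u -> m x = 0, \sum_(x in out A u) m x = 1
    & \sum_(x in out A u) m x * ((l x)%:R - (l u)%:R) = 0].
  case: (boolP (u \in players A)) => uP; first by exists (fun=> 0).
  have u0 : out A u != set0.
    by have /forall_inP := nature_live A; apply; rewrite inE.
  have [|m Hm] := @balanced_weights V (out A u) (fun x => (l x)%:R - (l u)%:R) u0.
    case: (c4 u uP) => [e|[[x xu lx] [y yu ly]]]; [left|right].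
      by move=> x; rewrite inE => /e ->; rewrite subrr.
    split; [exists x|exists y]; rewrite ?inE //.
      by rewrite subr_lt0 ltr_nat.
    by rewrite subr_gt0 ltr_nat.
  by exists m.
exists mu => [u /H[] //|u /H[_ _ m1 mz]].
have : \sum_(x in out A u) mu u x * (l x)%:R - \sum_(x in out A u) mu u x * (l u)%:R = 0.
  by rewrite -sumrB -[RHS]mz; apply: eq_bigr => x _; rewrite mulrBr.
by rewrite -mulr_suml m1 mul1r => /subr0_eq.
Qed.

End Weights.

(** * Optimal positional strategies *)

Section Optimal.
Local Open Scope ring_scope.
Variables (R : realType) (V : finType) (A : target_arena V).
Variable mu : V -> V -> rat.
Hypothesis mu_full : full_support_family A mu.

Implicit Types (sigma : strategy A) (s : mc_state A) (p q : playerT A).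
Local Notation reach := (reach R mu).
Local Notation value := (value R A mu).
Local Notation valueP := (valueP R mu).
Local Notation next := (@next R V A mu).
Local Notation rw := (@rw R V A mu).

(* A profitable deviation [p -> u] from a positional strategy yields a strictly
   better one: where the loss [d] is maximal, neither strategy ever reaches the
   target. *)
Lemma policy_improvement sigma p (u : natureT A) :
  let sigma' : strategy A := [ffun q => if q == p then u else sigma q] in
  val p \notin targets A ->
  reach sigma (Some p) < next sigma' (reach sigma) (Some p) ->
  (forall s, reach sigma s <= reach sigma' s) /\
  reach sigma (Some p) < reach sigma' (Some p).
Proof.
move=> sigma' pT lt_p.
have hp : hit (Some p : mc_state A) = false by rewrite /= (negbTE pT).
have nextE s F : s != Some p -> next sigma' F s = next sigma F s.
  case: s => [q|] qp; last by rewrite !next_None.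
  by rewrite !next_Some /sigma' ffunE -(inj_eq Some_inj) (negbTE qp).
have sub s : ~~ hit s -> reach sigma s <= next sigma' (reach sigma) s.
  move=> /negbTE hs; have [->|sp] := eqVneq s (Some p); first exact: ltW.
  by rewrite nextE // reachE // hs.
suff H s : reach sigma s <= reach sigma' s.
  split => //; apply: lt_le_trans lt_p _.
  by rewrite [leRHS]reachE // hp; apply: next_le.
pose d s := reach sigma s - reach sigma' s.
rewrite -subr_le0 -/(d s).
pose s0 := [arg max_(t > s) d t]%O.
have dmax t : d t <= d s0 by rewrite /s0; case: arg_maxP => // i _; exact.
apply: le_trans (dmax s) _; rewrite leNgt; apply/negP => M0.
have argh t : d t = d s0 -> ~~ hit t.
  move=> dt; apply/negP => ht; move: M0; rewrite -dt /d reachE // [X in _ - X]reachE //.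
  by rewrite ht subrr ltxx.
(* The loss is at most its average over the successors. Where it is maximal, equality holds, so all
   successors of positive probability have maximal loss too; at [p] the inequality is strict, so [p]
   is excluded. The chain thus never leaves this set, which contains no target. *)
have argn t : d t = d s0 -> next sigma' d t = d s0 /\ t != Some p.
  move=> dt; have ht := argh t dt.
  have nd : next sigma' d t <= d s0.
    by rewrite -[leRHS](next_cst mu_full sigma' _ t); apply: next_le.
  have dE : d t <= next sigma' d t.
    by rewrite /d nextB lerB // ?sub // [leRHS]reachE // (negbTE ht).
  split; first by apply/le_anti; rewrite nd -dt.
  apply/eqP => qp; move: nd; rewrite -dt qp leNgt => /negP; apply.
  by rewrite {1}/d nextB [X in _ - X]reachE // hp ltrD2r.
have rw_arg n t : d t = d s0 -> rw sigma t n = 0.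
  elim: n t => [|n IH] t dt; have ht := argh t dt.
    by rewrite rw0 (negbTE ht).
  rewrite rwS // (negbTE ht); apply: big1 => s' _.
  have [nt qp] := argn t dt.
  have /eqP : \sum_s' ratr (trans mu sigma t s') * (d s0 - d s') = 0.
    rewrite nextE // in nt.
    by have := @nextB R V A mu sigma (fun=> d s0) d t; rewrite next_cst // nt subrr.
  rewrite psumr_eq0 => [|i _]; last by rewrite mulr_ge0 ?subr_ge0 ?ler0q ?trans_ge0.
  move=> /allP/(_ s'); rewrite mem_index_enum => /(_ isT).
  rewrite mulf_eq0 => /orP[/eqP->|]; first by rewrite mul0r.
  by rewrite subr_eq0 eq_sym => /eqP/IH ->; rewrite mulr0.
have r0 : reach sigma s0 = 0.
  apply/eqP; rewrite eq_le reach_ge0 // andbT leNgt; apply/negP.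
  by move=> /reach_pos[//|n]; rewrite rw_arg ?ltxx.
by move: M0; rewrite /d r0 sub0r oppr_gt0 ltNge reach_ge0.
Qed.

(** Take a strategy maximising the sum of all reachability probabilities: an improvement at one
    player would lower none of them and raise one. *)
Lemma optimal_strategy (sigma0 : strategy A) : exists sigma,
  forall sigma' s, ~~ hit s -> next sigma' (reach sigma) s <= reach sigma s.
Proof.
pose tot sigma := \sum_p reach sigma (Some p).
pose sigma := [arg max_(sigma > sigma0) tot sigma]%O.
have smax sigma' : tot sigma' <= tot sigma.
  by rewrite /sigma; case: arg_maxP => // i _; exact.
exists sigma => sigma' [p|] /= hp; last by rewrite next_None.
rewrite leNgt; apply/negP => lt_p.
have := @policy_improvement sigma p (sigma' p) hp; rewrite /= => /(_ _)[|le lt].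
  by move: lt_p; rewrite !next_Some ffunE eqxx.
have := smax [ffun q => if q == p then sigma' p else sigma q].
rewrite leNgt => /negP; apply; rewrite /tot (bigD1 p) //= [ltRHS](bigD1 p) //=.
by apply: ltr_leD => //; apply: ler_sum.
Qed.

(** If no deviation is profitable, the probabilities under [sigma] form a supersolution for every
    other strategy. *)
Lemma optimal_value sigma :
  (forall sigma' s, ~~ hit s -> next sigma' (reach sigma) s <= reach sigma s) ->
  forall p, valueP p = reach sigma (Some p).
Proof.
move=> opt p; apply/le_anti; rewrite reach_valueP andbT.
have ge1 s : hit s -> 1 <= reach sigma s by move=> hs; rewrite reachE // hs.
apply: bigmax_le => [|sigma' _].
  case: (boolP (val p \in targets A)) => pT; last exact: reach_ge0.
  exact: ge1.
apply: (reach_le mu_full) => s; split => //; [exact: reach_ge0 | exact: ge1 | exact: opt].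
Qed.

End Optimal.

(** * Layers and ranks read off from the values *)

Section Layers.
Local Open Scope ring_scope.
Variables (R : realType) (V : finType) (A : target_arena V).
Variable mu : V -> V -> rat.
Hypothesis mu_full : full_support_family A mu.
Local Notation value := (value R A mu).

Lemma value_ge0 v : 0 <= value v.
Proof.
have P0 (p : playerT A) : 0 <= valueP R mu p.
  by apply: le_trans (bigmax_ge_id _ _ _ _); exact: ler0n.
case: (boolP (v \in players A)) => vP.
  by have := P0 (Sub v vP); rewrite -valueE_player SubK.
rewrite valueE_nature //; apply: sumr_ge0 => q qv.
rewrite mulr_ge0 ?ler0q ?(mu_ge0 mu_full) //.
by have := P0 (Sub q (out_player vP qv)); rewrite -valueE_player SubK.
Qed.

Lemma value_target t : t \in targets A -> value t = 1.
Proof.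
move=> tT; have tP : t \in players A by apply: (subsetP (targets_sub A)).
apply/le_anti/andP; split.
  apply: (value_le mu_full (g := fun=> 1)) => // u uP; under eq_bigr do rewrite mulr1.
  by have [_ _ mu1] := mu_full uP; rewrite -rmorph_sum mu1 rmorph1.
have -> : value t = valueP R mu (Sub t tP) by rewrite -valueE_player SubK.
by apply: valueP_target; rewrite SubK.
Qed.

Lemma value_le1 v : value v <= 1.
Proof.
apply: (value_le mu_full (g := fun=> 1)) => // u uP; under eq_bigr do rewrite mulr1.
by have [_ _ mu1] := mu_full uP; rewrite -rmorph_sum mu1 rmorph1.
Qed.

(** The rank of a player is the least number of steps within which an optimal strategy reaches the
    target with positive probability; after the first step, some successor needs fewer. *)
Lemma value_progress : exists r : V -> nat,
  (forall p u, p \in players A -> (p, u) \in edges A -> value u <= value p) /\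
  (forall p, p \in players A -> p \notin targets A -> 0 < value p ->
     exists u, [/\ (p, u) \in edges A, value u = value p &
       exists2 q, (u, q) \in edges A & (r q < r p)%N]).
Proof.
have [u0|noN] : (exists u0 : natureT A, True) \/ (forall u, u \in players A).
- case: (boolP [forall u, u \in players A]) => [/forallP|/forallPn[u uP]]; first by right.
  have uN : u \in ~: players A by rewrite inE.
  by left; exists (Sub u uN).
- case: u0 => u0 _; have [sigma opt] := optimal_strategy R mu_full [ffun=> u0].
  have vE := optimal_value mu_full opt.
  have /boolp.choice[r rP] (p : playerT A) : exists k,
      0 < reach R mu sigma (Some p) -> 0 < rw R mu sigma (Some p) k /\
        forall m, 0 < rw R mu sigma (Some p) m -> (k <= m)%N.
    case: (boolP (0 < reach R mu sigma (Some p))) => [/reach_pos h|_]; last by exists 0%N.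
    have [k k0 kmin] := ex_minnP (h mu_full).
    by exists k.
  pose r' v := if insub v is Some p then r p else 0%N.
  have val_u u : u \notin players A ->
      value u = \sum_q ratr (mu u (val q)) * reach R mu sigma (Some q).
    move=> uP; rewrite sum_mu // valueE_nature //.
    rewrite -(sum_out (fun v => ratr (mu u v) * value v)) //.
    by apply: eq_bigr => q _; rewrite valueE_player vE.
  exists r'; split=> [p u pP e|p pP pT].
    have uP : u \notin players A by rewrite -(edge_player e).
    have uN : u \in ~: players A by rewrite inE.
    have -> : value p = reach R mu sigma (Some (Sub p pP)).
      by rewrite -vE -valueE_player SubK.
    case: (boolP (p \in targets A)) => pT.
      have -> : reach R mu sigma (Some (Sub p pP)) = 1 by rewrite reachE //= ?SubK pT.
      exact: value_le1.
    have := opt [ffun=> Sub u uN] (Some (Sub p pP)); rewrite /= ?SubK => /(_ pT).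
    by rewrite next_Some ffunE !SubK e -val_u.
  pose q := Sub p pP : playerT A.
  have -> : value p = reach R mu sigma (Some q) by rewrite -vE -valueE_player SubK.
  move=> r0; have [rw0 rmin] := rP q r0.
  have hp : hit (Some q : mc_state A) = false by rewrite /= ?SubK (negbTE pT).
  case rq : (r q) rw0 => [|m]; first by rewrite rw0 hp ltxx.
  rewrite rwS // hp next_Some SubK; case: ifP => e; last first.
    by move=> /(lt_le_trans)/(_ (rw_reach _ mu_full _ _ _)); rewrite reach_None // ltxx.
  move=> sum0.
  have uP := nature_strategy sigma q.
  exists (val (sigma q)); split=> //.
    by rewrite val_u // reachE // hp next_Some SubK e.
  have [q' q'0] : exists q',
      0 < ratr (mu (val (sigma q)) (val q')) * rw R mu sigma (Some q') m.
    apply: contrapT => /forallNP H; move: sum0; apply/negP; rewrite -leNgt.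
    by apply: sumr_le0 => i _; have /negP := H i; rewrite -leNgt.
  have rw_ge := rw_ge0 R mu_full sigma (Some q') m.
  have m0 : 0 < mu (val (sigma q)) (val q').
    rewrite lt_def (mu_ge0 mu_full) // andbT; apply/eqP => z; move: q'0.
    by rewrite z rmorph0 mul0r ltxx.
  have rq0 : 0 < rw R mu sigma (Some q') m.
    by move: q'0; rewrite pmulr_rgt0 // ltr0q.
  exists (val q').
    apply/negPn/negP => ne; move: m0.
    by have [_ mu_0 _] := mu_full uP; rewrite mu_0 ?ltxx // inE.
  rewrite /r' valK insubT rq ltnS.
  have rc := lt_le_trans rq0 (rw_reach _ mu_full _ _ _).
  by have [_ ->] := rP q' rc.
(* Without nature vertices there are neither edges nor strategies; off the targets the value is then
   the default 0 and no progress is asked for. *)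
exists (fun=> 0%N); split=> [p u pP e|p pP pT].
  by have := edge_player e; rewrite pP noN.
have -> : value p = valueP R mu (Sub p pP) by rewrite -valueE_player SubK.
rewrite /valueP big1_idem ?SubK ?(negbTE pT) ?ltxx //; first exact: maxxx.
by move=> sigma _; have := nature_strategy sigma (Sub p pP); rewrite noN.
Qed.

(** The value of [u] is an average with positive weights. If no successor lies strictly below, or
    none strictly above, then a sum of terms of one sign vanishes, hence so does each difference. *)
Lemma value_balanced u : u \notin players A ->
  (forall q, (u, q) \in edges A -> value q = value u) \/
  ((exists2 q, (u, q) \in edges A & value q < value u) /\
   (exists2 q, (u, q) \in edges A & value u < value q)).
Proof.
move=> uP; have [mu_pos _ mu1] := mu_full uP.
have vE : \sum_(v in out A u) ratr (mu u v) * (value v - value u) = 0.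
  under eq_bigr do rewrite mulrBr.
  rewrite sumrB -valueE_nature // -mulr_suml -rmorph_sum mu1 rmorph1 mul1r.
  exact: subrr.
have pos v : v \in out A u -> 0 < ratr (mu u v) :> R by move=> /mu_pos; rewrite ltr0q.
case: (boolP [exists q, ((u, q) \in edges A) && (value q < value u)]) => [|lo].
  move=> /existsP[q /andP[uq ql]].
  case: (boolP [exists q, ((u, q) \in edges A) && (value u < value q)]) => [|hi].
    by move=> /existsP[q' /andP[uq' qh]]; right; split; [exists q | exists q'].
  left; have hi' v : (u, v) \in edges A -> value v <= value u.
    by move=> e; rewrite leNgt; apply: contra hi => h; apply/existsP; exists v; rewrite e.
  have /eqP : \sum_(v in out A u) ratr (mu u v) * (value u - value v) = 0.
    rewrite -[RHS]oppr0 -[X in _ = - X]vE -sumrN; apply: eq_bigr => v _.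
    by rewrite -mulrN opprB.
  rewrite psumr_eq0 => [/allP H|v uv]; last first.
    by rewrite mulr_ge0 ?(ltW (pos _ uv)) // subr_ge0 hi' //; rewrite inE in uv.
  move=> v uv; have := H v; rewrite mem_index_enum => /(_ isT).
  have uv' : v \in out A u by rewrite inE.
  by rewrite uv' /= mulf_eq0 gt_eqF ?pos //= subr_eq0 => /eqP.
left; have lo' v : (u, v) \in edges A -> value u <= value v.
  by move=> e; rewrite leNgt; apply: contra lo => h; apply/existsP; exists v; rewrite e.
move/eqP: vE; rewrite psumr_eq0 => [/allP H|v uv]; last first.
  by rewrite mulr_ge0 ?(ltW (pos _ uv)) // subr_ge0 lo' //; rewrite inE in uv.
move=> v uv; have := H v; rewrite mem_index_enum => /(_ isT).
have uv' : v \in out A u by rewrite inE.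
by rewrite uv' /= mulf_eq0 gt_eqF ?pos //= subr_eq0 => /eqP.
Qed.

(** Counts the vertices of smaller value; the second term makes layer 0 consist of the vertices of
    value 0. A vertex does not count itself, so the layer is at most [#|V|]. *)
Let lay v := (#|[set x | (value x < value v)%R]| + (0 < value v)%R)%N.

Lemma lay_lt x y : value x < value y -> (lay x < lay y)%N.
Proof.
move=> xy; rewrite /lay; rewrite -addSn; apply: leq_add; last first.
  by rewrite (le_lt_trans (value_ge0 x) xy) leq_b1.
apply: proper_card; apply/properP; split; last first.
  by exists x; rewrite !inE ?ltxx.
by apply/subsetP => z; rewrite !inE => /lt_trans; apply.
Qed.

Lemma lay_eq x y : value x = value y -> lay x = lay y.
Proof. by rewrite /lay => ->. Qed.

Lemma lay_le x y : value x <= value y -> (lay x <= lay y)%N.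
Proof. by rewrite le_eqVlt => /orP[/eqP/lay_eq->|/lay_lt/ltnW]. Qed.

Lemma lay_gt0 v : (0 < lay v)%N -> 0 < value v.
Proof.
rewrite /lay; case: (ltrP 0 (value v)) => // v0; rewrite addn0 card_gt0.
by case/set0Pn => x; rewrite inE => /lt_le_trans/(_ v0); rewrite ltNge value_ge0.
Qed.

Lemma values_certificate v (W : {set V}) : (forall w, w \in W -> value w < value v) ->
  exists l r, certificate A l r v W /\
    forall x, (l x <= #|V|)%N /\ (r x <= #|V|)%N.
Proof.
move=> vW; have [r [le_val prog]] := value_progress.
(* Only the order of the ranks matters; counting compresses them to at most [#|V|], as a certificate
   must be short. *)
pose r' v := #|[set x | (r x < r v)%N]|.
have rlt x y : (r x < r y)%N -> (r' x < r' y)%N.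
  move=> xy; apply: proper_card; apply/properP; split; last first.
    by exists x; rewrite !inE ?ltnn.
  by apply/subsetP => z; rewrite !inE => /ltn_trans; apply.
exists lay, r'; split; last first.
  move=> x; split; last exact: max_card.
  rewrite /lay; apply: leq_trans (_ : #|[set y | (value y < value x)%R]| + 1 <= _)%N.
    by rewrite leq_add2l leq_b1.
  rewrite addn1 -cardsT; apply: proper_card; apply/properP; split.
    by apply/subsetP.
  by exists x; rewrite !inE ?ltxx.
split.
- by move=> t x tT; apply: lay_le; rewrite (value_target tT) value_le1.
- by move=> p u pP e; apply/lay_le/le_val.
- move=> p pP pT /lay_gt0 /(prog p pP pT)[u [e ue [q uq rq]]].
  by exists u; split => //; [exact: lay_eq | exists q => //; exact: rlt].
- move=> u /value_balanced[eq|[[q uq lq] [q' uq' lq']]]; [left|right].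
    by move=> q /eq; exact: lay_eq.
  by split; [exists q | exists q'] => //; exact: lay_lt.
- by move=> w /vW; exact: lay_lt.
Qed.

End Layers.

Lemma certificate_complete (R : realType) (V : finType) (A : target_arena V) v
    (W : {set V}) :
  ~ never_worse R A v W ->
  exists l r, certificate A l r v W /\ forall x, l x <= #|V| /\ r x <= #|V|.
Proof.
move=> /existsNP[mu /not_implyP[mu_full H]].
apply: (values_certificate (R := R) mu_full) => w wW.
by rewrite ltNge; apply/negP => h; apply: H; exists w.
Qed.

Lemma certificate_sound (R : realType) (V : finType) (A : target_arena V) l r v
    (W : {set V}) :
  W != set0 -> certificate A l r v W -> ~ never_worse R A v W.
Proof.
move=> W0 cert H; have [mu mu_full harm] := cert_weights cert.
have [w wW] := H mu mu_full; apply/negP; rewrite -ltNge.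
apply: (cert_value_gt R mu_full cert harm _ W0 wW).
have [_ _ _ _ /(_ w wW) lw] := cert.
exact: leq_trans (leq_ltn_trans (leq0n _) lw) (leq_bigmax v).
Qed.

(** * Encodings of instances *)

Lemma all_iotaP (n : nat) (F : nat -> bool) :
  reflect (forall i : 'I_n, F i) (all F (iota 0 n)).
Proof.
apply: (iffP allP) => [H i|H i]; first by apply: H; rewrite mem_iota /=.
by rewrite mem_iota /= => lt_i; exact: (H (Ordinal lt_i)).
Qed.

Lemma has_iotaP (n : nat) (F : nat -> bool) :
  reflect (exists i : 'I_n, F i) (has F (iota 0 n)).
Proof.
apply: (iffP hasP) => [[i]|[i Fi]].
  by rewrite mem_iota /= => lt_i Fi; exists (Ordinal lt_i).
by exists (i : nat); rewrite // mem_iota /=.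
Qed.

(** Concatenation in terms of positions: each bit of an encoding becomes an arithmetical expression
    in its index. *)
Definition catf {T} (a : nat) (f g : nat -> T) k := if k < a then f k else g (k - a).

Lemma mkseq_cat T (f g : nat -> T) a b :
  mkseq f a ++ mkseq g b = mkseq (catf a f g) (a + b).
Proof.
rewrite /mkseq iotaD map_cat; congr (_ ++ _).
  by apply/eq_in_map => k; rewrite mem_iota /catf => /andP[_ ->].
rewrite add0n -{2}[a]addn0 iotaDl -map_comp; apply/eq_map => k /=.
by rewrite /catf ltnNge leq_addr addKn.
Qed.

Lemma bits_ord n (P : {pred 'I_n}) (p : nat -> bool) :
  (forall i : 'I_n, (i \in P) = p i) -> bits P = mkseq p n.
Proof.
move=> pP; rewrite /bits /mkseq -val_enum_ord -map_comp.
exact: eq_map.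
Qed.

(** Pairs are enumerated row by row, so position [k] is row [k %/ n], column [k %% n]. *)
Lemma bits_pair n (P : {pred 'I_n * 'I_n}) (p : nat -> nat -> bool) :
  (forall i j : 'I_n, ((i, j) \in P) = p i j) ->
  bits P = mkseq (fun k => p (k %/ n) (k %% n)) (n * n).
Proof.
move=> pP; have -> : bits P = [seq p i j | i <- iota 0 n, j <- iota 0 n].
  rewrite -val_enum_ord allpairs_mapl allpairs_mapr /bits.
  rewrite [enum _]enumT unlock /= /prod_enum map_allpairs.
  by apply: eq_allpairs => i j /=.
have -> m : [seq p i j | i <- iota 0 m, j <- iota 0 n] =
    mkseq (fun k => p (k %/ n) (k %% n)) (m * n).
  elim: m => [|m IH] //; rewrite -addn1 iotaD allpairs_cat IH /= cats0 add0n.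
  rewrite mulnDl mul1n /mkseq iotaD map_cat; congr (_ ++ _).
  rewrite add0n -[m * n]addn0 iotaDl -map_comp; apply/eq_in_map => j /=.
  rewrite mem_iota /= => jn; have n0 : 0 < n by apply: leq_ltn_trans jn.
  by rewrite divnMDl // modnMDl divn_small // modn_small // addn0.
by [].
Qed.

Definition nwr_bit n (P T W U : nat -> bool) (E : nat -> nat -> bool) : nat -> bool :=
  catf n (fun=> true) (catf 1 (fun=> false) (catf n P (catf n T (catf n W (catf n U
    (fun k => E (k %/ n) (k %% n))))))).

Definition nwr_length n := n + (1 + (n + (n + (n + (n + n * n))))).

(** Links the dependently typed instances to functions on numbers, which are what expressions can
    speak about. *)
Definition describes (x : nwr_instance) (P T W U : nat -> bool)
    (E : nat -> nat -> bool) : Prop :=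
  [/\ forall i, (i \in players (nwr_arena x)) = P i,
      forall i, (i \in targets (nwr_arena x)) = T i,
      forall i, (i \in nwr_set x) = W i,
      forall i, (i == nwr_vertex x) = U i
    & forall i j, ((i, j) \in edges (nwr_arena x)) = E i j].

Lemma nwr_encodeE x P T W U E : describes x P T W U E ->
  nwr_encode x = mkseq (nwr_bit (nwr_size x) P T W U E) (nwr_length (nwr_size x)).
Proof.
case=> hP hT hW hU hE; rewrite /nwr_encode /nwr_bit /nwr_length.
rewrite (bits_ord hP) (bits_ord hT) (bits_ord hW) (bits_pair hE).
have -> : bits (pred1 (nwr_vertex x)) = mkseq U (nwr_size x).
  by apply: bits_ord => i; rewrite -hU.
have -> n : nseq n true = mkseq (fun=> true) n.
  apply: (@eq_from_nth _ false); rewrite ?size_nseq ?size_mkseq // => i lt_i.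
  by rewrite nth_nseq nth_mkseq lt_i.
have mk1 (s : seq bool) : false :: s = mkseq (fun=> false) 1 ++ s by [].
by rewrite mk1 !mkseq_cat.
Qed.

Definition valid_arena n (P T W U : nat -> bool) (E : nat -> nat -> bool) : bool :=
  [&& all (fun i => all (fun j => E i j ==> (P i == ~~ P j)) (iota 0 n)) (iota 0 n),
      all (fun i => T i ==> P i) (iota 0 n),
      all (fun i => ~~ P i ==> has (fun j => E i j) (iota 0 n)) (iota 0 n),
      has W (iota 0 n)
    & has (fun i => all (fun j => U j == (j == i)) (iota 0 n)) (iota 0 n)].

Lemma valid_describes n P T W U E : valid_arena n P T W U E ->
  exists x, nwr_size x = n /\ describes x P T W U E.
Proof.
case/and5P => /all_iotaP bip /all_iotaP tsub /all_iotaP live.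
move=> /has_iotaP[w0 Ww0] /has_iotaP[v0 /all_iotaP Uv].
have a1 : [set e : 'I_n * 'I_n | E e.1 e.2] \subset
    setX [set i : 'I_n | P i] (~: [set i : 'I_n | P i]) :|:
    setX (~: [set i : 'I_n | P i]) [set i : 'I_n | P i].
  apply/bipartiteP => u v; rewrite !inE /= => e.
  by have /all_iotaP/(_ v) := bip u; rewrite e /= => /eqP.
have a2 : [set i : 'I_n | T i] \subset [set i : 'I_n | P i].
  by apply/subsetP => i; rewrite !inE; apply/implyP/tsub.
have a3 : [forall u in ~: [set i : 'I_n | P i],
    [set v | (u, v) \in [set e : 'I_n * 'I_n | E e.1 e.2]] != set0].
  apply/forall_inP => u; rewrite !inE => uP.
  have /implyP/(_ uP)/has_iotaP[v e] := live u.
  by apply/set0Pn; exists v; rewrite !inE.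
have w1 : [set i : 'I_n | W i] != set0 by apply/set0Pn; exists w0; rewrite inE.
exists (@NwrInstance n (TargetArena a1 a2 a3) [set i : 'I_n | W i] v0 w1).
split=> //; split=> [i|i|i|i|i j] /=; rewrite ?inE //.
by rewrite (eqP (Uv i)).
Qed.

Lemma describes_valid x P T W U E : describes x P T W U E ->
  valid_arena (nwr_size x) P T W U E.
Proof.
case=> hP hT hW hU hE; apply/and5P; split.
- apply/all_iotaP => i; apply/all_iotaP => j; rewrite -hE -!hP.
  by apply/implyP => /(bipartiteP _ _ (edges_bipartite _)) ->.
- apply/all_iotaP => i; rewrite -hT -hP; apply/implyP.
  exact: (subsetP (targets_sub _)).
- apply/all_iotaP => i; rewrite -hP; apply/implyP => iP.
  have /forall_inP/(_ i) := nature_live (nwr_arena x); rewrite inE => /(_ iP).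
  by case/set0Pn => j; rewrite inE hE => e; apply/has_iotaP; exists j.
- by have /set0Pn[i] := nwr_set_neq0 x; rewrite hW => ?; apply/has_iotaP; exists i.
- apply/has_iotaP; exists (nwr_vertex x); apply/all_iotaP => j.
  by rewrite -hU val_eqE.
Qed.

Definition cert_check n (P T W U : nat -> bool) (E : nat -> nat -> bool)
    (l r : nat -> nat) : bool :=
  [&& all (fun t => T t ==> all (fun x => l x <= l t) (iota 0 n)) (iota 0 n),
      all (fun p => all (fun u => P p && E p u ==> (l u <= l p)) (iota 0 n)) (iota 0 n),
      all (fun p => [&& P p, ~~ T p & 0 < l p] ==>
        has (fun u => [&& E p u, l u == l p &
          has (fun q => E u q && (r q < r p)) (iota 0 n)]) (iota 0 n)) (iota 0 n),
      all (fun u => ~~ P u ==>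
        (all (fun q => E u q ==> (l q == l u)) (iota 0 n) ||
         (has (fun q => E u q && (l q < l u)) (iota 0 n) &&
          has (fun q => E u q && (l u < l q)) (iota 0 n)))) (iota 0 n)
    & all (fun v => U v ==> all (fun w => W w ==> (l w < l v)) (iota 0 n)) (iota 0 n)].

Lemma cert_checkP x P T W U E (l r : nat -> nat) : describes x P T W U E ->
  reflect (certificate (nwr_arena x) (fun i => l i) (fun i => r i)
             (nwr_vertex x) (nwr_set x))
    (cert_check (nwr_size x) P T W U E l r).
Proof.
case=> hP hT hW hU hE; apply: (iffP and5P).
- case=> /all_iotaP c1 /all_iotaP c2 /all_iotaP c3 /all_iotaP c4 /all_iotaP c5; split.
  + move=> t i; rewrite hT => Tt; have /implyP/(_ Tt)/all_iotaP := c1 t.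
    exact.
  + move=> p u; rewrite hP hE => Pp e; have /all_iotaP/(_ u) := c2 p.
    by rewrite Pp e.
  + move=> p; rewrite hP hT => Pp Tp lp; have /implyP := c3 p.
    rewrite Pp Tp lp => /(_ isT)/has_iotaP[u /and3P[e /eqP lu]].
    case/has_iotaP => q /andP[uq rq].
    by exists u; rewrite hE; split => //; exists q; rewrite ?hE.
  + move=> u; rewrite hP => uP.
    have /implyP/(_ uP)/orP[/all_iotaP H|H] := c4 u; [left|right].
      by move=> q; rewrite hE => uq; have := H q; rewrite uq => /eqP.
    case/andP: H => /has_iotaP[q /andP[uq lq]] /has_iotaP[q' /andP[uq' lq']].
    by split; [exists q | exists q']; rewrite ?hE.
  + move=> w; rewrite hW => Ww; have := c5 (nwr_vertex x).
    by rewrite -hU eqxx => /all_iotaP/(_ w); rewrite Ww.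
- case=> c1 c2 c3 c4 c5; split; apply/all_iotaP.
  + move=> t; apply/implyP => Tt; apply/all_iotaP => i; apply: c1.
    by rewrite hT.
  + move=> p; apply/all_iotaP => u; apply/implyP => /andP[Pp e]; apply: c2.
      by rewrite hP.
    by rewrite hE.
  + move=> p; apply/implyP => /and3P[Pp Tp lp].
    have [||//|u [e lu [q uq rq]]] := c3 p; rewrite ?hP ?hT //.
    apply/has_iotaP; exists u; rewrite -hE e lu eqxx /=.
    by apply/has_iotaP; exists q; rewrite -hE uq.
  + move=> u; apply/implyP => Pu; apply/orP.
    have uN : u \notin players (nwr_arena x) by rewrite hP.
    case: (c4 u uN) => [H|[[q uq lq] [q' uq' lq']]]; [left|right].
      by apply/all_iotaP => q; apply/implyP; rewrite -hE => /H ->.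
    apply/andP; split; apply/has_iotaP; [exists q|exists q'];
      by rewrite -hE ?uq ?uq'.
  + move=> v; apply/implyP; rewrite -hU => /eqP ->; apply/all_iotaP => w.
    by apply/implyP; rewrite -hW => /c5.
Qed.

(** * Membership in coNP *)

(* The number of leading [true]s among [f 0, ..., f m.-1]. *)
Definition lead (f : nat -> bool) m := \sum_(0 <= i < m) all f (iota 0 i.+1).

Lemma leadP f m : [/\ lead f m <= m, forall k, k < lead f m -> f k
  & lead f m < m -> ~~ f (lead f m)].
Proof.
rewrite /lead big_mkord; elim: m => [|m [le_m below stop]]; first by rewrite big_ord0.
rewrite big_ord_recr /=; set n := (\sum_(_ < _) _) in le_m below stop *.
have [nm|] := boolP (n == m).
  rewrite (eqP nm) in below *.
  have -> : f 0 && all f (iota 1 m) = f m.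
    rewrite -[_ && _]/(all f (iota 0 m.+1)) -addn1 iotaD all_cat /= andbT.
    suff -> : all f (iota 0 m) by [].
    by apply/allP => k; rewrite mem_iota => /below.
  case fm : (f m); rewrite ?addn1 ?addn0; split; rewrite ?ltnn ?fm //.
  by move=> k; rewrite ltnS leq_eqVlt => /orP[/eqP-> | /below].
move=> nm'; have nm : n < m by rewrite ltn_neqAle nm' le_m.
have -> : f 0 && all f (iota 1 m) = false.
  apply/negP; rewrite -[_ && _]/(all f (iota 0 m.+1)) => /allP/(_ n).
  by rewrite mem_iota /= ltnW // (negbTE (stop nm)) => /(_ isT).
by rewrite addn0; split => [|k|_]; [exact: leqW | exact: below | exact: stop].
Qed.

Lemma lead_eq (f : nat -> bool) m n :
  n < m -> (forall k, k < n -> f k) -> ~~ f n -> lead f m = n.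
Proof.
move=> nm below stop; have [le_m lb ls] := leadP f m.
case: (ltngtP (lead f m) n) => // h.
  by move: (ls (ltn_trans h nm)); rewrite below.
by rewrite lb in stop.
Qed.

Section Check.
Variables (sz : nat) (get ug : nat -> bool).
Let n := lead get sz.
Definition get_player i := get (n + (1 + i)).
Definition get_target i := get (n + (1 + (n + i))).
Definition get_set i := get (n + (1 + (n + (n + i)))).
Definition get_vertex i := get (n + (1 + (n + (n + (n + i))))).
Definition get_edge i j := get (n + (1 + (n + (n + (n + (n + (i * n + j))))))).
(** Layers and ranks are rows of [n] bits, read by counting the ones, so every guessed string can be
    read as a certificate. *)
Definition get_layer i : nat := \sum_(0 <= k < n) ug (i * n + k).
Definition get_rank i : nat := \sum_(0 <= k < n) ug (n * n + (i * n + k)).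

Definition well_formed :=
  (sz == nwr_length n) &&
  valid_arena n get_player get_target get_set get_vertex get_edge.
Definition certified :=
  cert_check n get_player get_target get_set get_vertex get_edge get_layer get_rank.
End Check.

Lemma catf_lt T a (f g : nat -> T) k : k < a -> catf a f g k = f k.
Proof. by rewrite /catf => ->. Qed.
Lemma catf_ge T a (f g : nat -> T) k : catf a f g (a + k) = g k.
Proof. by rewrite /catf ltnNge leq_addr addKn. Qed.

Lemma nwr_describable x : exists P T W U E, describes x P T W U E.
Proof.
pose lift (S : pred 'I_(nwr_size x)) (i : nat) :=
  if insub i is Some j then S j else false.
exists (lift (mem (players (nwr_arena x)))), (lift (mem (targets (nwr_arena x)))),
  (lift (mem (nwr_set x))), (lift (pred1 (nwr_vertex x))),
  (fun i j => lift (fun i' => lift (fun j' => (i', j') \in edges (nwr_arena x)) j) i).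
by split=> [i|i|i|i|i j]; rewrite /lift !valK.
Qed.

Section Correct.
Variable s : seq bool.
Let get := nth false s.
Let n := lead get (size s).

Lemma encode_describes x : nwr_encode x = s ->
  nwr_size x = n /\
  describes x (get_player (size s) get) (get_target (size s) get) (get_set (size s) get)
    (get_vertex (size s) get) (get_edge (size s) get).
Proof.
have [P [T [W [U [E D]]]]] := nwr_describable x; rewrite (nwr_encodeE D) => sE.
have szE : size s = nwr_length (nwr_size x) by rewrite -sE size_mkseq.
have getE k : k < nwr_length (nwr_size x) -> get k = nwr_bit (nwr_size x) P T W U E k.
  by move=> lt_k; rewrite /get -sE nth_mkseq.
have nE : n = nwr_size x.
  apply: lead_eq => [|k lt_k|]; first by rewrite szE /nwr_length; lia.
    by rewrite getE /nwr_bit ?catf_lt // /nwr_length; lia.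
  rewrite getE /nwr_bit; last by rewrite /nwr_length; lia.
  by rewrite -[X in catf _ _ _ X]addn0 catf_ge catf_lt.
have lenE : nwr_length n = n + (1 + (n + (n + (n + (n + n * n))))) by [].
rewrite -nE; split=> //; case: D => hP hT hW hU hE; rewrite -nE in getE.
split=> [i|i|i|i|i j].
- have lt_i : i < n by rewrite nE.
  rewrite /get_player -/n getE /nwr_bit; last by lia.
  by rewrite !catf_ge catf_lt.
- have lt_i : i < n by rewrite nE.
  rewrite /get_target -/n getE /nwr_bit; last by lia.
  by rewrite !catf_ge catf_lt.
- have lt_i : i < n by rewrite nE.
  rewrite /get_set -/n getE /nwr_bit; last by lia.
  by rewrite !catf_ge catf_lt.
- have lt_i : i < n by rewrite nE.
  rewrite /get_vertex -/n getE /nwr_bit; last by lia.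
  by rewrite !catf_ge catf_lt.
- have [lt_i lt_j] : i < n /\ j < n by rewrite nE.
  rewrite /get_edge -/n getE /nwr_bit; last by nia.
  rewrite !catf_ge divnMDl ?modnMDl; last by lia.
  by rewrite divn_small // modn_small // addn0.
Qed.

Lemma well_formedP : reflect (exists x, nwr_encode x = s) (well_formed (size s) get).
Proof.
apply: (iffP andP) => [[/eqP szE]|[x sE]]; last first.
  have [nE D] := encode_describes sE.
  split; last by rewrite -/n -nE; exact: describes_valid D.
  have [P [T [W [U [E D']]]]] := nwr_describable x.
  by rewrite -/n -nE -sE (nwr_encodeE D') size_mkseq.
move=> /valid_describes[x [nE D]]; exists x; rewrite (nwr_encodeE D) nE -szE.
apply: (@eq_from_nth _ false); rewrite ?size_mkseq // => k lt_k.
rewrite nth_mkseq // -/(get k).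
have [n_sz n_lo n_hi] := leadP get (size s); rewrite -/n in szE n_sz n_lo n_hi *.
rewrite /nwr_length in szE; rewrite /nwr_bit {1}/catf; case: ltnP => k1.
  by rewrite n_lo.
rewrite {1}/catf; case: ltnP => k2.
  have -> : k = n by lia.
  by apply/esym/negbTE/n_hi; lia.
rewrite {1}/catf; case: ltnP => k3.
  by rewrite /get_player -/n; congr get; lia.
rewrite {1}/catf; case: ltnP => k4.
  by rewrite /get_target -/n; congr get; lia.
rewrite {1}/catf; case: ltnP => k5.
  by rewrite /get_set -/n; congr get; lia.
rewrite {1}/catf; case: ltnP => k6.
  by rewrite /get_vertex -/n; congr get; lia.
by rewrite /get_edge -/n -divn_eq; congr get; lia.
Qed.

End Correct.

(** In [pair_bits], the even positions carry the continuation flags; their leading ones count the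
    bits of the first component. *)
Definition pair_size w := lead (fun i => nth false w (2 * i)) (size w).
Definition pair_fst w i := (i < pair_size w) && nth false w (2 * i).+1.
Definition pair_snd w i := nth false w (2 * pair_size w + 1 + i).

(** A string that encodes no instance belongs to the complement of the language and has to be
    accepted. *)
Definition nwr_verify w :=
  ~~ well_formed (pair_size w) (pair_fst w) ||
  certified (pair_size w) (pair_fst w) (pair_snd w).

Lemma size_pair_bits s u : size (pair_bits s u) = 2 * size s + 1 + size u.
Proof. by elim: s => [|b s IH] //=; rewrite IH; lia. Qed.

Lemma nth_pair_bits s u i : nth false (pair_bits s u) i =
  if i < 2 * size s then (if odd i then nth false s i./2 else true)
  else if i == 2 * size s then false else nth false u (i - 2 * size s - 1).
Proof.
elim: s i => [|b s IH] i.
  by case: i => [|i]; rewrite muln0 //= subn0 subn1.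
case: i => [|[|i]] /=; rewrite ?mulnS // IH negbK !add2n !ltnS !eqSS.
by have -> : i.+2 - (2 * size s).+2 = i - 2 * size s by lia.
Qed.

Lemma nth_pair_prefix s u i : i <= 2 * size s -> nth false (pair_bits s u) i =
  (i < 2 * size s) && ((i %% 2 == 0) || nth false s (i %/ 2)).
Proof.
move=> i_le; rewrite nth_pair_bits divn2 modn2; case: ltnP => h /=.
  by case: (odd i).
by rewrite eqn_leq i_le h.
Qed.

Lemma pair_size_bits s u : pair_size (pair_bits s u) = size s.
Proof.
apply: lead_eq; first by rewrite size_pair_bits; lia.
  by move=> k lt_k; rewrite nth_pair_bits oddM /=; case: ifP => //; lia.
by rewrite nth_pair_bits ltnn eqxx.
Qed.

Lemma pair_fst_bits s u : pair_fst (pair_bits s u) = nth false s.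
Proof.
apply/funext => i; rewrite /pair_fst pair_size_bits nth_pair_bits.
case: ltnP => h; last by rewrite [RHS]nth_default.
have -> : (2 * i).+1 < 2 * size s by lia.
by rewrite /= oddM /= mul2n uphalf_double.
Qed.

Lemma pair_snd_bits s u : pair_snd (pair_bits s u) = nth false u.
Proof.
apply/funext => i; rewrite /pair_snd pair_size_bits nth_pair_bits.
have -> : 2 * size s + 1 + i < 2 * size s = false by lia.
have -> : 2 * size s + 1 + i == 2 * size s = false by lia.
by congr nth; lia.
Qed.

Lemma lf_pair_size : lf (fun s _ => pair_size s).
Proof. by rewrite /pair_size /lead; lf. Qed.

Lemma lf_pair_fst a : lf a -> lf (fun s v => pair_fst s (a s v)).
Proof. by move=> la; rewrite /pair_fst; have lsz := lf_pair_size; lf. Qed.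

Lemma lf_pair_snd a : lf a -> lf (fun s v => pair_snd s (a s v)).
Proof. by move=> la; rewrite /pair_snd; have lsz := lf_pair_size; lf. Qed.

Lemma lf_verify : lf (fun s _ => nwr_verify s).
Proof.
have lsz := lf_pair_size.
have ln : lf (fun s _ => lead (pair_fst s) (pair_size s)).
  by rewrite /lead; repeat first [apply: lf_pair_fst | lf_step].
rewrite /nwr_verify /well_formed /certified /valid_arena /cert_check /nwr_length.
rewrite /get_player /get_target /get_set /get_vertex /get_edge /get_layer /get_rank.
by repeat first [exact: ln | apply: lf_pair_fst | apply: lf_pair_snd | lf_step].
Qed.

Lemma sum_ltn n m : \sum_(0 <= k < n) (k < m) = minn n m.
Proof.
elim: n => [|n IH]; first by rewrite big_geq // min0n.
by rewrite big_nat_recr //= IH; case: ltnP; lia.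
Qed.

Lemma nwr_coNP (R : realType) : coNP (language_of (nwr_problem R)).
Proof.
(* Layers and ranks take [n * n] bits each, and [n] is at most the length of the input. *)
exists ('X * 'X + 'X * 'X)%R, nwr_verify; split.
  apply: (@polytime_mkseq (fun=> 1) (fun s _ => nwr_verify s)); last exact: lf_verify.
  exact: lf_const.
move=> s; rewrite hornerD hornerM hornerX.
have vE u : nwr_verify (pair_bits s u) = ~~ well_formed (size s) (nth false s) ||
    certified (size s) (nth false s) (nth false u).
  by rewrite /nwr_verify pair_size_bits pair_fst_bits pair_snd_bits.
set n := lead (nth false s) (size s).
split=> [nL|[u _]].
  case: (boolP (well_formed (size s) (nth false s))) => wf; last first.
    by exists [::] => //; rewrite vE wf.
  have [x sE] := well_formedP _ wf; have [nE D] := encode_describes sE.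
  rewrite -/n in nE.
  have nw : ~ never_worse R (nwr_arena x) (nwr_vertex x) (nwr_set x).
    by move=> nw; apply: nL; exists x.
  have [l [r [cert lr]]] := certificate_complete nw.
  pose f (h : 'I_(nwr_size x) -> nat) k :=
    if insub (k %/ n) is Some i then k %% n < h i else false.
  pose u := mkseq (catf (n * n) (f l) (f r)) (n * n + n * n).
  exists u.
    rewrite size_mkseq; have [n_sz _ _] := leadP (nth false s) (size s).
    by rewrite -/n in n_sz; rewrite leq_add // leq_mul.
  rewrite vE; apply/orP; right; rewrite /certified -/n.
  have fE h (i : 'I_(nwr_size x)) k : k < n -> f h (i * n + k) = (k < h i).
    move=> kn; have n0 : 0 < n by apply: leq_ltn_trans kn.
    by rewrite /f divnMDl // modnMDl divn_small // modn_small // addn0 valK.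
  have lt_n (i : 'I_(nwr_size x)) k : k < n -> i * n + k < n * n.
    move=> kn; have lt_i : i < n by rewrite -nE.
    nia.
  have lE : (fun i : 'I_(nwr_size x) =>
      get_layer (size s) (nth false s) (nth false u) i) = l.
    apply/funext => i; rewrite /get_layer -/n.
    have l_n : l i <= n by rewrite -nE -[leqRHS]card_ord (lr i).1.
    rewrite -[RHS](minn_idPr l_n) -sum_ltn.
    rewrite !big_mkord; apply: eq_bigr => k _; have lt_k := lt_n i k (ltn_ord k).
    by rewrite nth_mkseq ?catf_lt ?fE // ltn_addr.
  have rE : (fun i : 'I_(nwr_size x) =>
      get_rank (size s) (nth false s) (nth false u) i) = r.
    apply/funext => i; rewrite /get_rank -/n.
    have r_n : r i <= n by rewrite -nE -[leqRHS]card_ord (lr i).2.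
    rewrite -[RHS](minn_idPr r_n) -sum_ltn.
    rewrite !big_mkord; apply: eq_bigr => k _; have lt_k := lt_n i k (ltn_ord k).
    by rewrite nth_mkseq ?catf_ge ?fE // ltn_add2l.
  rewrite -nE; apply/(cert_checkP _ _ D).
  by rewrite lE rE.
rewrite vE => /orP[wf [x sE _]|/= C [x sE nw]].
  by move/negP: wf; apply; apply/well_formedP; exists x.
have [nE D] := encode_describes sE; rewrite -/n in nE.
move: C; rewrite /certified -/n -nE => /(cert_checkP _ _ D) C.
exact: certificate_sound (nwr_set_neq0 x) C nw.
Qed.

(** * Satisfiability as a question about arenas *)

Lemma odd_half_lt u m : u < 2 * m -> u %/ 2 < m.
Proof. by lia. Qed.

(** * Digraphs as arenas without choices *)

Section Digraph.
(* Player [2x] moves to the nature vertex [2x+1], which leads to the players [2y]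
   such that [D x y]. *)
Variables (m : nat) (D : nat -> nat -> bool) (t v : nat) (W : nat -> bool).
Hypothesis D_total : forall x, x < m -> exists2 y, y < m & D x y.
Hypothesis D_t : forall y, D t y = (y == t).
Hypothesis t_lt : t < m.
Hypothesis v_lt : v < m.
Hypothesis W_ex : exists2 w, w < m & W w.

Definition dg_player u := u %% 2 == 0.
Definition dg_target u := u == 2 * t.
Definition dg_set u := (u %% 2 == 0) && W (u %/ 2).
Definition dg_vertex u := u == 2 * v.
Definition dg_edge u w :=
  if u %% 2 == 0 then w == u.+1 else (w %% 2 == 0) && D (u %/ 2) (w %/ 2).

(** A [certificate] whose two vertices for a node share a layer; the condition that players never
    move up then holds by itself. *)
Definition node_cert (h r : nat -> nat) : Prop :=
  [/\ forall x, x < m -> h x <= h t,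
      forall x, x < m -> x != t -> 0 < h x -> exists y, [/\ y < m, D x y & r y < r x],
      forall x, x < m -> (forall y, y < m -> D x y -> h y = h x) \/
        ((exists y, [/\ y < m, D x y & h y < h x]) /\
         (exists y, [/\ y < m, D x y & h x < h y]))
    & forall x, x < m -> W x -> h x < h v].

Lemma dg_valid :
  valid_arena (2 * m) dg_player dg_target dg_set dg_vertex dg_edge.
Proof.
apply/and5P; split.
- apply/all_iotaP => i; apply/all_iotaP => j; apply/implyP.
  rewrite /dg_edge /dg_player; case: eqP => i2 => [/eqP->|/andP[/eqP ->]] //.
  by apply/eqP; case: eqP => //; lia.
- by apply/all_iotaP => i; apply/implyP => /eqP; rewrite /dg_player; lia.
- apply/all_iotaP => i; apply/implyP; rewrite /dg_player /dg_edge => /negbTE ->.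
  have [y y_lt Dy] := D_total (odd_half_lt (ltn_ord i)).
  have lt2 : 2 * y < 2 * m by rewrite ltn_mul2l.
  apply/has_iotaP; exists (Ordinal lt2) => /=.
  by rewrite modnMr mulKn.
- have [w w_lt Ww] := W_ex; have lt2 : 2 * w < 2 * m by rewrite ltn_mul2l.
  by apply/has_iotaP; exists (Ordinal lt2); rewrite /dg_set /= modnMr mulKn.
- have lt2 : 2 * v < 2 * m by rewrite ltn_mul2l.
  by apply/has_iotaP; exists (Ordinal lt2); apply/all_iotaP.
Qed.

Lemma dg_instance (R : realType) : exists x,
  [/\ nwr_size x = 2 * m, describes x dg_player dg_target dg_set dg_vertex dg_edge,
      single_successor x
    & never_worse R (nwr_arena x) (nwr_vertex x) (nwr_set x) <->
      ~ exists h r, node_cert h r].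
Proof.
have [x [nE dx]] := valid_describes dg_valid; exists x; split=> //.
  case: (dx) => hP _ _ _ hE u; rewrite hP /dg_player => uP.
  have lt_u : u.+1 < nwr_size x by have := ltn_ord u; lia.
  rewrite -(cards1 (Ordinal lt_u)); apply: eq_card => w.
  by rewrite !inE hE /dg_edge uP.
have dbl k : k < m -> 2 * k < nwr_size x by rewrite nE ltn_mul2l.
split=> [nw [h [r [n1 n2 n3 n4]]]|nc].
  suff C : certificate (nwr_arena x) (fun i : 'I__ => h (i %/ 2))
      (fun i : 'I__ => r (i %/ 2)) (nwr_vertex x) (nwr_set x).
    exact: certificate_sound (nwr_set_neq0 x) C nw.
  case: dx => hP hT hW hU hE.
  have node (u : 'I_(nwr_size x)) : u %/ 2 < m by have := ltn_ord u; lia.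
  have div2 k : 2 * k %/ 2 = k by lia.
  split.
  - move=> t' u; rewrite hT => /eqP ->; rewrite div2; exact: n1.
  - move=> p u; rewrite hP hE /dg_player /dg_edge => pP; rewrite pP => /eqP ->.
    by have -> : p.+1 %/ 2 = p %/ 2 by lia.
  - move=> p; rewrite hP hT /dg_player /dg_target => pP pT h0.
    have pt : p %/ 2 != t by lia.
    have [y [y_lt Dy ry]] := n2 _ (node p) pt h0.
    have lt_p : p.+1 < nwr_size x by have := ltn_ord p; lia.
    exists (Ordinal lt_p); rewrite hE /dg_edge pP /=.
    have pE : p.+1 %/ 2 = p %/ 2 by lia.
    rewrite pE; split => //; exists (Ordinal (dbl _ y_lt)); rewrite ?hE /dg_edge /=.
      have -> : p.+1 %% 2 == 0 = false by lia.
      by rewrite pE modnMr div2.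
    by rewrite div2.
  - move=> u; rewrite hP /dg_player => uP.
    case: (n3 _ (node u)) => [n|[[y [y_lt Dy hy]] [z [z_lt Dz hz]]]]; [left|right].
      by move=> q; rewrite hE /dg_edge (negbTE uP) => /andP[_ /n]; apply.
    split; [exists (Ordinal (dbl _ y_lt))|exists (Ordinal (dbl _ z_lt))];
      by rewrite ?hE /dg_edge /= ?(negbTE uP) ?modnMr div2.
  - move=> w; rewrite hW /dg_set => /andP[_ Ww].
    have /eqP -> : dg_vertex (nwr_vertex x) by rewrite -hU.
    by rewrite div2; exact: n4 Ww.
apply: contrapT => nw; apply: nc.
have [l0 [r0 [cert _]]] := certificate_complete nw.
pose ext (f : 'I_(nwr_size x) -> nat) k := if insub k is Some i then f i else 0.
pose l := ext l0; pose r := ext r0.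
have lE i : l0 i = l i by rewrite /l /ext valK.
have rE i : r0 i = r i by rewrite /r /ext valK.
exists (fun k => l (2 * k)), (fun k => r (2 * k)).
case: cert => c1 c2 c3 c4 c5; case: dx => hP hT hW hU hE.
have dblS k : k < m -> (2 * k).+1 < nwr_size x by rewrite nE; lia.
have ord_dbl k (k_lt : k < m) : dg_player (Ordinal (dbl _ k_lt)).
  by rewrite /dg_player /= modnMr.
have edge1 k (k_lt : k < m) :
    (Ordinal (dbl _ k_lt), Ordinal (dblS _ k_lt)) \in edges (nwr_arena x).
  by rewrite hE /dg_edge /= modnMr /=.
have oddE k : (2 * k).+1 %% 2 == 0 = false by lia.
have halfE k : (2 * k).+1 %/ 2 = k by lia.
have edge2 k y (k_lt : k < m) (y_lt : y < m) :
    ((Ordinal (dblS _ k_lt), Ordinal (dbl _ y_lt)) \in edges (nwr_arena x)) = D k y.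
  by rewrite hE /dg_edge /= oddE modnMr halfE mulKn.
have edgeP k (k_lt : k < m) q : (Ordinal (dblS _ k_lt), q) \in edges (nwr_arena x) ->
    exists2 y, D k y & exists y_lt : y < m, q = Ordinal (dbl _ y_lt).
  rewrite hE /dg_edge /= oddE halfE => /andP[q2 Dq]; exists (q %/ 2) => //.
  have y_lt : q %/ 2 < m by have := ltn_ord q; lia.
  by exists y_lt; apply/val_inj => /=; lia.
have c4' k (k_lt : k < m) : (forall y, y < m -> D k y -> l (2 * y) = l (2 * k).+1) \/
   ((exists y, [/\ y < m, D k y & l (2 * y) < l (2 * k).+1]) /\
    (exists y, [/\ y < m, D k y & l (2 * k).+1 < l (2 * y)])).
  have uP : Ordinal (dblS _ k_lt) \notin players (nwr_arena x).
    by rewrite hP /dg_player /= oddE.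
  case: (c4 _ uP) => [eq|[[q uq lq] [q' uq' lq']]]; [left|right].
    move=> y y_lt Dy; have := eq (Ordinal (dbl _ y_lt)).
    by rewrite edge2 => /(_ Dy); rewrite !lE.
  move: (edgeP _ _ _ uq) (edgeP _ _ _ uq') lq lq' => -[y Dy [y_lt ->]] [z Dz [z_lt ->]].
  rewrite !lE => ly lz.
  by split; [exists y | exists z].
(* The vertices of a node share a layer: in layer 0 a player cannot move up, in a positive layer it
   has to stay, having one move only. The nature vertex of the target leads to the target alone and
   must have its layer. *)
have GH k : k < m -> l (2 * k).+1 = l (2 * k).
  move=> k_lt; case: (eqVneq k t) => [kt|kt].
    case: (c4' _ k_lt) => [|[[y []]]]; rewrite kt.
      by move=> /(_ t t_lt); rewrite D_t eqxx => ->.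
    move=> _; rewrite D_t => /eqP -> lt1 [z [_]]; rewrite D_t => /eqP ->.
    by move=> lt2; have := ltn_trans lt1 lt2; rewrite ltnn.
  have pP : Ordinal (dbl _ k_lt) \in players (nwr_arena x) by rewrite hP.
  have pT : Ordinal (dbl _ k_lt) \notin targets (nwr_arena x).
    by rewrite hT /dg_target /= eqn_mul2l.
  have le := c2 _ _ pP (edge1 _ k_lt); rewrite !lE /= in le.
  have [l00|l01] := posnP (l (2 * k)); first by move: le; rewrite l00 leqn0 => /eqP.
  have [|u [e lu _]] := c3 _ pP pT; first by rewrite lE.
  move: e lu; rewrite hE /dg_edge /= modnMr /= => /eqP u_eq.
  by rewrite !lE /= u_eq.
split.
- move=> k k_lt; have := c1 (Ordinal (dbl _ t_lt)) (Ordinal (dbl _ k_lt)).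
  by rewrite hT /dg_target /= eqxx !lE => /(_ isT).
- move=> k k_lt kt l1.
  have pP : Ordinal (dbl _ k_lt) \in players (nwr_arena x) by rewrite hP.
  have pT : Ordinal (dbl _ k_lt) \notin targets (nwr_arena x).
    by rewrite hT /dg_target /= eqn_mul2l.
  have [|u [e lu [q uq rq]]] := c3 _ pP pT; first by rewrite lE.
  have u_eq : u = Ordinal (dblS _ k_lt).
    by move: e; rewrite hE /dg_edge /= modnMr /= => /eqP ?; apply/val_inj.
  move: uq rq; rewrite u_eq => /edgeP[y Dy [y_lt ->]]; rewrite !rE.
  by exists y.
- by move=> k k_lt; have := c4' _ k_lt; rewrite GH.
- move=> k k_lt Wk.
  have kW : Ordinal (dbl _ k_lt) \in nwr_set x by rewrite hW /dg_set /= modnMr mulKn.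
  have := c5 _ kW; rewrite !lE /=.
  by have /eqP -> : dg_vertex (nwr_vertex x) by rewrite -hU.
Qed.

End Digraph.

(* Clause [j < nc] contains the literal "variable [i < nv] has value [b]" when
   [lit j i b]. *)
Definition satisfiable nv nc (lit : nat -> nat -> bool -> bool) : Prop :=
  exists a : nat -> bool, forall j, j < nc ->
    exists i b, [/\ i < nv, lit j i b & a i = b].

(** * CNF formulas as digraphs *)

Section Cnf.
Variables (nv nc : nat) (lit : nat -> nat -> bool -> bool).

(* The nodes are V_i = 3i for i <= nv, where V_nv is the target, the literals
   L_(i,b) = 3i+1+b, the sink 3nv+1 and the clauses from 3nv+2 on. Node V_i leads to
   L_(i,0) and L_(i,1), and L_(i,b) leads to V_(i+1) and to the sink. The value
   increases along the V_i and one literal of each variable is at least V_i, so the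
   literals of value below V_0 are consistent. *)
Definition cnf_node x y : bool :=
  if x < 3 * nv then
    if x %% 3 == 0 then (y == x.+1) || (y == x.+2)
    else (y == 3 * nv + 1) || (y == 3 * (x %/ 3) + 3)
  else if x <= 3 * nv + 1 then y == x
  else (y == 3 * nv) || [&& y < 3 * nv, y %% 3 != 0 &
    if y %% 3 == 2 then lit (x - (3 * nv + 2)) (y %/ 3) true
    else lit (x - (3 * nv + 2)) (y %/ 3) false].

Definition cnf_size := 3 * nv + 2 + nc.
(** The clauses and the sink. The sink, whose layer must be 0, forces V_0 into a positive layer, so
    a literal that is at least V_0 differs from the sink. *)
Definition cnf_set x := 3 * nv + 1 <= x.

Lemma clause_node x i (b : bool) : 3 * nv + 2 <= x -> i < nv ->
  cnf_node x (3 * i + 1 + b) = lit (x - (3 * nv + 2)) i b.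
Proof.
move=> xj lt_i; rewrite /cnf_node.
have -> : (x < 3 * nv) = false by lia.
have -> : (x <= 3 * nv + 1) = false by lia.
have -> : (3 * i + 1 + b == 3 * nv) = false by lia.
have -> : (3 * i + 1 + b < 3 * nv) by lia.
have -> : (3 * i + 1 + b) %/ 3 = i by lia.
have -> : ((3 * i + 1 + b) %% 3 == 2) = b by lia.
have -> : ((3 * i + 1 + b) %% 3 != 0) by lia.
by case: b.
Qed.

Lemma sat_node_cert : satisfiable nv nc lit ->
  exists h r, node_cert cnf_size cnf_node (3 * nv) 0 cnf_set h r.
Proof.
case=> a sat.
(* The sink is at 0, true literals at 1, clauses at 2, V_i at 2i+3 and the false literal of variable
   i at 2i+4, between V_i and V_(i+1). So each V_i, each literal and each clause has successors on
   both sides. *)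
pose h x := if x < 3 * nv then
    if x %% 3 == 0 then 2 * (x %/ 3) + 3
    else if a (x %/ 3) == (x %% 3 == 2) then 1 else 2 * (x %/ 3) + 4
  else if x == 3 * nv then 2 * nv + 3 else if x == 3 * nv + 1 then 0 else 2.
(* The number of steps to the target: two per variable from V_i, one less from its literals, one
   from a clause. *)
pose r x := if x < 3 * nv then
    if x %% 3 == 0 then 2 * (nv - x %/ 3) else 2 * (nv - x %/ 3) - 1
  else if x == 3 * nv then 0 else 1.
have hL i (b : bool) : i < nv -> h (3 * i + 1 + b) = if a i == b then 1 else 2 * i + 4.
  move=> lt_i; rewrite /h.
  have -> : (3 * i + 1 + b < 3 * nv) by lia.
  have -> : ((3 * i + 1 + b) %% 3 == 0) = false by lia.
  have -> : (3 * i + 1 + b) %/ 3 = i by lia.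
  by have -> : ((3 * i + 1 + b) %% 3 == 2) = b by lia.
have hV i : i <= nv -> h (3 * i) = 2 * i + 3.
  move=> le_i; rewrite /h; have [lt_i|] := boolP (3 * i < 3 * nv).
    have -> : (3 * i %% 3 == 0) by lia.
    by have -> : 3 * i %/ 3 = i by lia.
  move=> ge_i; have -> : i = nv by lia.
  by rewrite eqxx.
have hF : h (3 * nv + 1) = 0.
  rewrite /h; have -> : (3 * nv + 1 < 3 * nv) = false by lia.
  have -> : (3 * nv + 1 == 3 * nv) = false by lia.
  by rewrite eqxx.
have hC x : 3 * nv + 2 <= x -> h x = 2.
  move=> le_x; rewrite /h; have -> : (x < 3 * nv) = false by lia.
  have -> : (x == 3 * nv) = false by lia.
  by have -> : (x == 3 * nv + 1) = false by lia.
have rV i : i <= nv -> r (3 * i) = 2 * (nv - i).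
  move=> le_i; rewrite /r; have [lt_i|] := boolP (3 * i < 3 * nv).
    have -> : (3 * i %% 3 == 0) by lia.
    by have -> : 3 * i %/ 3 = i by lia.
  move=> ge_i; have -> : i = nv by lia.
  by rewrite eqxx subnn.
have rL i (b : bool) : i < nv -> r (3 * i + 1 + b) = 2 * (nv - i) - 1.
  move=> lt_i; rewrite /r.
  have -> : (3 * i + 1 + b < 3 * nv) by lia.
  have -> : ((3 * i + 1 + b) %% 3 == 0) = false by lia.
  by have -> : (3 * i + 1 + b) %/ 3 = i by lia.
have nodeP x : x < cnf_size -> [\/ exists2 i, i < nv & x = 3 * i,
    exists i, exists2 b : bool, i < nv & x = 3 * i + 1 + b,
    x = 3 * nv | x = 3 * nv + 1 \/ 3 * nv + 2 <= x].
  move=> _; case: (ltnP x (3 * nv)) => x1.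
    case: (eqVneq (x %% 3) 0) => x3; first by apply: Or41; exists (x %/ 3); lia.
    by apply: Or42; exists (x %/ 3), (x %% 3 == 2); lia.
  case: (eqVneq x (3 * nv)) => x2; first exact: Or43.
  by apply: Or44; case: (eqVneq x (3 * nv + 1)) => x3; [left | right; lia].
have dV i (b : bool) : i < nv -> cnf_node (3 * i) (3 * i + 1 + b).
  move=> lt_i; rewrite /cnf_node; have -> : 3 * i < 3 * nv by lia.
  have -> : 3 * i %% 3 == 0 by lia.
  by case: b => /=; lia.
have dL i (b : bool) : i < nv -> cnf_node (3 * i + 1 + b) (3 * nv + 1) /\
    cnf_node (3 * i + 1 + b) (3 * i.+1).
  move=> lt_i; rewrite /cnf_node; have -> : 3 * i + 1 + b < 3 * nv by lia.
  have -> : ((3 * i + 1 + b) %% 3 == 0) = false by lia.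
  by split; rewrite /= ?eqxx //; apply/orP; right; lia.
have dC x : 3 * nv + 2 <= x -> cnf_node x (3 * nv).
  move=> le_x; rewrite /cnf_node; have -> : (x < 3 * nv) = false by lia.
  have -> : (x <= 3 * nv + 1) = false by lia.
  by rewrite eqxx.
exists h, r; split.
- move=> x /nodeP[[i lt_i ->]|[i [b lt_i ->]]|->|[->|/hC ->]]; rewrite (hV nv) //.
  + by rewrite hV; lia.
  + by rewrite hL //; case: ifP; lia.
  + by rewrite hF.
  + lia.
- move=> x /nodeP[[i lt_i ->]|[i [b lt_i ->]]|->|[->|le_x]] xt x0.
  + exists (3 * i + 1 + true); split; [rewrite /cnf_size; lia | exact: dV |].
    by rewrite rL // rV; lia.
  + exists (3 * i.+1); split; [rewrite /cnf_size; lia | by case: (dL i b lt_i) |].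
    by rewrite rL // rV; lia.
  + by rewrite eqxx in xt.
  + by rewrite hF in x0.
  + exists (3 * nv); split; [rewrite /cnf_size; lia | exact: dC |].
    rewrite rV // /r; have -> : (x < 3 * nv) = false by lia.
    by rewrite (negbTE xt); lia.
- move=> x x_lt; case/nodeP: (x_lt) => [[i lt_i xE]|[i [b lt_i xE]]|xE|[xE|le_x]].
  + right; rewrite xE hV; last lia.
    split; [exists (3 * i + 1 + a i)|exists (3 * i + 1 + ~~ a i)];
      (split; [rewrite /cnf_size; lia | exact: dV | rewrite hL //]).
      by rewrite eqxx; lia.
    by case: (a i) => /=; lia.
  + have [dF dN] := dL i b lt_i; right; rewrite xE.
    split; [exists (3 * nv + 1)|exists (3 * i.+1)]; rewrite hL // ?hF ?hV //;
      (split; [rewrite /cnf_size; lia | by [] | by case: ifP; lia]).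
  + left => y _; rewrite /cnf_node xE ltnn leq_addr => /eqP -> //.
  + left => y _; rewrite /cnf_node xE leqnn.
    have -> : (3 * nv + 1 < 3 * nv) = false by lia.
    by move=> /eqP ->.
  + right; rewrite hC //.
    have j_lt : x - (3 * nv + 2) < nc by rewrite /cnf_size in x_lt; lia.
    have [i [b [lt_i lt_b ab]]] := sat _ j_lt.
    split; [exists (3 * i + 1 + b)|exists (3 * nv)].
      split; [rewrite /cnf_size; lia | by rewrite clause_node |].
      by rewrite hL // ab eqxx.
    by split; [rewrite /cnf_size; lia | exact: dC | rewrite hV //; lia].
- move=> x /nodeP[[i lt_i ->]|[i [b lt_i ->]]|->|[->|/hC ->]] Wx.
  + by rewrite /cnf_set in Wx; lia.
  + by rewrite /cnf_set in Wx; lia.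
  + by rewrite /cnf_set in Wx; lia.
  + by rewrite hF (hV 0).
  + by rewrite (hV 0).
Qed.

Lemma node_cert_sat :
  (exists h r, node_cert cnf_size cnf_node (3 * nv) 0 cnf_set h r) ->
  satisfiable nv nc lit.
Proof.
case=> h [r [n1 n2 n3 n4]].
have hF : h (3 * nv + 1) = 0.
  apply/eqP; rewrite -leqn0 leqNgt; apply/negP => h0.
  have [||y [_]] := n2 (3 * nv + 1) _ _ h0; [rewrite /cnf_size; lia | lia |].
  rewrite /cnf_node leqnn; have -> : (3 * nv + 1 < 3 * nv) = false by lia.
  by move=> /eqP ->; rewrite ltnn.
have h00 : 0 < h 0.
  apply: leq_ltn_trans (n4 (3 * nv + 1) _ _); rewrite ?leq0n //.
    by rewrite /cnf_size; lia.
  by rewrite /cnf_set.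
have step i : i < nv -> h 0 <= h (3 * i) ->
    exists2 b : bool, h 0 <= h (3 * i + 1 + b) & h 0 <= h (3 * i.+1).
  move=> lt_i h_i.
  have [b hb] : exists b : bool, h 0 <= h (3 * i + 1 + b).
    have node_i y : cnf_node (3 * i) y = (y == (3 * i).+1) || (y == (3 * i).+2).
      rewrite /cnf_node; have -> : 3 * i < 3 * nv by lia.
      by have -> : 3 * i %% 3 == 0 by lia.
    have [|eq|[_ [y [_]]]] := n3 (3 * i) _; first by rewrite /cnf_size; lia.
      exists false; rewrite addn0 (eq (3 * i + 1)) //; first by rewrite /cnf_size; lia.
      by rewrite node_i addn1 eqxx.
    rewrite node_i => /orP[] /eqP -> /ltnW h_y; [exists false | exists true];
      by apply: leq_trans h_i (leq_trans h_y _); rewrite ?addn0 !addn1.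
  exists b => //.
  have node_b y : cnf_node (3 * i + 1 + b) y = (y == 3 * nv + 1) || (y == 3 * i.+1).
    rewrite /cnf_node; have -> : 3 * i + 1 + b < 3 * nv by lia.
    have -> : ((3 * i + 1 + b) %% 3 == 0) = false by lia.
    by have -> : 3 * ((3 * i + 1 + b) %/ 3) + 3 = 3 * i.+1 by lia.
  have [|eq|[_ [y [_]]]] := n3 (3 * i + 1 + b) _; first by rewrite /cnf_size; lia.
    have F_lt : 3 * nv + 1 < cnf_size by rewrite /cnf_size; lia.
    have := eq _ F_lt; rewrite node_b eqxx hF => /(_ isT) E.
    by move: hb; rewrite -E leqNgt h00.
  rewrite node_b => /orP[] /eqP ->; first by rewrite hF.
  by move=> /ltnW; exact: leq_trans.
have hV i : i <= nv -> h 0 <= h (3 * i).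
  by elim: i => [|i IH] // lt_i; have [b _] := step i lt_i (IH (ltnW lt_i)).
exists (fun i => h (3 * i + 1 + true) < h 0) => j j_lt.
pose x := 3 * nv + 2 + j.
have x_lt : x < cnf_size by rewrite /cnf_size /x ltn_add2l.
have hx : h x < h 0 by apply: n4 => //; rewrite /cnf_set /x; lia.
have node_x y : cnf_node x y -> h y < h 0 ->
    exists i, exists2 b : bool, i < nv & y = 3 * i + 1 + b.
  rewrite /cnf_node; have -> : (x < 3 * nv) = false by rewrite /x; lia.
  have -> : (x <= 3 * nv + 1) = false by rewrite /x; lia.
  case/orP => [/eqP->|/and3P[y1 y3 _] _]; first by rewrite ltnNge hV.
  by exists (y %/ 3), (y %% 3 == 2); lia.
have [y [y_lt Dy hy]] : exists y, [/\ y < cnf_size, cnf_node x y & h y < h 0].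
  have [eq|[[y [y_lt Dy hy]] _]] := n3 x x_lt; last first.
    by exists y; split => //; exact: ltn_trans hx.
  have t_lt : 3 * nv < cnf_size by rewrite /cnf_size; lia.
  have : h (3 * nv) = h x.
    apply: eq => //; rewrite /cnf_node; have -> : (x < 3 * nv) = false by rewrite /x; lia.
    have -> : (x <= 3 * nv + 1) = false by rewrite /x; lia.
    by rewrite eqxx.
  by move=> E; move: hx; rewrite -E ltnNge hV.
have [i [b lt_i yE]] := node_x y Dy hy.
exists i, b; split=> //.
  move: Dy; rewrite yE clause_node ?/x ?leq_addr //.
  by have -> : 3 * nv + 2 + j - (3 * nv + 2) = j by lia.
case: b yE => yE; first by rewrite -yE hy.
(* The two literals of a variable cannot both be below V_0; by [hy] the negative one is, so the
   positive one is not. *)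
apply/negbTE; rewrite -leqNgt; have [[] //] := step i lt_i (hV i (ltnW lt_i)).
by rewrite -yE leqNgt hy.
Qed.

End Cnf.

(** The formula is never written out: the reduction prints an adjacency matrix, for which it
    suffices that the occurrence of a literal in a clause is expressible. *)
Lemma cnf_hard (R : realType) (L : language) (nv nc : seq bool -> nat)
    (lit : seq bool -> nat -> nat -> bool -> bool) :
  lf (fun s _ => nv s) -> lf (fun s _ => nc s) ->
  (forall b, lf (fun s v => lit s (v 0) (v 1) b)) ->
  (forall s, L s <-> ~ satisfiable (nv s) (nc s) (lit s)) ->
  reduces_to L (@restrict (nwr_problem R) single_successor).
Proof.
move=> lnv lnc llit LP.
pose m s := cnf_size (nv s) (nc s).
pose D s := cnf_node (nv s) (lit s).
have lm : lf (fun s _ => m s) by rewrite /m /cnf_size; lf.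
have lD : lf (fun s v => D s (v 0) (v 1)).
  rewrite /D /cnf_node.
  repeat first [lazymatch goal with
    |- lf (fun s v => nat_of_bool (lit s (@?a s v) (@?c s v) ?b)) =>
      refine (lf_app2 (F := fun s i j => lit s i j b) (a := a) (b := c) (llit b) _ _)
    end | lf_step].
pose bit s := nwr_bit (2 * m s) dg_player (dg_target (3 * nv s))
  (dg_set (cnf_set (nv s))) (dg_vertex 0) (dg_edge (D s)).
exists (fun s => mkseq (bit s) (nwr_length (2 * m s))).
  apply: polytime_mkseq; first by rewrite /nwr_length; lf.
  rewrite /bit /nwr_bit /catf /dg_player /dg_target /dg_set /cnf_set /dg_vertex /dg_edge.
  move: (D) (lD) (m) (lm) => E lE k lk.
  repeat first [lazymatch goal with
    |- lf (fun s v => nat_of_bool (E s (@?a s v) (@?c s v))) =>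
      refine (lf_app2 (F := fun s i j => E s i j) (a := a) (b := c) lE _ _)
    end | lf_step].
move=> s.
have t_lt : 3 * nv s < m s by rewrite /m /cnf_size; lia.
have D_total x : x < m s -> exists2 y, y < m s & D s x y.
  rewrite /m /cnf_size => x_lt; case: (boolP (x < 3 * nv s)) => x1.
    case: (boolP (x %% 3 == 0)) => x3.
      by exists x.+1; [lia | rewrite /D /cnf_node x1 x3 eqxx].
    by exists (3 * nv s + 1); [lia | rewrite /D /cnf_node x1 (negbTE x3) eqxx].
  case: (boolP (x <= 3 * nv s + 1)) => x2.
    by exists x; rewrite // /D /cnf_node (negbTE x1) x2.
  by exists (3 * nv s); [lia | rewrite /D /cnf_node (negbTE x1) (negbTE x2) eqxx].
have D_t y : D s (3 * nv s) y = (y == 3 * nv s).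
  by rewrite /D /cnf_node ltnn leq_addr.
have W_ex : exists2 w, w < m s & cnf_set (nv s) w.
  by exists (3 * nv s + 1); rewrite /cnf_set // /m /cnf_size; lia.
have v_lt : 0 < m s by apply: leq_ltn_trans t_lt.
have [x [nE dx ss nw]] := dg_instance D_total D_t t_lt v_lt W_ex R.
exists (exist _ x ss) => /=; first by rewrite (nwr_encodeE dx) nE.
rewrite nw LP; split=> H C; apply: H; first exact: node_cert_sat C.
exact: sat_node_cert C.
Qed.

(** * Computations as satisfiability problems *)

Lemma horner_nat_mono (p : {poly nat}) m n : m <= n -> (p.[m] <= p.[n])%N%R.
Proof.
move=> mn; rewrite /horner; elim: (polyseq p) => [|c q IH] //=.
by rewrite leq_add2r leq_mul.
Qed.

(** * Clauses describing the runs of a machine *)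

Section Tableau.
Variables (M : tm) (p q : {poly nat}).

Notation tape_idx := 'I_(tm_last M).+1.
Definition rule : finType := (tm_state M * {ffun tape_idx -> tm_sym M})%type.

Definition rule_act (rho : rule) : tm_state M * {ffun tape_idx -> tm_sym M * move} :=
  if tm_halt rho.1 then (rho.1, [ffun k => (rho.2 k, Stay)])
  else tm_delta rho.1 rho.2.

Definition rule_of (c : config M) : rule :=
  (cf_state c, [ffun k => cf_tape c k (cf_head c k)]).

Lemma stepE c : let r := rule_act (rule_of c) in
  [/\ cf_state (step c) = r.1,
      forall k i, cf_tape (step c) k i =
        if i == cf_head c k then (r.2 k).1 else cf_tape c k i
    & forall k, cf_head (step c) k = Defs.shift (r.2 k).2 (cf_head c k)].
Proof.
rewrite /step /rule_act /=; case: ifP => _; last first.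
  by case: (tm_delta _ _) => q' act.
by split=> // k *; rewrite !ffunE //=; case: eqP => [->|].
Qed.

Definition tag : finType :=
  (tm_state M + tape_idx + tape_idx * tm_sym M + tape_idx * tm_sym M + rule)%type.

(* The variables at time [t]: state, head positions, tape contents, scanned symbols
   and the applicable rule. *)
Definition vQ x : tag := inl (inl (inl (inl x))).
Definition vH k : tag := inl (inl (inl (inr k))).
Definition vC k a : tag := inl (inl (inr (k, a))).
Definition vS k a : tag := inl (inr (k, a)).
Definition vR rho : tag := inr rho.

Definition literal := (bool * (tag * nat * nat))%type.
Definition pos v (t i : nat) : literal := (true, (v, t, i)).
Definition neg v (t i : nat) : literal := (false, (v, t, i)).

(** The running time on the longest pair of [s] with a guess. The added 2 brings cell 1, where the
    answer is read, into the tableau. *)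
Definition time (s : seq bool) := (q.[(2 * size s + 1 + (p.[size s])%R)%N])%R + 2.
(** Cell 0 holds the end marker and the next [2 * size s + 1] cells the self-delimited [s] with its
    closing 0. *)
Definition guess_start (s : seq bool) := 2 * size s + 2.
Definition guess_end s := guess_start s + (p.[size s])%R.

(** Fills the places where no constraint is meant, as every choice of indices has to yield a
    clause. *)
Definition tautology : seq literal :=
  [:: pos (vQ (tm_init M)) 0 0; neg (vQ (tm_init M)) 0 0].

Definition input_clause (k : tape_idx) (s : seq bool) i : seq literal :=
  if i == 0 then [:: pos (vC k (tm_lend M)) 0 i]
  else if (k == ord0) && (i < guess_end s) then
    if i < guess_start s then
      if (i.-1 < 2 * size s) && ((i.-1 %% 2 == 0) || nth false s (i.-1 %/ 2))
      then [:: pos (vC k (tm_bit M true)) 0 i]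
      else [:: pos (vC k (tm_bit M false)) 0 i]
    else [:: pos (vC k (tm_bit M true)) 0 i; pos (vC k (tm_bit M false)) 0 i;
             pos (vC k (tm_blank M)) 0 i]
  else [:: pos (vC k (tm_blank M)) 0 i].

Definition kind : finType := ('I_11 * rule * tape_idx * tm_sym M)%type.

(* Apart from the last case, which excludes rejection, every run satisfies the
   clauses. Case 8 chooses the guessed word, which case 9 terminates by blanks; the
   others are implications forcing the variables that describe the run to be true,
   by induction on time, so that no uniqueness constraints are needed. *)
Definition clause (kappa : kind) (s : seq bool) (t i j : nat) : seq literal :=
  let: (n, rho, k, a) := kappa in
  let act := rule_act rho in
  match nat_of_ord n with
  | 0 => [:: neg (vH k) t i; neg (vC k a) t i; pos (vS k a) t 0]
  | 1 => neg (vQ rho.1) t 0 :: pos (vR rho) t 0 ::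
           [seq neg (vS k (rho.2 k)) t 0 | k <- enum tape_idx]
  | 2 => [:: neg (vR rho) t 0; pos (vQ act.1) t.+1 0]
  | 3 => [:: neg (vR rho) t 0; neg (vH k) t i;
             pos (vH k) t.+1 (Defs.shift (act.2 k).2 i)]
  | 4 => [:: neg (vR rho) t 0; neg (vH k) t i; pos (vC k (act.2 k).1) t.+1 i]
  | 5 => if i == j then tautology else
         [:: neg (vC k a) t i; neg (vH k) t j; pos (vC k a) t.+1 i]
  | 6 => [:: pos (vQ (tm_init M)) 0 0]
  | 7 => [:: pos (vH k) 0 0]
  | 8 => input_clause k s i
  | 9 => if i < guess_start s then tautology else
         [:: neg (vC ord0 (tm_blank M)) 0 i; pos (vC ord0 (tm_blank M)) 0 i.+1]
  | _ => if a == tm_bit M true then tautology else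
         [:: neg (vC ord_max a) (time s) 1]
  end.

Definition holds (A : tag -> nat -> nat -> bool) (l : literal) :=
  if l.1 then A l.2.1.1 l.2.1.2 l.2.2 else ~~ A l.2.1.1 l.2.1.2 l.2.2.

Definition models s A := forall kappa t i j,
  t < time s -> i < time s -> j < time s -> has (holds A) (clause kappa s t i j).

Lemma tautologyP A : has (holds A) tautology.
Proof. by rewrite /= /holds /=; case: (A _ _ _). Qed.

Definition run w t := iter t (@step M) (init_config M w).
Arguments run : simpl never.
#[local] Arguments tape_of : simpl never.

Lemma run_head w t k : cf_head (run w t) k <= t.
Proof.
elim: t => [|t IH] //; rewrite /run iterS; have [_ _ ->] := stepE (run w t).
by move: IH; set h := cf_head _ _; case: (_.2) => /=; lia.
Qed.

Definition run_model w (v : tag) t i : bool :=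
  let c := run w t in
  match v with
  | inl (inl (inl (inl x))) => cf_state c == x
  | inl (inl (inl (inr k))) => cf_head c k == i
  | inl (inl (inr (k, a))) => cf_tape c k i == a
  | inl (inr (k, a)) => cf_tape c k (cf_head c k) == a
  | inr rho => rule_of c == rho
  end.

Lemma tape_ofS (w : seq bool) i : tape_of M w i.+1 =
  if i < size w then tm_bit M (nth false w i) else tm_blank M.
Proof.
rewrite /tape_of /=; case: ltnP => h; first by rewrite (nth_map false).
by rewrite nth_default ?size_map.
Qed.

Lemma run_models s u : size u <= (p.[size s])%R ->
  cf_tape (run (pair_bits s u) (time s)) ord_max 1 = tm_bit M true ->
  models s (run_model (pair_bits s u)).
Proof.
set w := pair_bits s u => u_le acc [[[n rho] k] a] t i j _ _ _.
have [sQ sC sH] := stepE (run w t); rewrite -/(run w t.+1) in sQ sC sH.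
rewrite /clause; case: n => n /= _.
case: n => [|[|[|[|[|[|[|[|[|[|n]]]]]]]]]].
- rewrite /= /holds /=; case: eqP => [<-|] //=; by case: eqP.
- rewrite /= /holds /=; case: eqP => [eQ|] //=; case: eqP => //= ne.
  apply/hasP; have [k' nk'] : exists k',
      cf_tape (run w t) k' (cf_head (run w t) k') != rho.2 k'.
    apply/existsP; rewrite -negb_forall; apply/negP => /forallP eS; apply: ne.
    rewrite /rule_of eQ [RHS]surjective_pairing; congr (_, _); apply/ffunP => k'.
    by rewrite ffunE; exact/eqP.
  exists (neg (vS k' (rho.2 k')) t 0); first by apply/map_f; rewrite mem_enum.
  by [].
- by rewrite /= /holds /=; case: eqP => [<-|] //=; rewrite -sQ eqxx.
- rewrite /= /holds /=; case: eqP => [<-|] //=; case: eqP => [<-|] //=.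
  by rewrite sH eqxx.
- rewrite /= /holds /=; case: eqP => [<-|] //=; case: eqP => [<-|] //=.
  by rewrite sC eqxx eqxx.
- case: eqP => [_|ij]; first exact: tautologyP.
  rewrite /= /holds /=; case: eqP => [<-|] //=; case: eqP => [hj|] //=.
  rewrite sC hj.
  have -> : (i == j) = false by apply/eqP.
  by rewrite eqxx.
- by rewrite /= /holds /= ?eqxx.
- by rewrite /= /holds /= ?eqxx.
- rewrite /input_clause; case: i => [|i] /=.
    by rewrite /holds /= /tape_of /= ?eqxx.
  case: (boolP (k == ord0)) => [/eqP ->|k0] /=; last first.
    by rewrite /holds /= (negbTE k0) tape_ofS ?eqxx.
  have w_size : size w = 2 * size s + 1 + size u by exact: size_pair_bits.
  case: ifP => ie; last first.
    rewrite /= /holds /= tape_ofS /= ltnNge.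
    have -> : size w <= i by rewrite w_size; move: ie; rewrite /guess_end /guess_start; lia.
    by rewrite eqxx.
  case: ifP => io; last first.
    rewrite /= /holds /= tape_ofS /=.
    by case: ifP => _; rewrite ?eqxx ?orbT //; case: (nth _ _ _); rewrite ?eqxx ?orbT.
  have i_lt : i < size w by rewrite w_size; move: io; rewrite /guess_start; lia.
  have i_le : i <= 2 * size s by move: io; rewrite /guess_start; lia.
  by case: ifP => b; rewrite /= /holds /= tape_ofS i_lt nth_pair_prefix // b eqxx.
- case: ifP => [_|io]; first exact: tautologyP.
  have i_pos : i = i.-1.+1 by move: io; rewrite /guess_start; lia.
  rewrite /= /holds /= i_pos !tape_ofS.
  case: (ltnP i.-1 (size w)) => h1; last by rewrite ltnNge leqW // eqxx orbT.
  case: eqP => // e; have := tm_uniq M; rewrite /= !inE !negb_or.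
  by move: e; case: (nth _ _ _) => ->; rewrite eqxx ?andbF.
- case: eqP => [_|a1]; first exact: tautologyP.
  by rewrite /= /holds /= acc orbF; apply/eqP => /esym.
Qed.

(** The guess ends at the first of its cells that the model allows to be blank; case 9 spreads the
    blanks from there. If the model allows both bits in a cell, 1 is taken. *)
Lemma models_run s A : models s A -> exists2 u, size u <= (p.[size s])%R &
  forall t, t <= time s -> forall k i, i < time s ->
    A (vC k (cf_tape (run (pair_bits s u) t) k i)) t i.
Proof.
move=> H; set P := (p.[size s])%R; set o := guess_start s.
have T0 : 0 < time s by rewrite /time addn2.
pose rho0 : rule := rule_of (init_config M [::]).
pose blank m := A (vC ord0 (tm_blank M)) 0 (o + m).
pose len := lead (fun m => ~~ blank m) P.
have [len_le len_lo len_hi] := leadP (fun m => ~~ blank m) P.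
rewrite -/len in len_le len_lo len_hi.
pose u := mkseq (fun m => A (vC ord0 (tm_bit M true)) 0 (o + m)) len.
have u_size : size u = len by rewrite size_mkseq.
exists u; first by rewrite u_size.
set w := pair_bits s u.
have w_size : size w = 2 * size s + 1 + len by rewrite /w size_pair_bits u_size.
have blank_hi m : len <= m -> m < P -> o + m < time s -> blank m.
  move=> lm; rewrite -(subnKC lm); elim: (m - len) => [|d IH] mP mT.
    by rewrite addn0 in mP mT *; apply/negPn/len_hi.
  have := H (@Ordinal 11 9 isT, rho0, ord0, tm_blank M) 0 (o + (len + d)) 0 T0 _ T0.
  rewrite /clause /= -/o; have -> : (o + (len + d) < o) = false by lia.
  rewrite /= /holds /= orbF => /(_ _)/orP[].
  - by lia.
  - by rewrite -/(blank (len + d)) IH //; lia.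
  - by rewrite /blank !addnS.
have init k i : i < time s -> A (vC k (tape_of M (if k == ord0 then w else [::]) i)) 0 i.
  move=> iT; have := H (@Ordinal 11 8 isT, rho0, k, tm_blank M) 0 i 0 T0 iT T0.
  rewrite /clause /= /input_clause; case: i iT => [|i] iT.
    by rewrite /= /holds /= orbF /tape_of.
  rewrite tape_ofS; case: (boolP (k == ord0)) => [/eqP ->|k0] /=; last first.
    by rewrite /holds /= orbF.
  case: ifP => ie; last first.
    rewrite /= /holds /= orbF ltnNge.
    have -> // : size w <= i.
    by rewrite w_size; move: ie; rewrite /guess_end /guess_start -/P; lia.
  case: ifP => io.
    have i_lt : i < size w by rewrite w_size; move: io; rewrite /guess_start; lia.
    have i_le : i <= 2 * size s by move: io; rewrite /guess_start; lia.
    by rewrite i_lt nth_pair_prefix //; case: ifP => b; rewrite /= /holds /= orbF.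
  pose m := i.+1 - o.
  have iE : i.+1 = o + m by rewrite /m; move: io; rewrite -/o; lia.
  have mP : m < P by rewrite /m; move: ie; rewrite /guess_end -/o -/P; lia.
  case: (ltnP m len) => m_len.
    have i_lt : i < size w by rewrite w_size; move: iE m_len; rewrite /o /guess_start; lia.
    have -> : nth false w i = nth false u m.
      rewrite /w nth_pair_bits; have -> : (i < 2 * size s) = false.
        by move: iE; rewrite /o /guess_start; lia.
      have -> : (i == 2 * size s) = false.
        by move: iE; rewrite /o /guess_start; lia.
      by congr nth; move: iE; rewrite /o /guess_start; lia.
    rewrite i_lt /u nth_mkseq // iE /= /holds /= orbF -/(blank m).
    by rewrite (negbTE (len_lo _ m_len)) orbF; case b : (A (vC _ (tm_bit M true)) _ _).
  move=> _; have -> : (i < size w) = false.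
    by rewrite w_size; move: iE m_len; rewrite /o /guess_start; lia.
  by rewrite iE; apply: blank_hi; rewrite -?iE.
have main t : t <= time s ->
    [/\ A (vQ (cf_state (run w t))) t 0,
        forall k, A (vH k) t (cf_head (run w t) k)
      & forall k i, i < time s -> A (vC k (cf_tape (run w t) k i)) t i].
  elim: t => [|t IH] tT.
    split=> [|k|k i].
    - have := H (@Ordinal 11 6 isT, rho0, ord0, tm_blank M) 0 0 0 T0 T0 T0.
      by rewrite /clause /= /holds /= orbF.
    - have := H (@Ordinal 11 7 isT, rho0, k, tm_blank M) 0 0 0 T0 T0 T0.
      by rewrite /clause /= /holds /= orbF.
    - exact: init.
  have [AQ AH AC] := IH (ltnW tT).
  have headT k : cf_head (run w t) k < time s := leq_ltn_trans (run_head w t k) tT.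
  pose rho := rule_of (run w t).
  have AS k : A (vS k (rho.2 k)) t 0.
    rewrite /rho /= ffunE; set a := cf_tape _ _ _.
    have := H (@Ordinal 11 0 isT, rho0, k, a) t _ 0 tT (headT k) T0.
    by rewrite /clause /= /holds /= AH AC //= orbF.
  have AR : A (vR rho) t 0.
    have := H (@Ordinal 11 1 isT, rho, ord0, tm_blank M) t 0 0 tT T0 T0.
    rewrite /clause [has _ _]/= {1}/holds /= AQ /= => /orP[//|/hasP[l /mapP[k _ ->]]].
    by rewrite /holds /= AS.
  have [sQ sC sH] := stepE (run w t).
  split=> [|k|k i iT].
  - have := H (@Ordinal 11 2 isT, rho, ord0, tm_blank M) t 0 0 tT T0 T0.
    by rewrite /clause /= /holds /= AR /= orbF -sQ.
  - have := H (@Ordinal 11 3 isT, rho, k, tm_blank M) t _ 0 tT (headT k) T0.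
    by rewrite /clause /= /holds /= AR AH /= orbF -sH.
  - have := H (@Ordinal 11 4 isT, rho, k, tm_blank M) t _ 0 tT (headT k) T0.
    rewrite /clause /= /holds /= AR AH /= orbF.
    have := H (@Ordinal 11 5 isT, rho, k, cf_tape (run w t) k i) t i _ tT iT (headT k).
    rewrite /clause [run w t.+1]iterS sC /=; case: eqP => [->|ij] //.
    by move=> h _; move: h; rewrite /= /holds /= AC // AH /= orbF.
by move=> t /main[_ _].
Qed.
End Tableau.

(** * Expressibility of membership in a clause *)

Section LiteralMembership.
Variable V : eqType.
Implicit Type ls : seq bool -> (nat -> nat) -> seq (bool * (V * nat * nat)).

(** Clauses are lists and no values of expressions; their content is tested literal by literal, with
    sign and tag fixed and the two indices computed. *)
Definition lf_mem ls := forall b v X Y, lf X -> lf Y ->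
  lf (fun s w => (b, (v, X s w, Y s w)) \in ls s w).

Lemma lf_mem_nil : lf_mem (fun _ _ => [::]).
Proof. by move=> b v X Y _ _; exact: (lf_const 0). Qed.

Lemma lf_mem_cons b0 v0 T I ls : lf T -> lf I -> lf_mem ls ->
  lf_mem (fun s w => (b0, (v0, T s w, I s w)) :: ls s w).
Proof.
move=> lT lI l_ls b v X Y lX lY; have := l_ls b v X Y lX lY => lr.
have H : lf (fun s w => [&& b == b0, v == v0, X s w == T s w & Y s w == I s w] ||
    ((b, (v, X s w, Y s w)) \in ls s w)).
  apply: lf_or => //; apply: lf_and; first exact: lf_const.
  by apply: lf_and; [exact: lf_const | lf].
by apply: (lf_eq _ H) => s w; rewrite in_cons !xpair_eqE -!andbA.
Qed.

Lemma lf_mem_if (c : seq bool -> (nat -> nat) -> bool) ls1 ls2 :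
  lf c -> lf_mem ls1 -> lf_mem ls2 ->
  lf_mem (fun s w => if c s w then ls1 s w else ls2 s w).
Proof.
move=> lc l1 l2 b v X Y lX lY; have l1' := l1 b v X Y lX lY; have l2' := l2 b v X Y lX lY.
by apply: (lf_eq _ (lf_ifb lc l1' l2')) => s w; case: (c s w).
Qed.

Lemma lf_mem_map (J : Type) (r : seq J) b0 (f : J -> V) T I : lf T -> lf I ->
  lf_mem (fun s w => [seq (b0, (f k, T s w, I s w)) | k <- r]).
Proof.
by move=> lT lI; elim: r => [|k r IH]; [exact: lf_mem_nil | exact: lf_mem_cons].
Qed.

End LiteralMembership.

(** * Numbering of variables and clauses *)

Section Hardness.
Variables (M : tm) (p q : {poly nat}).
Local Notation tmax := (time p q).
Local Notation cls := (@clause M p q).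
Local Notation kd := (kind M).
Local Notation tg := (tag M).

Lemma lf_time : lf (fun s _ => tmax s).
Proof. by rewrite /time; lf. Qed.

Lemma lf_mem_clause (kappa : kd) T I J : lf T -> lf I -> lf J ->
  lf_mem (fun s w => cls kappa s (T s w) (I s w) (J s w)).
Proof.
move=> lT lI lJ; have lt := lf_time; have l0 := lf_const 0; have l1 := lf_const 1.
have lTS := lf_succ lT; have lIS := lf_succ lI.
have ltaut : lf_mem (fun _ _ => tautology M).
  by do 2!apply: lf_mem_cons => //; exact: lf_mem_nil.
have lgs : lf (fun s _ => guess_start s) by rewrite /guess_start; lf.
have lge : lf (fun s _ => guess_end p s) by rewrite /guess_end; lf.
case: kappa => [[[[n n_lt] rho] k] a]; rewrite /clause.
case: n n_lt => [|[|[|[|[|[|[|[|[|[|n]]]]]]]]]] n_lt /=.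
- by do 3!apply: lf_mem_cons => //; exact: lf_mem_nil.
- by do 2!apply: lf_mem_cons => //; exact: lf_mem_map.
- by do 2!apply: lf_mem_cons => //; exact: lf_mem_nil.
- do 3!apply: lf_mem_cons => //.
  by case: (_.2) => /=; lf.
- by do 3!apply: lf_mem_cons => //; exact: lf_mem_nil.
- apply: lf_mem_if => //; first by lf.
  by do 3!apply: lf_mem_cons => //; exact: lf_mem_nil.
- by apply: lf_mem_cons => //; exact: lf_mem_nil.
- by apply: lf_mem_cons => //; exact: lf_mem_nil.
- rewrite /input_clause.
  have lnil := @lf_mem_nil tg.
  apply: lf_mem_if; [by lf | exact: lf_mem_cons |].
  apply: lf_mem_if; [by case: (k == ord0) => /=; lf | | exact: lf_mem_cons].
  apply: lf_mem_if; [by lf | | by do 3!apply: lf_mem_cons => //].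
  by apply: lf_mem_if; [lf | exact: lf_mem_cons | exact: lf_mem_cons].
- apply: lf_mem_if => //; first by lf.
  by do 2!apply: lf_mem_cons => //; exact: lf_mem_nil.
- by case: (a == _) => //; apply: lf_mem_cons => //; exact: lf_mem_nil.
Qed.

(** Clauses also speak of the next time and of the next cell, so the indices of variables may equal
    [tmax s]. Hence variables are numbered in base [tmax s] plus one, clauses in base [tmax s]. *)
Lemma clause_bound kappa s t i j : t < tmax s -> i < tmax s -> j < tmax s ->
  forall l, l \in cls kappa s t i j -> l.2.1.2 <= tmax s /\ l.2.2 <= tmax s.
Proof.
move=> tT iT jT l l_in; apply/andP; move: l l_in; apply/allP.
have T1 : 1 <= tmax s by apply: leq_ltn_trans tT.
have ltaut : all (fun l => (l.2.1.2 <= tmax s) && (l.2.2 <= tmax s)) (tautology M) by [].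
case: kappa => [[[[n n_lt] rho] k] a]; rewrite /clause.
case: n n_lt => [|[|[|[|[|[|[|[|[|[|n]]]]]]]]]] n_lt; rewrite ?[nat_of_ord _]/=.
- by rewrite /= !(ltnW tT) (ltnW iT).
- rewrite /= !(ltnW tT) /=; apply/allP => l /mapP[k' _ ->] /=.
  by rewrite (ltnW tT).
- by rewrite /= (ltnW tT) tT.
- rewrite /= !(ltnW tT) (ltnW iT) tT /= andbT.
  by case: (_.2) => /=; lia.
- by rewrite /= !(ltnW tT) (ltnW iT) tT.
- by case: ifP => // _; rewrite /= (ltnW tT) (ltnW iT) (ltnW jT) tT.
- by [].
- by [].
- rewrite /input_clause; do 4?[case: ifP => _] => //=; by rewrite ?(ltnW iT).
- by case: ifP => // _; rewrite /= (ltnW iT) iT.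
- by case: ifP => // _; rewrite /= leqnn T1.
Qed.

Let N s := tmax s.
Let B s := (tmax s).+1.

Definition num_vars s := #|tg| * B s * B s.
Definition num_clauses s := #|kd| * N s * N s * N s.

(** The numbers are decoded as digits, the leading one being the rank of a kind or a tag. Both types
    are fixed with the machine, so their elements can be tried one by one. *)
Definition num_lit s (j x : nat) (b : bool) : bool :=
  has (fun kappa : kd => (j %/ N s %/ N s %/ N s == enum_rank kappa) &&
    has (fun v : tg => (x %/ B s %/ B s == enum_rank v) &&
      ((b, (v, x %/ B s %% B s, x %% B s)) \in
        cls kappa s (j %/ N s %/ N s %% N s) (j %/ N s %% N s) (j %% N s)))
      (enum tg)) (enum kd).

Lemma lf_num_lit b : lf (fun s w => num_lit s (w 0) (w 1) b).
Proof.
have lN : lf (fun s _ => N s) by exact: lf_time.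
have lB : lf (fun s _ => B s) by apply: lf_succ; exact: lf_time.
apply: lf_static_has => kappa; apply: lf_and; first by lf.
apply: lf_static_has => v; apply: lf_and; first by lf.
by apply: lf_mem_clause; lf.
Qed.

Lemma decode2 c t i b : t < b -> i < b -> let x := (c * b + t) * b + i in
  [/\ x %/ b %/ b = c, x %/ b %% b = t & x %% b = i].
Proof.
move=> tb ib x; have b0 : 0 < b by apply: leq_ltn_trans tb.
have xb : x %/ b = c * b + t by rewrite /x divnMDl // divn_small // addn0.
rewrite xb divnMDl // modnMDl [t %/ b]divn_small // addn0 modn_small //.
by rewrite /x modnMDl modn_small.
Qed.

Lemma code2_lt c t i b n : c < n -> t < b -> i < b -> (c * b + t) * b + i < n * b * b.
Proof.
move=> cn tb ib; have : c * b + t < n * b by nia.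
by move: (c * b + t) (n * b) => x y; nia.
Qed.

Lemma satisfiable_models s :
  satisfiable (num_vars s) (num_clauses s) (num_lit s) <->
  exists A : tg -> nat -> nat -> bool, models p q s A.
Proof.
split=> [[a sat]|[A mA]].
  exists (fun v t i => a ((enum_rank v * B s + t) * B s + i)) => kappa t i j tT iT jT.
  pose J := ((enum_rank kappa * N s + t) * N s + i) * N s + j.
  have J_lt : J < num_clauses s.
    have := code2_lt (ltn_ord (enum_rank kappa)) tT iT.
    rewrite /J /num_clauses -/(N s).
    move: (_ * N s + i) (_ * N s * N s) jT => x y; rewrite -/(N s).
    by move: (N s) => n; nia.
  have J_dec : [/\ J %/ N s %/ N s %/ N s = enum_rank kappa,
      J %/ N s %/ N s %% N s = t, J %/ N s %% N s = i & J %% N s = j].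
    have n0 : 0 < N s by apply: leq_ltn_trans tT.
    have J1 : J %/ N s = (enum_rank kappa * N s + t) * N s + i.
      by rewrite /J divnMDl // divn_small // addn0.
    have [d1 d2 d3] := decode2 (enum_rank kappa) tT iT.
    by rewrite J1; split=> //; rewrite /J modnMDl modn_small.
  have [x [b [x_lt lit ax]]] := sat J J_lt.
  case: J_dec lit => j1 j2 j3 j4; rewrite /num_lit j1 j2 j3 j4.
  case/hasP => kappa' _ /andP[/eqP/ord_inj/enum_rank_inj <-].
  case/hasP => v _ /andP[/eqP xv l_in].
  apply/hasP; exists (b, (v, x %/ B s %% B s, x %% B s)) => //.
  rewrite /holds /= -xv -divn_eq -divn_eq ax.
  by case: (b).
pose a x := if insub (x %/ B s %/ B s) is Some r then
  A (enum_val (r : 'I_#|tg|)) (x %/ B s %% B s) (x %% B s) else false.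
exists a => J J_lt.
have n0 : 0 < N s by rewrite /N /time addn2.
have r_lt : J %/ N s %/ N s %/ N s < #|kd|.
  by rewrite !ltn_divLR.
pose kappa := enum_val (Ordinal r_lt).
have kE : J %/ N s %/ N s %/ N s == enum_rank kappa by rewrite /kappa enum_valK.
have mod_lt y : y %% N s < tmax s by rewrite ltn_mod.
have /hasP[[b [[v t'] i']] l_in hl] := mA kappa _ _ _ (mod_lt (J %/ N s %/ N s))
  (mod_lt (J %/ N s)) (mod_lt J).
have [/= t'T i'T] := clause_bound (mod_lt _) (mod_lt _) (mod_lt _) l_in.
have [d1 d2 d3] := decode2 (enum_rank v) (t'T : t' < B s) (i'T : i' < B s).
exists ((enum_rank v * B s + t') * B s + i'), b; split.
- exact: code2_lt.
- apply/hasP; exists kappa; rewrite ?mem_enum // kE /=.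
  by apply/hasP; exists v; rewrite ?mem_enum // d1 d2 d3 eqxx.
- rewrite /a d1 d2 d3 valK enum_rankK.
  by move: hl; rewrite /holds /=; case: (b) => [|/negbTE].
Qed.

End Hardness.

Lemma run_halted (M : tm) w n m y : outputs_in M w n y -> n <= m ->
  cf_tape (run M w m) ord_max =1 tape_of M y.
Proof.
case=> halt out nm; rewrite /run -(subnK nm) iterD.
suff -> : iter (m - n) (@step M) (iter n (@step M) (init_config M w)) =
  iter n (@step M) (init_config M w) by [].
elim: (m - n) => //= k ->.
by rewrite /step halt.
Qed.

Lemma coNP_hard_single (R : realType) :
  coNP_hard (@restrict (nwr_problem R) single_successor).
Proof.
move=> L [p [verify [[M [q qP]] LP]]].
have out s u : size u <= (p.[size s])%R ->
    cf_tape (run M (pair_bits s u) (time p q s)) ord_max =1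
    tape_of M [:: verify (pair_bits s u)].
  move=> u_le; have [n n_le out] := qP (pair_bits s u).
  apply: run_halted out _; apply: leq_trans n_le _.
  rewrite /time; apply: leq_trans (leq_addr _ _); apply: horner_nat_mono.
  by rewrite size_pair_bits leq_add2l.
apply: (@cnf_hard R L (num_vars M p q) (num_clauses M p q) (@num_lit M p q)).
- have l := lf_time p q; rewrite /num_vars; lf.
- have l := lf_time p q; rewrite /num_clauses; lf.
- exact: lf_num_lit.
move=> s; suff E : ~ L s <-> satisfiable (num_vars M p q s) (num_clauses M p q s)
    (@num_lit M p q s).
  split=> [Ls|nS]; first by move/E.
  by apply: contrapT => /E.
rewrite satisfiable_models LP; split=> [[u u_le acc]|[A mA]].
  exists (@run_model M (pair_bits s u)); apply: run_models => //.
  by rewrite out // acc.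
have [u u_le Au] := models_run mA; exists u => //.
apply/negPn/negP => rej.
have T1 : 1 < time p q s by rewrite /time addn2.
have := Au _ (leqnn _) ord_max 1 T1; rewrite out // (negbTE rej) /tape_of /= => A1.
pose rho0 : rule M := rule_of (init_config M [::]).
have T0 : 0 < time p q s by apply: ltnW.
(* A rejecting run has the symbol of 0 in the answer cell; case 10 for that symbol forbids it. *)
have := mA (@Ordinal 11 10 isT, rho0, ord0, tm_bit M false) 0 0 0 T0 T0 T0.
rewrite /clause /=; case: eqP => [e|_]; last by rewrite /= /holds /= A1.
by have := tm_uniq M; rewrite /= !inE e eqxx ?andbF.
Qed.

Lemma reduces_to_restrict L (D : decision_problem) (Q : instance D -> Prop) :
  reduces_to L (restrict Q) -> reduces_to L D.
Proof. by case=> f fP H; exists f => // s; have [x e yx] := H s; exists (sval x). Qed.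

Theorem theorem4 (R : realType) :
  coNP_complete (nwr_problem R) /\
  coNP_hard (@restrict (nwr_problem R) single_successor).
Proof.
have hard := coNP_hard_single R; split=> //; split; first exact: nwr_coNP.
by move=> L /hard; exact: reduces_to_restrict.
Qed.
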